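(* Let $(u,p)$ be a weak solution (of the HHMO-model) in the transitional regime where $u^*_0<u^*<\Psi(\alpha)$. Then $p(x,t)=0$ for all $x$ large enough (i.e. there is $R>0$ such that $p(x,t)=0$ for all $x\ge R$ and all $t\ge 0$). Moreover, $u$ converges uniformly to the profile $\Phi_0$, i.e. $$\lim_{t\to\infty}\ \sup_{\eta\ge0}\,|u(\eta\sqrt t,t)-\Phi_0(\eta)|=0 .$$
   Context: Let $\alpha,\beta,u^*>0$ be constants. The HHMO-model is formally $u_t=u_{xx}+\frac{\alpha\beta}{2\sqrt t}\,\delta(x-\alpha\sqrt t)-p\,u$ for $x>0,t>0$, with $u_x(0,t)=0$ and $u(x,0)=0$ for $x>0$; it is extended to $x\in\mathbb{R}$ by even reflection. Let $$\Psi(\eta)=\frac{\alpha\beta}{2}e^{\alpha^2/4}\int_{\max\{|\eta|,\alpha\}}^\infty e^{-\zeta^2/4}\,d\zeta ,$$ and $\psi(x,t)=\Psi(x/\sqrt t)$ for $t>0$; for $t=0$, $\psi(x,0)=0$ if $x\ne0$ and $\psi(0,0)=\Psi(\alpha)$. A weak solution is a pair $(u,p)$ of functions on $\mathbb{R}\times[0,\infty)$ such that: (i) $u(x,t)=u(-x,t)$ and $p(x,t)=p(-x,t)$ for all $x\in\mathbb{R}$, $t\ge0$; (ii) for every $T>0$, $u-\psi$ is bounded on $\mathbb{R}\times[0,T]$, and $u-\psi$ and $\partial_x(u-\psi)$ are continuous on $\mathbb{R}\times[0,T]$; (iii) $p$ is measurable and $p(x,t)=0$ if $\sup_{s\in[0,t]}u(x,s)<u^*$,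 $p(x,t)\in[0,1]$ if $\sup_{s\in[0,t]}u(x,s)=u^*$, $p(x,t)=1$ if $\sup_{s\in[0,t]}u(x,s)>u^*$; (iv) $p(x,t)$ is non-decreasing in $t$ for every $x\in\mathbb{R}$; (v) for every $T>0$, $$\int_0^T\!\!\int_{\mathbb{R}}\varphi_t\,(u-\psi)\,dy\,ds=\int_0^T\!\!\int_{\mathbb{R}}\bigl(\varphi_x\,(u-\psi)_x+p\,u\,\varphi\bigr)\,dy\,ds$$ for every $\varphi$ with $\varphi,\varphi_x,\varphi_t$ continuous on $\mathbb{R}\times[0,T]$ that vanishes for large $|x|$ and for $t=T$. With $\operatorname{erf}(z)=\frac{2}{\sqrt\pi}\int_0^z e^{-y^2}dy$ and $\operatorname{erfc}=1-\operatorname{erf}$, and $M(a,b,z)=\sum_{n\ge0}\frac{(a)_n}{(b)_n}\frac{z^n}{n!}$ Kummer's function, $$u_0^*=\left(\frac{M(\frac32,\frac32,-\frac{\alpha^2}{4})}{\alpha\,M(\frac12,\frac32,-\frac{\alpha^2}{4})}+\frac{\exp(-\frac{\alpha^2}{4})}{\sqrt\pi\,\operatorname{erfc}(\frac\alpha2)}\right)^{-1}\frac{\alpha\beta}{2},$$ $$\Phi_0(\eta)=\begin{cases}\dfrac{u_0^*}{\operatorname{erf}(\frac\alpha2)}\operatorname{erf}(\frac\eta2)&\text{if }0\le\eta<\alpha,\\[1.5ex]\dfrac{u_0^*}{\operatorname{erfc}(\frac\alpha2)}\operatorname{erfc}(\frac\eta2)&\text{if }\eta\ge\alpha.\end{cases}$$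 *)

(* Defs.v *)
From HB Require Import structures.
From mathcomp Require Export all_boot all_order all_algebra.
From mathcomp Require Export all_classical all_reals all_analysis.
From mathcomp Require Export measurable_realfun.

Set Implicit Arguments.
Unset Strict Implicit.
Unset Printing Implicit Defensive.

Export Order.TTheory GRing.Theory Num.Theory.
Export numFieldNormedType.Exports.

Local Open Scope classical_set_scope.
Local Open Scope ring_scope.

Section SpecialFunctions.
Context {R : realType}.
Implicit Types (a b z eta : R) (n : nat).

Definition pochhammer a n : R := \prod_(i < n) (a + i%:R).

Definition kummerM a b z : R :=
  limn (series (fun n =>
    pochhammer a n / pochhammer b n * (z ^+ n / (n`!)%:R))).

Definition erf z : R :=
  2 / Num.sqrt pi *
    if 0 <= z then \int[lebesgue_measure]_(y in `[0, z]) expR (- y ^+ 2)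
    else - \int[lebesgue_measure]_(y in `[z, 0]) expR (- y ^+ 2).

Definition erfc z : R := 1 - erf z.

End SpecialFunctions.

Section HHMO.
Context {R : realType}.
Implicit Types (alpha beta ustar x t T eta : R) (u p phi phix phit : R -> R -> R).

Definition Psi alpha beta eta : R :=
  alpha * beta / 2 * expR (alpha ^+ 2 / 4) *
    \int[lebesgue_measure]_(zeta in `[Num.max `|eta| alpha, +oo[)
      expR (- zeta ^+ 2 / 4).

Definition psi alpha beta x t : R :=
  if 0 < t then Psi alpha beta (x / Num.sqrt t)
  else if x == 0 then Psi alpha beta alpha else 0.

Definition strip T : set (R * R) := [set z | 0 <= z.2 <= T].

(* Lebesgue measurability on the half-plane [R x [0, +oo[]: the product
   [lebesgue_measure \x lebesgue_measure] lives on the Borel sets, so the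
   source sigma-algebra is completed by its negligible sets. *)
Definition lebesgue_measurable_half_plane (f : R -> R -> R) : Prop :=
  let mu2 := (@lebesgue_measure R \x @lebesgue_measure R)%E in
  measurable_fun
    ([set z | 0 <= z.2] : set (g_sigma_algebraType (completed_algebra_gen mu2)))
    (fun z => f z.1 z.2).

(* [phix] and [phit] are the partial derivatives of [phi] on
   [R x [0, T]]; the time derivative is one-sided at [t = 0] and [t = T]. *)
Record test_function T phi phix phit : Prop := TestFunction {
  test_dx : forall x t, 0 <= t <= T ->
    is_derive x 1 (fun y => phi y t) (phix x t) ;
  test_dt : forall x t, 0 <= t <= T ->
    (phi x s - phi x t) / (s - t) @[s --> within `[0, T] t^'] --> phit x t ;
  test_cont : {within strip T, continuous (fun z => phi z.1 z.2)} ;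
  test_cont_dx : {within strip T, continuous (fun z => phix z.1 z.2)} ;
  test_cont_dt : {within strip T, continuous (fun z => phit z.1 z.2)} ;
  test_support : exists K : R, forall x t, 0 <= t <= T -> K < `|x| -> phi x t = 0 ;
  test_final : forall x, phi x T = 0 }.

Definition running_sup u x t : \bar R := ereal_sup [set (u x s)%:E | s in `[0, t]].

(* [u] and [p] are functions on [R x [0, +oo[]: no condition bears on their
   values at negative times. *)
Record weak_solution alpha beta ustar u p : Prop := WeakSolution {
  ws_even : forall x t, 0 <= t -> u x t = u (- x) t /\ p x t = p (- x) t ;
  ws_bounded : forall T, 0 < T -> exists M : R, forall x t, 0 <= t <= T ->
    `|u x t - psi alpha beta x t| <= M ;
  ws_cont : forall T, 0 < T ->
    {within strip T, continuous (fun z => u z.1 z.2 - psi alpha beta z.1 z.2)} ;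
  ws_derivable : forall x t, 0 <= t ->
    derivable (fun y => u y t - psi alpha beta y t) x 1 ;
  ws_cont_dx : forall T, 0 < T ->
    {within strip T, continuous
      (fun z => derive1 (fun y => u y z.2 - psi alpha beta y z.2) z.1)} ;
  ws_measurable : lebesgue_measurable_half_plane p ;
  ws_below : forall x t, 0 <= t -> (running_sup u x t < ustar%:E)%E -> p x t = 0 ;
  ws_at : forall x t, 0 <= t -> running_sup u x t = ustar%:E -> 0 <= p x t <= 1 ;
  ws_above : forall x t, 0 <= t -> (ustar%:E < running_sup u x t)%E -> p x t = 1 ;
  ws_monotone : forall x (s : R) t, 0 <= s -> s <= t -> p x s <= p x t ;
  ws_weak : forall T, 0 < T -> forall phi phix phit,
    test_function T phi phix phit ->
    \int[lebesgue_measure]_(s in `[0, T]) \int[lebesgue_measure]_y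
      (phit y s * (u y s - psi alpha beta y s)) =
    \int[lebesgue_measure]_(s in `[0, T]) \int[lebesgue_measure]_y
      (phix y s * derive1 (fun y' => u y' s - psi alpha beta y' s) y
       + p y s * u y s * phi y s) }.

Definition u0star alpha beta : R :=
  (kummerM (3 / 2) (3 / 2) (- (alpha ^+ 2 / 4)) /
     (alpha * kummerM (1 / 2) (3 / 2) (- (alpha ^+ 2 / 4))) +
   expR (- (alpha ^+ 2 / 4)) / (Num.sqrt pi * erfc (alpha / 2)))^-1 *
  (alpha * beta / 2).

(* Meaningful for [0 <= eta] only. *)
Definition Phi0 alpha beta eta : R :=
  if eta < alpha then u0star alpha beta / erf (alpha / 2) * erf (eta / 2)
  else u0star alpha beta / erfc (alpha / 2) * erfc (eta / 2).

End HHMO.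

(* Main.v *)
(* Write w = u - psi, P = Psi(alpha), E(x,t) = erfc(x / (2 sqrt t)) and
   G(x,t) = t^(-1/2) exp(-x^2/(4t)).  Since the Kummer quotients are error
   functions, u0* = P erf(alpha/2) and Phi_0(eta) = Psi(eta) - P erfc(eta/2) for
   eta >= 0, so that the claim is w + P E -> 0 uniformly on x >= 0.

   The difference w is C^1 in x and solves w_t = w_xx - p u weakly with zero initial
   datum.  If p u >= m near a point where w - phi has a local maximum (backward in
   time), phi smooth, then phi_t + m <= phi_xx there: after mollification in x this
   is the classical maximum principle.  Only pointwise bounds on p u enter, hence
   monotonicity of the integral suffices and the measurability of p is never used.
   Comparison with explicit barriers built from E, G and functions of x then gives
   - 0 <= u <= psi, hence -P <= w <= 0;
   - p = 1 and psi = P on a strip |x| <= c for large t, because u starts above u* at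
     the origin; on |x| <= L the value w + P is then dominated by a stationary
     supersolution A (1 + (c^2/2) ln (1 + x^2/c^2)) with A small plus a multiple of G,
     so w(0,t) -> -P;
   - w <= -(P - d) E + C G on x >= 0 for every d > 0 and all large t; hence u <= u0* + o(1)
     < u*, and p = 0 for large x;
   - then w solves the heat equation for large x, so w >= -P E - C G. *)
Require Import Defs.
From mathcomp Require Import ring lra.

Set Implicit Arguments.
Unset Strict Implicit.
Unset Printing Implicit Defensive.

Local Open Scope classical_set_scope.
Local Open Scope ring_scope.

(** * Integration without measurability *)

(* [lra] is slow in large contexts: keep only the arithmetic hypotheses. *)
Ltac keep_arith :=
  repeat match goal with H := _ |- _ => clearbody H end;
  repeat match goal with
  | H : ?T |- _ =>
    lazymatch T with
    | is_true _ => fail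
    | @eq _ _ _ => fail
    | _ /\ _ => fail
    | _ => clear H
    end
  end.
Ltac slra := keep_arith; lra.
Ltac snra := keep_arith; nra.

(** The main obstacle is that [w] has no time derivative and no second space derivative, because
    [p u] may be discontinuous. Products a(y) b(s) suffice as test functions: the factor in y turns
    the equation into an inequality for a continuous function of time alone, and the factor in s
    turns that into an inequality between two times. Only [C^1] regularity is asked of them, so
    quadratic splines serve, and their quadratic remainders make differentiation under the integral
    elementary.

    All smooth barriers are c1 E + c2 G + c3 t + f(x), with heat residual c3 - f''. The perturbation
    e x^2 + 3 e t does double duty: 3 e > 2 e makes the inequality strict, and e x^2 reduces the
    line to a bounded interval. A multiple of G pays for whatever the state is at the starting time
    and costs only O(t^(-1/2)) later.

    The function psi has kinks at |x| = alpha sqrt t. It is however the minimum of P, K E(x,t) and K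
    E(-x,t), with K the factor of erfc in Psi, so a smooth function touches it from above at every
    point, and this is all that the maximum principle needs. *)

Section Unmeasurable.
Context d (T : measurableType d) (R : realType) (mu : {measure set T -> \bar R}).
Implicit Types (D : set T) (f g : T -> R).
Local Open Scope ereal_scope.

(** The integral of a nonnegative function is the supremum of the integrals of the simple functions
    below it, so monotonicity is free of measurability; additivity would not be. *)
Lemma ge0_le_integral_unmeasurable D (f g : T -> \bar R) :
  (forall x, D x -> 0 <= f x) -> (forall x, D x -> f x <= g x) ->
  \int[mu]_(x in D) f x <= \int[mu]_(x in D) g x.
Proof.
move=> f0 fg; rewrite !ge0_integralE//; last first.
  by move=> x Dx; exact: le_trans (f0 _ Dx) (fg _ Dx).
apply: ereal_sup_le => _ [h /= hf <-]; exists h => //= x.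
apply: le_trans (hf x) _; rewrite /patch; case: ifPn => // /set_mem Dx.
exact: fg.
Qed.

Lemma bounded_integral_fin_num D f (M : R) : measurable D -> mu D < +oo ->
  (forall x, D x -> 0 <= f x <= M)%R -> \int[mu]_(x in D) (f x)%:E \is a fin_num.
Proof.
move=> mD Dfin fM; rewrite ge0_fin_numE; last first.
  by apply: integral_ge0 => x /fM /andP[f0 _]; rewrite lee_fin.
have : \int[mu]_(x in D) (f x)%:E <= \int[mu]_(x in D) (M%:E).
  apply: ge0_le_integral_unmeasurable => x /fM /andP[? ?]; by rewrite lee_fin.
move=> /le_lt_trans; apply; rewrite integral_cst//.
have [->|/set0P[x Dx]] := eqVneq D set0; first by rewrite measure0 mule0 ltry.
by rewrite lte_mul_pinfty// lee_fin; have /andP[/le_trans h /h] := fM _ Dx.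
Qed.

(** The integral is the difference of those of the positive and negative parts; a bound on a set of
    finite measure makes this a difference of real numbers. *)
Lemma integral_EFin_parts D f (M : R) : measurable D -> mu D < +oo ->
    (forall x, D x -> `|f x| <= M)%R ->
  exists a b : R, [/\ \int[mu]_(x in D) (Num.max (f x) 0)%:E = a%:E,
    \int[mu]_(x in D) (Num.max (- f x) 0)%:E = b%:E &
    \int[mu]_(x in D) (f x)%:E = (a - b)%:E].
Proof.
move=> mD Dfin fM.
have h1 : \int[mu]_(x in D) (Num.max (f x) 0)%:E \is a fin_num.
  apply: (@bounded_integral_fin_num _ _ M) => // x /fM fxM.
  rewrite le_max lexx orbT/= ge_max (le_trans (ler_norm _) fxM)/=.
  exact: le_trans fxM.
have h2 : \int[mu]_(x in D) (Num.max (- f x) 0)%:E \is a fin_num.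
  apply: (@bounded_integral_fin_num _ _ M) => // x /fM fxM.
  rewrite le_max lexx orbT/= ge_max (le_trans (normr_ge0 _) fxM) andbT.
  by apply: le_trans fxM; rewrite -normrN ler_norm.
exists (fine (\int[mu]_(x in D) (Num.max (f x) 0)%:E)),
  (fine (\int[mu]_(x in D) (Num.max (- f x) 0)%:E)).
rewrite !fineK//; split => //.
rewrite integralE EFinB !fineK//; congr (_ - _); apply: eq_integral => x _.
  by rewrite funeposE EFin_max.
by rewrite funenegE EFin_max.
Qed.

Local Close Scope ereal_scope.

Lemma le_Rintegral_unmeasurable D f g (M : R) :
  measurable D -> (mu D < +oo)%E ->
  (forall x, D x -> `|f x| <= M) -> (forall x, D x -> `|g x| <= M) ->
  (forall x, D x -> f x <= g x) ->
  \int[mu]_(x in D) f x <= \int[mu]_(x in D) g x.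
Proof.
move=> mD Dfin fM gM fg.
have [a [b [fa fb fab]]] := integral_EFin_parts mD Dfin fM.
have [a' [b' [ga gb gab]]] := integral_EFin_parts mD Dfin gM.
rewrite /Rintegral fab gab/= lerB// -lee_fin -?fa -?fb -?ga -?gb;
  apply: ge0_le_integral_unmeasurable => x Dx; rewrite lee_fin.
- by rewrite le_max lexx orbT.
- by rewrite ge_max le_max fg//= le_max lexx orbT.
- by rewrite le_max lexx orbT.
- by rewrite ge_max le_max lerN2 fg//= le_max lexx orbT.
Qed.

(** Negation merely exchanges the two parts, hence commutes with the integral even where additivity
    is out of reach. *)
Lemma RintegralN_unmeasurable D f (M : R) : measurable D -> (mu D < +oo)%E ->
  (forall x, D x -> `|f x| <= M) ->
  \int[mu]_(x in D) (- f x) = - \int[mu]_(x in D) f x.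
Proof.
move=> mD Dfin fM.
have [a [b [fa fb fab]]] := integral_EFin_parts mD Dfin fM.
have fMN x : D x -> `|- f x| <= M by rewrite normrN; exact: fM.
have [a' [b' [ga gb gab]]] := integral_EFin_parts mD Dfin fMN.
rewrite /Rintegral fab gab/= opprB; congr (_ - _); apply: EFin_inj.
  by rewrite -ga -fb.
by rewrite -gb -fa; under eq_integral do rewrite opprK.
Qed.

Lemma normr_Rintegral_unmeasurable D f (M : R) : measurable D -> (mu D < +oo)%E ->
  (forall x, D x -> `|f x| <= M) ->
  `|\int[mu]_(x in D) f x| <= M * fine (mu D).
Proof.
move=> mD Dfin fM; have [D0|/set0P[x Dx]] := eqVneq D set0.
  by rewrite D0 Rintegral_set0 measure0/= mulr0 normr0.
have M0 : 0 <= M by exact: le_trans (fM _ Dx).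
rewrite -Rintegral_cst// ler_norml -(@RintegralN_unmeasurable _ (cst M) M)//;
  last by move=> ? _; rewrite ger0_norm.
apply/andP; split; apply: (@le_Rintegral_unmeasurable _ _ _ M) => // y Dy.
- by rewrite normrN ger0_norm.
- by have := fM _ Dy; rewrite ler_norml => /andP[].
- by rewrite ger0_norm.
- by have := fM _ Dy; rewrite ler_norml => /andP[].
Qed.

End Unmeasurable.

(** * Integrals of continuous functions over segments *)

Section SegmentIntegral.
Context {R : realType}.
Notation mu := (@lebesgue_measure R).
Implicit Types (f g : R -> R) (a b : R).

Lemma continuous_integrable f a b : continuous f ->
  mu.-integrable `[a, b] (EFin \o f).
Proof.
move=> cf; apply: continuous_compact_integrable; first exact: segment_compact.
exact: continuous_subspaceT.
Qed.

Lemma segment_finite a b : (mu `[a, b] < +oo)%E.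
Proof. by rewrite lebesgue_measure_itv; case: ifP => _; rewrite ?ltry. Qed.

Lemma fine_segment a b : a <= b -> fine (mu `[a, b]) = b - a.
Proof.
rewrite le_eqVlt lebesgue_measure_itv/= lte_fin => /predU1P[->|->//].
by rewrite ltxx subrr.
Qed.

Lemma RintegralDc f g a b : continuous f -> continuous g ->
  \int[mu]_(x in `[a, b]) (f x + g x) =
  \int[mu]_(x in `[a, b]) f x + \int[mu]_(x in `[a, b]) g x.
Proof. by move=> cf cg; rewrite RintegralD//; exact: continuous_integrable. Qed.

Lemma RintegralBc f g a b : continuous f -> continuous g ->
  \int[mu]_(x in `[a, b]) (f x - g x) =
  \int[mu]_(x in `[a, b]) f x - \int[mu]_(x in `[a, b]) g x.
Proof. by move=> cf cg; rewrite RintegralB//; exact: continuous_integrable. Qed.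

Lemma RintegralZc f k a b : continuous f ->
  \int[mu]_(x in `[a, b]) (k * f x) = k * \int[mu]_(x in `[a, b]) f x.
Proof. by move=> cf; rewrite RintegralZl//; exact: continuous_integrable. Qed.

Lemma le_Rintegralc f g a b : continuous f -> continuous g ->
  (forall x, a <= x <= b -> f x <= g x) ->
  \int[mu]_(x in `[a, b]) f x <= \int[mu]_(x in `[a, b]) g x.
Proof.
by move=> cf cg fg; apply: le_Rintegral => //; exact: continuous_integrable.
Qed.

Lemma normr_Rintegral_segment f a b (M : R) : a <= b ->
  (forall x, a <= x <= b -> `|f x| <= M) ->
  `|\int[mu]_(x in `[a, b]) f x| <= M * (b - a).
Proof.
move=> ab fM; rewrite -fine_segment//.
apply: normr_Rintegral_unmeasurable => //; first exact: segment_finite.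
Qed.

Lemma is_derive_continuous f (x df : R) : is_derive x 1 f df ->
  {for x, continuous f}.
Proof.
move=> fx; apply: differentiable_continuous; apply/derivable1_diffP.
exact: ex_derive.
Qed.

Lemma Rintegral_FTC2 (F f : R -> R) a b : a <= b -> continuous f ->
  (forall x : R, is_derive x 1 F (f x)) ->
  \int[mu]_(x in `[a, b]) f x = F b - F a.
Proof.
rewrite le_eqVlt => /predU1P[-> _ _|ab cf dF].
  by rewrite set_itv1 Rintegral_set1 subrr.
have cF : continuous F by move=> x; exact: is_derive_continuous (dF x).
rewrite /Rintegral (@continuous_FTC2 _ f F)//.
- exact: continuous_subspaceT.
- split.
  + by move=> x _; have ? := dF x; exact: ex_derive.
  + by apply: cvg_at_right_filter; exact: cF.
  + by apply: cvg_at_left_filter; exact: cF.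
- by move=> x _; rewrite derive1E; have := dF x => h; rewrite derive_val.
Qed.

Lemma Rintegral_support f a b : (forall x, ~~ (a <= x <= b) -> f x = 0) ->
  \int[mu]_x f x = \int[mu]_(x in `[a, b]) f x.
Proof.
move=> f0; rewrite [RHS]Rintegral_mkcond; congr Rintegral; apply/funext => x.
rewrite patchE; case: ifPn => // xab; apply: f0; apply: contraNN xab => xab.
by rewrite inE/= in_itv.
Qed.

End SegmentIntegral.

(** * Spline test functions *)

Section QuadraticRemainder.
Context {R : realType}.
Implicit Types (f g : R -> R) (x l df dg k c : R).

(** A uniform quadratic remainder survives integration against a bounded function; this is why
    remainders, not just derivatives, are recorded for the splines below. *)
Lemma is_derive_quadratic f x l (C : R) :
  (forall h, `|h| <= 1 -> `|f (x + h) - f x - h * l| <= C * h ^+ 2) ->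
  is_derive x 1 f l.
Proof.
move=> H.
have C0 : 0 <= C.
  have := H 1; rewrite normr1 lexx expr1n mulr1 => /(_ isT); exact: le_trans.
have cv : h^-1 *: (f (h *: 1 + x) - f x) @[h --> 0^'] --> l.
  apply/cvgrPdist_le => e e0.
  near=> h.
  have h0 : h != 0 by near: h; exact: nbhs_dnbhs_neq.
  have h1 : `|h| <= 1 by near: h; apply: dnbhs0_le.
  have he : `|h| <= e / (C + 1) by near: h; apply: dnbhs0_le; rewrite divr_gt0// ltr_wpDl.
  have -> : l - h^-1 *: (f (h *: 1 + x) - f x) =
            - h^-1 * (f (x + h) - f x - h * l).
    rewrite /GRing.scale/= mulr1 (addrC h x); field; exact: h0.
  rewrite normrM normrN normfV ler_pdivrMl ?normr_gt0//.
  apply: le_trans (H _ h1) _; rewrite -(real_normK (num_real h)).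
  have : `|h| * (C + 1) <= e by rewrite -ler_pdivlMr// ltr_wpDl.
  have := normr_ge0 h; nra.
apply: DeriveDef; last exact: cvg_lim cv.
by apply/cvg_ex; exists l.
Unshelve. all: by end_near. Qed.

Lemma is_derive_add f g x df dg : is_derive x 1 f df -> is_derive x 1 g dg ->
  is_derive x 1 (fun y => f y + g y) (df + dg).
Proof. by move=> *; exact: is_deriveD. Qed.

Lemma is_derive_sub f g x df dg : is_derive x 1 f df -> is_derive x 1 g dg ->
  is_derive x 1 (fun y => f y - g y) (df - dg).
Proof. by move=> *; exact: is_deriveB. Qed.

Lemma is_derive_mul f g x df dg : is_derive x 1 f df -> is_derive x 1 g dg ->
  is_derive x 1 (fun y => f y * g y) (df * g x + f x * dg).
Proof.
move=> hf hg; rewrite addrC (mulrC df).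
exact: (@is_deriveM _ _ f g x 1 df dg hf hg).
Qed.

Lemma is_derive_scale k f x df : is_derive x 1 f df ->
  is_derive x 1 (fun y => k * f y) (k * df).
Proof. by move=> hf; exact: (@is_deriveZ _ _ _ f k x 1 df). Qed.

Lemma is_derive_const c x : is_derive x 1 (fun=> c) 0.
Proof. exact: (@is_derive_cst _ _ _ c x 1). Qed.

Lemma is_derive_sqr_sub c x : is_derive x 1 (fun y => (y - c) ^+ 2) (2 * (x - c)).
Proof.
apply: (@is_derive_quadratic _ _ _ 1) => h _.
by rewrite (_ : _ - _ = h ^+ 2) ?ger0_norm ?sqr_ge0 ?mul1r//; ring.
Qed.

Lemma is_derive_affine (k c x : R) : is_derive x 1 (fun y => k * y + c) k.
Proof.
apply: (@is_derive_quadratic _ _ _ 0) => h _; rewrite mul0r.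
by rewrite (_ : _ - _ = 0) ?normr0//; ring.
Qed.

Lemma is_derive_comp_affine f (k c x df : R) :
  is_derive (k * x + c) 1 f df ->
  is_derive x 1 (fun y => f (k * y + c)) (k * df).
Proof.
by move=> dfx; rewrite mulrC; apply: is_derive1_comp; exact: is_derive_affine.
Qed.

Definition sqpos x := Num.max 0 x ^+ 2.

Lemma sqpos_quadratic x h :
  `|sqpos (x + h) - sqpos x - h * (2 * Num.max 0 x)| <= h ^+ 2.
Proof.
rewrite ler_norml /sqpos.
by rewrite /Num.max; case: ltrP => ?; case: ltrP => ?; apply/andP; split; nra.
Qed.

Lemma continuous_max0 : continuous (fun x : R => Num.max 0 x).
Proof.
move=> x; apply: (@continuous_max R R (cst 0) id); first exact: cvg_cst.
exact: cvg_id.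
Qed.

(* The primitive of the hat function supported on [0, 1], a quadratic spline. *)
Definition ramp x := 2 * (sqpos x - 2 * sqpos (x - 2^-1) + sqpos (x - 1)).
Definition hat x :=
  4 * (Num.max 0 x - 2 * Num.max 0 (x - 2^-1) + Num.max 0 (x - 1)).

(** The constant is 2 (1 + 2 + 1), the sum of the remainders of the three squares. *)
Lemma ramp_quadratic x h : `|ramp (x + h) - ramp x - h * hat x| <= 8 * h ^+ 2.
Proof.
rewrite /ramp /hat.
have := sqpos_quadratic x h; have := sqpos_quadratic (x - 2^-1) h.
have := sqpos_quadratic (x - 1) h.
rewrite !ler_norml -!(addrAC _ h) => /andP[? ?] /andP[? ?] /andP[? ?].
by apply/andP; split; nra.
Qed.

Lemma is_derive_ramp x : is_derive x 1 ramp (hat x).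
Proof. by apply: (@is_derive_quadratic _ _ _ 8) => h _; exact: ramp_quadratic. Qed.

Lemma continuous_hat : continuous hat.
Proof.
have h c : continuous (fun x : R => Num.max 0 (x - c)).
  move=> x; apply: (@continuous_max R R (cst 0) (fun x => x - c)).
    exact: cvg_cst.
  by apply: cvgB; [exact: cvg_id|exact: cvg_cst].
move=> x; apply: cvgM; first exact: cvg_cst.
apply: cvgD; last exact: h.
apply: cvgB; first exact: continuous_max0.
apply: cvgM; first exact: cvg_cst.
exact: h.
Qed.

Lemma hat_ge0 x : 0 <= hat x.
Proof.
by rewrite /hat /Num.max; do 3 case: ltrP => ?; lra.
Qed.

Lemma hat_left x : x <= 0 -> hat x = 0.
Proof. by move=> ?; rewrite /hat /Num.max; do 3 case: ltrP => ?; lra. Qed.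

Lemma hat_right x : 1 <= x -> hat x = 0.
Proof. by move=> ?; rewrite /hat /Num.max; do 3 case: ltrP => ?; lra. Qed.

Lemma ramp_left x : x <= 0 -> ramp x = 0.
Proof. by move=> ?; rewrite /ramp /sqpos /Num.max; do 3 case: ltrP => ?; nra. Qed.

Lemma ramp_right x : 1 <= x -> ramp x = 1.
Proof. by move=> ?; rewrite /ramp /sqpos /Num.max; do 3 case: ltrP => ?; nra. Qed.

Lemma ramp_mono x y : x <= y -> ramp x <= ramp y.
Proof.
rewrite le_eqVlt => /predU1P[->//|xy].
have [z _ e] := @MVT R ramp hat x y xy (fun z _ => is_derive_ramp z)
  (continuous_subspaceT (fun z => is_derive_continuous (is_derive_ramp z))).
by rewrite -subr_ge0 e mulr_ge0 ?hat_ge0// subr_ge0 ltW.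
Qed.

Lemma ramp01 x : 0 <= ramp x <= 1.
Proof.
have [x0|x0] := lerP x 0; first by rewrite ramp_left// lexx ler01.
have [x1|x1] := lerP 1 x; first by rewrite ramp_right// lexx ler01.
rewrite -{1}(ramp_left (lexx 0)) -(ramp_right (lexx 1)).
by rewrite !ramp_mono// ltW.
Qed.

End QuadraticRemainder.

(** * Trapezoidal cutoff functions *)

Section Trapezoid.
Context {R : realType}.
Notation mu := (@lebesgue_measure R).
Implicit Types (h l r s : R).

(** For [l + h <= r], a [C^1] cutoff that rises from 0 to 1 on [[l, l + h]] and falls back on
    [[r, r + h]]. It serves as cutoff in time and, in the form [trap rho (- rho) 0], as mollifier in
    space. *)
Definition trap h l r s := ramp (h^-1 * s - h^-1 * l) - ramp (h^-1 * s - h^-1 * r).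
Definition dtrap h l r s :=
  h^-1 * hat (h^-1 * s - h^-1 * l) - h^-1 * hat (h^-1 * s - h^-1 * r).

Lemma is_derive_ramp_affine h l s :
  is_derive s 1 (fun s => ramp (h^-1 * s - h^-1 * l)) (h^-1 * hat (h^-1 * s - h^-1 * l)).
Proof. by apply: (@is_derive_comp_affine _ ramp); exact: is_derive_ramp. Qed.

Lemma continuous_hat_affine h l :
  continuous (fun s => h^-1 * hat (h^-1 * s - h^-1 * l)).
Proof.
move=> s; apply: cvgM; first exact: cvg_cst.
apply: (@continuous_comp R R R (fun s => h^-1 * s - h^-1 * l) hat).
  apply: cvgB; last exact: cvg_cst.
  by apply: cvgM; [exact: cvg_cst|exact: cvg_id].
exact: continuous_hat.
Qed.

Lemma is_derive_trap h l r s : is_derive s 1 (trap h l r) (dtrap h l r s).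
Proof. by apply: is_deriveB; exact: is_derive_ramp_affine. Qed.

Lemma continuous_dtrap h l r : continuous (dtrap h l r).
Proof. by move=> s; apply: cvgB; exact: continuous_hat_affine. Qed.

Lemma continuous_trap h l r : continuous (trap h l r).
Proof. by move=> s; exact: is_derive_continuous (is_derive_trap _ _ _ _). Qed.

Lemma trap_ge0 h l r s : 0 < h -> l <= r -> 0 <= trap h l r s.
Proof.
move=> h0 lr; rewrite subr_ge0; apply: ramp_mono.
by rewrite lerB// ler_pM2l ?invr_gt0.
Qed.

Lemma trap_out h l r s : 0 < h -> l <= r -> ~~ (l < s < r + h) -> trap h l r s = 0.
Proof.
move=> h0 lr; rewrite negb_and -!leNgt /trap => /orP[sl|rs].
  rewrite !ramp_left ?subrr// subr_le0 ler_pM2l ?invr_gt0//; lra.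
rewrite !ramp_right ?subrr// -mulrBr ler_pdivlMl//; lra.
Qed.

Lemma dtrap_out h l r s : 0 < h -> l <= r -> ~~ (l < s < r + h) -> dtrap h l r s = 0.
Proof.
move=> h0 lr; rewrite negb_and -!leNgt /dtrap => /orP[sl|rs].
  rewrite !hat_left ?subrr// subr_le0 ler_pM2l ?invr_gt0//; lra.
rewrite !hat_right ?subrr// -mulrBr ler_pdivlMl//; lra.
Qed.

Lemma trap_quadratic h l r s d :
  `|trap h l r (s + d) - trap h l r s - d * dtrap h l r s| <= 16 * h^-1 ^+ 2 * d ^+ 2.
Proof.
have aux c : `|ramp (h^-1 * (s + d) - h^-1 * c) - ramp (h^-1 * s - h^-1 * c) -
    d * (h^-1 * hat (h^-1 * s - h^-1 * c))| <= 8 * (h^-1 * d) ^+ 2.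
  rewrite mulrA (mulrC d) (_ : _ * (s + d) - _ = h^-1 * s - h^-1 * c + h^-1 * d).
    exact: ramp_quadratic.
  by ring.
have := aux l; have := aux r; rewrite exprMn /trap /dtrap !ler_norml.
by move=> /andP[? ?] /andP[? ?]; apply/andP; split; lra.
Qed.

Lemma Rintegral_trap_gt0 h l r L U : 0 < h -> l <= r -> L <= l -> r + h <= U ->
  l + h <= r -> 0 < \int[mu]_(s in `[L, U]) trap h l r s.
Proof.
move=> h0 lr Ll rU lhr.
(* On [[l + h / 2, l + h]] the rising part is at least [ramp 2^-1], which is 1/2, and the falling
   part has not started. *)
apply: (@lt_le_trans _ _ (2^-1 * (h / 2))); first by rewrite mulr_gt0// divr_gt0.
have -> : 2^-1 * (h / 2) =
    \int[mu]_(s in `[L, U]) ((cst 2^-1 : R -> R) \_ `[l + h / 2, l + h]) s.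
  rewrite -Rintegral_mkcondr setIidr; last first.
    by move=> s /=; rewrite !in_itv/=; lra.
  rewrite Rintegral_cst//= fine_segment; [congr (_ * _); lra|lra].
have in01 s : 0 <= trap h l r s <= 1.
  rewrite trap_ge0//= /trap.
  have /andP[_ ?] := ramp01 (h^-1 * s - h^-1 * l).
  have /andP[? _] := ramp01 (h^-1 * s - h^-1 * r); lra.
apply: (@le_Rintegral_unmeasurable _ _ _ _ _ _ _ 1) => //.
- exact: segment_finite.
- by move=> s _; rewrite patchE; case: ifP => _ /=; rewrite ger0_norm//; lra.
- by move=> s _; have /andP[? ?] := in01 s; rewrite ger0_norm.
move=> s _; rewrite patchE; case: ifPn => [|_]; last by have /andP[] := in01 s.
rewrite inE/= in_itv/= => /andP[s1 s2].
rewrite /trap [ramp (_ - h^-1 * r)]ramp_left ?subr0; last first.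
  by rewrite subr_le0 ler_pM2l ?invr_gt0//; lra.
have -> : (2^-1 : R) = ramp 2^-1.
  by rewrite /ramp /sqpos /Num.max; do 3 case: ltrP => ?; lra.
apply: ramp_mono; rewrite -mulrBr ler_pdivlMl//; lra.
Qed.

End Trapezoid.

(** * From a weak differential inequality to an inequality between two times *)

Section WeakDecrease.
Context {R : realType}.
Notation mu := (@lebesgue_measure R).

(** [dtrap] is the difference of two kernels of mass 1, one just after [l] and one just before [r],
    so its pairing with [A] approximates [A l - A r]. A contradiction argument with one small [h]
    avoids passing to the limit. *)
Lemma weak_derivative_le (A : R -> R) (q l r T : R) :
  continuous A -> 0 <= l -> l < r -> r <= T ->
  (forall h, 0 < h -> 2 * h <= r - l ->
    q * \int[mu]_(s in `[0, T]) trap h l (r - h) s <=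
    \int[mu]_(s in `[0, T]) (dtrap h l (r - h) s * A s)) ->
  A r - A l <= - q * (r - l).
Proof.
move=> cA l0 lr rT H; rewrite leNgt; apply/negP => Hlt.
pose D s := A s + q * s.
have cD : continuous D.
  move=> s; apply: cvgD; first exact: cA.
  by apply: cvgM; [exact: cvg_cst|exact: cvg_id].
have Dlr : D l < D r by rewrite /D; nra.
pose mid := (D l + D r) / 2; pose e := (D r - D l) / 4.
have e0 : 0 < e by rewrite divr_gt0// subr_gt0.
have [d1 /= d10 H1] : exists2 d, 0 < d & forall s, `|l - s| < d -> D s <= mid - e.
  have /cvgrPdist_le /(_ _ e0) := cD l.
  move=> /nbhs_ballP[d /= d0 hd]; exists d => // s /hd.
  by rewrite ler_norml /mid => /andP[]; rewrite /e; lra.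
have [d2 /= d20 H2] : exists2 d, 0 < d & forall s, `|r - s| < d -> mid + e <= D s.
  have /cvgrPdist_le /(_ _ e0) := cD r.
  move=> /nbhs_ballP[d /= d0 hd]; exists d => // s /hd.
  by rewrite ler_norml /mid => /andP[]; rewrite /e; lra.
(* Small enough for each kernel to see [D] on its own side of [mid] only, and for the two kernels
   not to overlap. *)
pose h := Num.min (Num.min (d1 / 2) (d2 / 2)) ((r - l) / 2).
have h0 : 0 < h by rewrite !lt_min !divr_gt0//= subr_gt0.
have hd1 : h < d1.
  apply: (@le_lt_trans _ _ (d1 / 2)); first by rewrite !ge_min lexx.
  by lra.
have hd2 : h < d2.
  apply: (@le_lt_trans _ _ (d2 / 2)); first by rewrite !ge_min lexx orbT.
  by lra.
have hrl : 2 * h <= r - l.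
  by rewrite -ler_pdivlMl// mulrC !ge_min lexx orbT.
have {}H := H h h0 hrl.
pose b := trap h l (r - h); pose b' := dtrap h l (r - h).
pose k1 s := h^-1 * hat (h^-1 * s - h^-1 * l).
have hi0 : 0 <= h^-1 by rewrite invr_ge0 ltW.
(* Near [l] the factor [b'] is nonnegative and [D - mid] is at most [- e]; near [r] both signs
   flip. *)
have pw s : b' s * (D s - mid) <= - e * k1 s.
  rewrite /b' /dtrap -/(k1 s); set k2 := h^-1 * hat (h^-1 * s - _).
  have k10 : 0 <= k1 s by rewrite mulr_ge0// hat_ge0.
  have k20 : 0 <= k2 by rewrite mulr_ge0// hat_ge0.
  have k1l : s < l -> k1 s = 0.
    by move=> ?; rewrite /k1 hat_left ?mulr0// subr_le0 ler_wpM2l// ltW.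
  have k1r : l + h < s -> k1 s = 0.
    move=> ?; rewrite /k1 hat_right ?mulr0// -mulrBr ler_pdivlMl//; slra.
  have k2l : s <= r - h -> k2 = 0.
    by move=> ?; rewrite /k2 hat_left ?mulr0// subr_le0 ler_wpM2l//.
  have k2r : r < s -> k2 = 0.
    move=> ?; rewrite /k2 hat_right ?mulr0// -mulrBr ler_pdivlMl//; slra.
  have [sl|ls] := ltrP s l; first by rewrite k1l// k2l; slra.
  have [sl|ls'] := ltrP (l + h) s; last first.
    rewrite k2l; last slra.
    have D1 : D s <= mid - e by apply: H1; rewrite distrC ger0_norm; slra.
    by rewrite subr0 mulrC ler_wpM2r//; slra.
  rewrite k1r// sub0r mulr0.
  have [sr|rs] := ltrP r s; first by rewrite k2r; slra.
  have [sr|rs'] := lerP s (r - h); first by rewrite k2l; slra.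
  have D2 : mid + e <= D s by apply: H2; rewrite ger0_norm; slra.
  by rewrite mulNr oppr_le0 mulr_ge0//; slra.
have cb : continuous b by exact: continuous_trap.
have cb' : continuous b' by exact: continuous_dtrap.
have ck1 : continuous k1 by exact: continuous_hat_affine.
have cDm : continuous (fun s => b' s * (D s - mid)).
  move=> s; apply: cvgM; first exact: cb'.
  by apply: cvgB; [exact: cD|exact: cvg_cst].
have T0 : 0 <= T by slra.
have int1 : \int[mu]_(s in `[0, T]) k1 s = 1.
  rewrite (Rintegral_FTC2 T0 ck1 (is_derive_ramp_affine h l)).
  rewrite ramp_right; last by rewrite -mulrBr ler_pdivlMl//; slra.
  by rewrite ramp_left ?subr0// mulr0 sub0r oppr_le0 mulr_ge0.
have upper : \int[mu]_(s in `[0, T]) (b' s * (D s - mid)) <= - e.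
  rewrite -[leRHS]mulr1 -int1 -RintegralZc//.
  by apply: le_Rintegralc => // s; apply: cvgM; [exact: cvg_cst|exact: ck1].
have cg : continuous (fun s => b s * q + b' s * (q * s - mid)).
  move=> s; apply: cvgD; first by apply: cvgM; [exact: cb|exact: cvg_cst].
  apply: cvgM; first exact: cb'.
  apply: cvgB; last exact: cvg_cst.
  by apply: cvgM; [exact: cvg_cst|exact: cvg_id].
(* Integration by parts: this is the derivative of [b s * (q * s - mid)], and [b] vanishes at both
   ends. Hence the constant [mid] costs nothing and the term [q * s] accounts for the integral of
   [q * b]. *)
have int0 : \int[mu]_(s in `[0, T]) (b s * q + b' s * (q * s - mid)) = 0.
  have dg (s : R) : is_derive s 1 (fun s => b s * (q * s - mid))
      (b s * q + b' s * (q * s - mid)).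
    rewrite (mulrC (b' s)).
    have h1 := is_derive_trap h l (r - h) s.
    have h2 := is_derive_affine q (- mid) s.
    exact: (@is_deriveM _ _ b (fun s => q * s - mid) s 1 (b' s) q).
  by rewrite (Rintegral_FTC2 T0 cg dg) /b !trap_out ?mul0r ?subrr//; slra.
have cbA : continuous (fun s => b' s * A s) by move=> s; apply: cvgM; [exact: cb'|exact: cA].
have cqb : continuous (fun s => q * b s) by move=> s; apply: cvgM; [exact: cvg_cst|exact: cb].
have : 0 <= \int[mu]_(s in `[0, T]) (b' s * (D s - mid)).
  rewrite (_ : \int[mu]_(s in _) _ = \int[mu]_(s in `[0, T])
      ((b' s * A s - q * b s) + (b s * q + b' s * (q * s - mid)))); last first.
    by apply: eq_Rintegral => s _; rewrite /D; ring.
  rewrite RintegralDc//; last by move=> s; apply: cvgB; [exact: cbA|exact: cqb].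
  by rewrite int0 addr0 RintegralBc// RintegralZc// subr_ge0.
slra.
Qed.

End WeakDecrease.

(** * Parametric integrals and calculus *)

Lemma continuous_pair (T U V : topologicalType) (f : T -> U) (g : T -> V) x :
  {for x, continuous f} -> {for x, continuous g} ->
  {for x, continuous (fun t => (f t, g t))}.
Proof.
move=> cf cg.
exact: (@cvg_pair _ _ _ (nbhs x) (nbhs (f x)) (nbhs (g x)) _ _ _ f g cf cg).
Qed.

Lemma continuous_comp2 (T U V W : topologicalType) (F : U * V -> W)
    (f : T -> U) (g : T -> V) x :
  {for x, continuous f} -> {for x, continuous g} ->
  {for (f x, g x), continuous F} -> {for x, continuous (fun t => F (f t, g t))}.
Proof.
move=> cf cg cF.
exact: (@continuous_comp _ _ _ (fun t => (f t, g t)) F x (continuous_pair cf cg) cF).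
Qed.

Section ParametricIntegral.
Context {R : realType}.
Notation mu := (@lebesgue_measure R).

(** Compactness of the segment makes continuity in the parameter uniform in [y]. The parameter space
    is arbitrary because both times and points of the plane occur as parameters. *)
Lemma tube_continuity (Q : topologicalType) (F : R * Q -> R) (q : Q) (L U e : R) :
  continuous F -> 0 < e ->
  \forall q' \near q, forall y, L <= y <= U -> `|F (y, q') - F (y, q)| <= e.
Proof.
move=> cF e0.
have /compact_near_coveringP K := @segment_compact R L U.
suff : \forall q' \near q, `[L, U] `<=` (fun y => `|F (y, q') - F (y, q)| <= e).
  move=> Hn; apply: (@filterS _ _ (nbhs_filter q) _ _ _ Hn) => q' h y yLU; apply: h.
  by rewrite /= in_itv.
apply: (K Q (nbhs q) (fun q' y => `|F (y, q') - F (y, q)| <= e)) => y _.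
have cG : {for (y, q), continuous (fun p : R * Q => F p - F (p.1, q))}.
  apply: (@continuousB _ _ _ F (fun p : R * Q => F (p.1, q))); first exact: cF.
  apply: (@continuous_comp2 _ _ _ _ F fst (cst q)); last exact: cF.
    exact: cvg_fst.
  exact: cvg_cst.
have /cvgrPdist_le/(_ _ e0) := cG.
rewrite /= subrr; apply: filterS => -[y' q'] /=.
by rewrite sub0r normrN.
Qed.

Lemma continuous_slice (Q : topologicalType) (F : R * Q -> R) q :
  continuous F -> continuous (fun y => F (y, q)).
Proof.
move=> cF y; apply: (@continuous_comp2 _ _ _ _ F id (cst q)); last exact: cF.
  exact: cvg_id.
exact: cvg_cst.
Qed.

Lemma continuous_Rintegral (Q : topologicalType) (F : R * Q -> R) (L U : R) :
  L <= U -> continuous F ->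
  continuous (fun q => \int[mu]_(y in `[L, U]) F (y, q)).
Proof.
move=> LU cF q; apply/cvgrPdist_le => e e0.
have e'0 : 0 < e / (U - L + 1) by rewrite divr_gt0//; lra.
have := @tube_continuity Q F q L U _ cF e'0; apply: filterS => q' h.
rewrite -RintegralBc; [|exact: continuous_slice..].
apply: le_trans (@normr_Rintegral_segment _ _ _ _ (e / (U - L + 1)) LU _) _.
  by move=> y /h; rewrite distrC.
by rewrite mulrAC ler_pdivrMr; nra.
Qed.

Lemma bounded_on_segment (f : R -> R) (L U : R) : continuous f ->
  exists2 M, 0 <= M & forall y, L <= y <= U -> `|f y| <= M.
Proof.
move=> cf; have [LU|UL] := lerP L U; last by exists 0 => // y; lra.
have cn : {within `[L, U], continuous (fun y => `|f y|)}.
  apply: continuous_subspaceT => y; apply: (@continuous_comp _ _ _ f); first exact: cf.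
  exact: norm_continuous.
have [c _ H] := EVT_max LU cn.
by exists `|f c| => // y yLU; apply: H; rewrite in_itv.
Qed.

(** The derivative falls on the kernel, so [f] need only be continuous. *)
Lemma is_derive_mollify (a a' f : R -> R) (L U C : R) : L <= U ->
  continuous a -> continuous a' -> continuous f ->
  (forall s d, `|a (s + d) - a s - d * a' s| <= C * d ^+ 2) ->
  forall x : R, is_derive x 1 (fun x => \int[mu]_(y in `[L, U]) (a (y - x) * f y))
    (- \int[mu]_(y in `[L, U]) (a' (y - x) * f y)).
Proof.
move=> LU ca ca' cf H x.
have [M M0 fM] := @bounded_on_segment f L U cf.
have ct (g : R -> R) x' : continuous g -> continuous (fun y => g (y - x') * f y).
  move=> cg y; apply: cvgM; last exact: cf.
  apply: (@continuous_comp _ _ _ (fun y => y - x') g); last exact: cg.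
  by apply: cvgB; [exact: cvg_id|exact: cvg_cst].
apply: (@is_derive_quadratic _ _ _ _ (C * M * (U - L))) => h _.
have ch : continuous (fun y => h * (a' (y - x) * f y)).
  by move=> y; apply: cvgM; [exact: cvg_cst|exact: ct].
have cd : continuous (fun y => a (y - (x + h)) * f y - a (y - x) * f y).
  by move=> y; apply: cvgB; exact: ct.
rewrite mulrN opprK -RintegralZc; last exact: ct.
rewrite -RintegralBc; [|exact: ct..].
rewrite -RintegralDc//.
apply: le_trans (@normr_Rintegral_segment _ _ _ _ (C * h ^+ 2 * M) LU _) _; last first.
  by rewrite le_eqVlt; apply/orP; left; apply/eqP; ring.
move=> y yLU.
rewrite (_ : _ + _ = (a (y - x + - h) - a (y - x) - - h * a' (y - x)) * f y).
  rewrite normrM; apply: ler_pM => //; last exact: fM.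
  by rewrite -(sqrrN h); exact: H.
by rewrite opprD addrA; ring.
Qed.

End ParametricIntegral.

(** * Weak solutions of the heat equation and the maximum principle *)

Section Calculus.
Context {R : realType}.
Implicit Types (f : R -> R).

Lemma is_derive_linear_approx f (x l e : R) : is_derive x 1 f l -> 0 < e ->
  exists2 d, 0 < d & forall h, `|h| < d -> `|f (x + h) - f x - h * l| <= e * `|h|.
Proof.
move=> fx e0.
have cv : h^-1 *: (f (h *: 1 + x) - f x) @[h --> 0^'] --> l.
  have <- : 'D_1 f x = l by rewrite derive_val.
  exact: ex_derive.
move/cvgrPdist_le : cv => /(_ _ e0) /nbhs_ballP[d /= d0 hd]; exists d => // h hlt.
have [->|h0] := eqVneq h 0; first by rewrite addr0 subrr mul0r subr0 normr0 mulr0.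
have := hd h; rewrite /ball/= sub0r normrN => /(_ hlt h0).
have -> : l - h^-1 *: (f (h *: 1 + x) - f x) = - h^-1 * (f (x + h) - f x - h * l).
  rewrite /GRing.scale/= mulr1 (addrC h x); field; exact: h0.
by rewrite normrM normrN normfV ler_pdivrMl ?normr_gt0// (mulrC e).
Qed.

(** If [h2] were positive, [h1], which vanishes at [c], would be positive just to the right of it,
    and [h] would increase there. *)
Lemma second_derivative_at_max (h h1 : R -> R) (a b c h2 : R) : a < c < b ->
  (forall x, a < x < b -> is_derive x 1 h (h1 x)) -> is_derive c 1 h1 h2 ->
  (forall x, a < x < b -> h x <= h c) -> h2 <= 0.
Proof.
move=> acb dh dh1 hmax; rewrite leNgt; apply/negP => h20.
have ab : a <= b by lra.
have cab : c \in `]a, b[ by rewrite in_itv.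
have hc0 : h1 c = 0.
  have dhc := dh _ acb; have <- : 'D_1 h c = h1 c by rewrite derive_val.
  have d0 : is_derive c 1 h 0.
    apply: (derive1_at_max ab _ cab) => t; rewrite in_itv/= => tab; last exact: hmax.
    by have ? := dh _ tab; exact: ex_derive.
  by rewrite derive_val.
have [d d0 hd] := is_derive_linear_approx dh1 (divr_gt0 h20 (ltr0Sn _ 1)).
pose e := Num.min (d / 2) ((b - c) / 2).
have e0 : 0 < e by rewrite lt_min !divr_gt0//; lra.
have ed : e < d by apply: (@le_lt_trans _ _ (d / 2)); [rewrite ge_min lexx|lra].
have eb : c + e < b.
  suff : e <= (b - c) / 2 by lra.
  by rewrite ge_min lexx orbT.
have hder x : x \in `]c, (c + e)[ -> is_derive x 1 h (h1 x).
  by rewrite in_itv/= => ?; apply: dh; lra.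
have [||x] := @MVT R h h1 c (c + e) _ hder _; first lra.
  apply: continuous_in_subspaceT => x; rewrite inE/= in_itv/= => ?.
  by apply: (@is_derive_continuous _ _ _ (h1 x)); apply: dh; lra.
rewrite in_itv/= => xc hx.
have := hmax (c + e) ltac:(lra); rewrite -subr_le0 hx addrAC subrr add0r.
apply/negP; rewrite -ltNge mulr_gt0//.
have := hd (x - c); rewrite ger0_norm; last lra.
move=> /(_ ltac:(lra)); rewrite (_ : c + (x - c) = x); last by ring.
by rewrite hc0 subr0 ler_norml => /andP[? _]; nra.
Qed.

Lemma bounded_on_box (F : R * R -> R) (a b c d : R) : continuous F ->
  exists2 M, 0 <= M & forall x t, a <= x <= b -> c <= t <= d -> `|F (x, t)| <= M.
Proof.
move=> cF; have [[ab cd]|ne] := pselect (a <= b /\ c <= d); last first.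
  by exists 0 => // x t ? ?; exfalso; apply: ne; lra.
have cn : {within `[a, b] `*` `[c, d], continuous (fun p => `|F p|)}.
  apply: continuous_subspaceT => p.
  by apply: (@continuous_comp _ _ _ F); [exact: cF|exact: norm_continuous].
have [||p _ H] := compact_EVT_max _ _ cn.
- by exists (a, c); rewrite /= !in_itv/=; lra.
- by apply: compact_setX; exact: segment_compact.
exists `|F p| => // x t xab tcd; apply: H.
by rewrite inE/= !in_itv/= xab tcd.
Qed.

End Calculus.

Section WeakHeat.
Context {R : realType}.
Notation mu := (@lebesgue_measure R).

(* [z] solves [z_t = z_xx - g] weakly for positive times with zero initial
   datum; [g] is only bounded, it need not be measurable. *)
Record weak_heat (z zx g : R -> R -> R) : Prop := WeakHeat {
  wh_cont : continuous (fun q : R * R => z q.1 q.2) ;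
  wh_cont_dx : continuous (fun q : R * R => zx q.1 q.2) ;
  wh_dx : forall x t : R, is_derive x 1 (z ^~ t) (zx x t) ;
  wh_source : forall T, 0 < T ->
    exists M, forall x t, 0 <= t <= T -> `|g x t| <= M ;
  wh_weak : forall (T : R) (a a' b b' : R -> R), 0 < T ->
    (forall x : R, is_derive x 1 a (a' x)) -> continuous a' ->
    (exists K, forall x, K < `|x| -> a x = 0) ->
    (forall s : R, is_derive s 1 b (b' s)) -> continuous b' -> b T = 0 ->
    \int[mu]_(s in `[0, T]) \int[mu]_y (a y * b' s * z y s) =
    \int[mu]_(s in `[0, T]) \int[mu]_y
      (a' y * b s * zx y s + g y s * (a y * b s)) }.

(** The pointwise bound [m <= g] trades the source for a constant by monotonicity alone; what
    remains is the integral of a continuous function, on which the usual rules are available. *)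
Lemma weak_heat_window (z zx g : R -> R -> R) (L U T m c : R) (a a' b b' : R -> R) :
  weak_heat z zx g -> L <= U -> 0 < T ->
  (forall x : R, is_derive x 1 a (a' x)) -> continuous a' -> (forall x, 0 <= a x) ->
  (forall x, ~~ (L <= x <= U) -> a x = 0) -> (forall x, ~~ (L <= x <= U) -> a' x = 0) ->
  (forall s : R, is_derive s 1 b (b' s)) -> continuous b' -> b T = 0 ->
  (forall s, 0 <= b s) ->
  (forall y s, L <= y <= U -> 0 <= s <= T -> b s != 0 -> m <= g y s) ->
  (forall s, 0 <= s <= T -> b s != 0 ->
     c <= \int[mu]_(y in `[L, U]) (a' y * zx y s + m * a y)) ->
  c * \int[mu]_(s in `[0, T]) b s <=
  \int[mu]_(s in `[0, T]) (b' s * \int[mu]_(y in `[L, U]) (a y * z y s)).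
Proof.
move=> H LU T0 da ca' a0 aout a'out db cb' bT b0 mg cle.
have ca : continuous a by move=> x; exact: is_derive_continuous (da x).
have cb : continuous b by move=> x; exact: is_derive_continuous (db x).
have czs s : continuous (z ^~ s).
  exact: (@continuous_slice _ _ (fun q : R * R => z q.1 q.2) s (wh_cont H)).
have czxs s : continuous (zx ^~ s).
  exact: (@continuous_slice _ _ (fun q : R * R => zx q.1 q.2) s (wh_cont_dx H)).
have caz s : continuous (fun y => a y * z y s).
  by move=> y; apply: cvgM; [exact: ca|exact: czs].
have -> : \int[mu]_(s in `[0, T]) (b' s * \int[mu]_(y in `[L, U]) (a y * z y s)) =
    \int[mu]_(s in `[0, T]) \int[mu]_y (a y * b' s * z y s).
  apply: eq_Rintegral => s _; rewrite -RintegralZc//.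
  rewrite (@Rintegral_support _ _ L U); last by move=> y /aout ->; rewrite !mul0r.
  by apply: eq_Rintegral => y _; ring.
rewrite (wh_weak H T0 da ca' _ db cb' bT); last first.
  exists (Num.max `|L| `|U|) => x; rewrite gt_max => /andP[Lx Ux].
  apply: aout; apply/negP => /andP[h1 h2].
  have : `|x| <= Num.max `|L| `|U|.
    by rewrite le_max !ler_norml; move: (ler_norm (- L)) (ler_norm U); rewrite normrN; lra.
  by rewrite leNgt gt_max Lx Ux.
rewrite -RintegralZc//.
have [Mg gM] := wh_source H T0.
have [Mx Mx0 zxM] := @bounded_on_box _ (fun q : R * R => zx q.1 q.2) L U 0 T (wh_cont_dx H).
have [Ma Ma0 aM] := @bounded_on_segment _ a L U ca.
have [Ma' Ma'0 a'M] := @bounded_on_segment _ a' L U ca'.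
have [Mb Mb0 bM] := @bounded_on_segment _ b 0 T cb.
have Mg0 : 0 <= Mg by apply: le_trans (gM 0 0 _) => //; rewrite lexx/= ltW.
pose inner s y := a' y * b s * zx y s + g y s * (a y * b s).
have innerE s : \int[mu]_y inner s y = \int[mu]_(y in `[L, U]) inner s y.
  apply: Rintegral_support => y yLU.
  by rewrite /inner aout// a'out// !mul0r mulr0 addr0.
pose M1 := Ma' * Mb * Mx + Mg * (Ma * Mb).
have innerM s y : 0 <= s <= T -> L <= y <= U -> `|inner s y| <= M1.
  move=> sT yLU; apply: le_trans (ler_normD _ _) _; rewrite !normrM.
  apply: lerD; first by rewrite !ler_pM ?mulr_ge0 ?a'M ?bM ?(zxM y s).
  by rewrite !ler_pM ?mulr_ge0 ?aM ?bM ?gM.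
apply: (@le_Rintegral_unmeasurable _ _ _ _ _ _ _ (`|c| * Mb + M1 * (U - L))) => //.
- exact: segment_finite.
- move=> s /=; rewrite in_itv/= => sT; rewrite normrM ler_wpDr//.
    by rewrite mulr_ge0 ?subr_ge0// /M1 addr_ge0// !mulr_ge0.
  by rewrite ler_pM// bM.
- move=> s /=; rewrite in_itv/= => sT; rewrite innerE.
  apply: le_trans (@normr_Rintegral_segment _ _ _ _ M1 LU (fun y => innerM s y sT)) _.
  by rewrite ler_wpDl// mulr_ge0.
move=> s /=; rewrite in_itv/= => sT; rewrite innerE.
have [bs0|bs0] := eqVneq (b s) 0.
  rewrite bs0 mulr0; apply: Rintegral_ge0 => y _.
  by rewrite /inner bs0 mulr0 mul0r !mulr0 addr0.
have cm : continuous (fun y => a' y * zx y s + m * a y).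
  move=> y; apply: cvgD; first by apply: cvgM; [exact: ca'|exact: czxs].
  by apply: cvgM; [exact: cvg_cst|exact: ca].
have [Mc Mc0 cM] := @bounded_on_segment _ _ L U cm.
have h1 : c * b s <= b s * \int[mu]_(y in `[L, U]) (a' y * zx y s + m * a y).
  by rewrite mulrC ler_wpM2l// cle.
apply: le_trans h1 _; rewrite -RintegralZc//.
apply: (@le_Rintegral_unmeasurable _ _ _ _ _ _ _ (Mb * Mc + M1)) => //.
- exact: segment_finite.
- move=> y /=; rewrite in_itv/= => yLU; rewrite normrM ler_wpDr//.
    by rewrite /M1 addr_ge0// !mulr_ge0.
  by rewrite ler_pM ?bM ?cM.
- by move=> y /=; rewrite in_itv/= => yLU; rewrite ler_wpDl ?mulr_ge0 ?innerM.
move=> y /=; rewrite in_itv/= => yLU; rewrite /inner.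
have := mg y s yLU sT bs0; have := a0 y; have := b0 s => ? ? ?.
have : 0 <= (g y s - m) * (a y * b s) by rewrite !mulr_ge0// subr_ge0.
lra.
Qed.

(** The integrated form of the statement that the average of [z] against [a] decreases at rate at
    least [c], obtained from trapezoidal cutoffs in time. *)
Lemma weak_heat_decrease (z zx g : R -> R -> R) (L U l r m c : R) (a a' : R -> R) :
  weak_heat z zx g -> L <= U -> 0 <= l -> l < r ->
  (forall x : R, is_derive x 1 a (a' x)) -> continuous a' -> (forall x, 0 <= a x) ->
  (forall x, ~~ (L <= x <= U) -> a x = 0) -> (forall x, ~~ (L <= x <= U) -> a' x = 0) ->
  (forall y s, L <= y <= U -> l <= s <= r -> m <= g y s) ->
  (forall s, l <= s <= r -> c <= \int[mu]_(y in `[L, U]) (a' y * zx y s + m * a y)) ->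
  \int[mu]_(y in `[L, U]) (a y * z y r) - \int[mu]_(y in `[L, U]) (a y * z y l) <=
  - c * (r - l).
Proof.
move=> H LU l0 lr da ca' a0 aout a'out mg cle.
have ca : continuous a by move=> x; exact: is_derive_continuous (da x).
have rr1 : r <= r + 1 by rewrite lerDl.
have cA : continuous (fun s => \int[mu]_(y in `[L, U]) (a y * z y s)).
  apply: (@continuous_Rintegral _ R (fun p => a p.1 * z p.1 p.2)) => // p.
  apply: cvgM; last exact: (wh_cont H).
  by apply: (@continuous_comp _ _ _ fst a); [exact: cvg_fst|exact: ca].
apply: (weak_derivative_le cA l0 lr rr1) => h h0 hl.
have lrh : l <= r - h by clear - h0 hl; lra.
have in_window s : trap h l (r - h) s != 0 -> l <= s <= r.
  move=> hb; have [|/(trap_out h0 lrh)/eqP] := boolP (l < s < r - h + h).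
    by rewrite subrK => /andP[/ltW -> /ltW ->].
  by rewrite (negbTE hb).
apply: (@weak_heat_window z zx g L U (r + 1) m c a a' (trap h l (r - h))
  (dtrap h l (r - h)) H LU _ da ca' a0 aout a'out).
- by clear - l0 lr; lra.
- by move=> s; exact: is_derive_trap.
- exact: continuous_dtrap.
- by apply: trap_out => //; clear; lra.
- by move=> s; exact: trap_ge0.
- by move=> y s hy _ /in_window; exact: mg.
- by move=> s _ /in_window; exact: cle.
Qed.

End WeakHeat.

(** * The maximum principle at a touching point *)

Section Touching.
Context {R : realType}.
Notation mu := (@lebesgue_measure R).

(** Translation invariance by differentiation in the centre: the derivative is minus the integral of
    [a'] over its whole support, which is 0. *)
Lemma mollifier_mass (rho L U x1 x2 : R) : 0 < rho ->
  L + rho <= x1 <= U - rho -> L + rho <= x2 <= U - rho ->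
  \int[mu]_(y in `[L, U]) trap rho (- rho) 0 (y - x1) =
  \int[mu]_(y in `[L, U]) trap rho (- rho) 0 (y - x2).
Proof.
move=> rho0.
wlog x12 : x1 x2 / x1 <= x2.
  by move=> W h1 h2; have [/W ->//|/ltW/W ->//] := lerP x1 x2.
move=> h1 h2; set a := trap _ _ _; set a' := dtrap rho (- rho) 0.
have LU : L <= U by lra.
have c1 : continuous (fun _ : R => 1 : R) by move=> ?; exact: cvg_cst.
have D := @is_derive_mollify R a a' (fun=> 1) L U _ LU (@continuous_trap _ _ _ _)
  (@continuous_dtrap _ _ _ _) c1 (@trap_quadratic _ _ _ _).
have [|c] := @MVT_segment R (fun x => \int[mu]_(y in `[L, U]) (a (y - x) * 1))
    (fun x => - \int[mu]_(y in `[L, U]) (a' (y - x) * 1)) x1 x2 x12 _ _.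
  by apply: continuous_subspaceT => x; apply: is_derive_continuous (D x).
rewrite in_itv/= => c12 E.
have Z (x : R) : L + rho <= x <= U - rho -> \int[mu]_(y in `[L, U]) (a' (y - x) * 1) = 0.
  move=> hx.
  have da (y : R) : is_derive y 1 (fun y => a (y - x)) (a' (y - x) * 1).
    have := @is_derive_comp_affine R a 1 (- x) y (a' (y - x)).
    rewrite !mul1r mulr1.
    under eq_fun do rewrite mul1r.
    by apply; exact: is_derive_trap.
  have ca : continuous (fun y => a' (y - x) * 1).
    move=> y; apply: cvgM; last exact: cvg_cst.
    apply: (@continuous_comp _ _ _ (fun y => y - x) a'); last exact: continuous_dtrap.
    by apply: cvgB; [exact: cvg_id|exact: cvg_cst].
  by rewrite (Rintegral_FTC2 LU ca da) /a !trap_out ?subrr ?oppr_le0 ?ltW//; lra.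
move: E; rewrite Z ?oppr0 ?mul0r; last lra.
move=> /eqP; rewrite subr_eq0 => /eqP E.
under eq_Rintegral do rewrite -[a _]mulr1.
under [RHS]eq_Rintegral do rewrite -[a _]mulr1.
by rewrite E.
Qed.

(** A maximum principle of viscosity type. The mollification of [z] in x has two space derivatives,
    so the second derivative test applies to it; in time, the inequality between two times stands in
    for the derivative. A quadratic and a linear term make the maximum strict, so that the maximum
    of the mollified difference stays off the lateral and lower sides. The upper side [t0] is
    harmless, since only earlier times are compared. The source is bounded on the doubled width
    because the mollifier reaches beyond the box. *)
Lemma touching_from_above (z zx g : R -> R -> R) (x0 t0 r m sg ga : R)
    (phi phix phixx phit : R -> R -> R) :
  weak_heat z zx g -> 0 < r -> r < t0 ->
  (forall y s, x0 - 2 * r <= y <= x0 + 2 * r -> t0 - r <= s <= t0 -> m <= g y s) ->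
  (forall y s : R, x0 - r <= y <= x0 + r -> t0 - r <= s <= t0 ->
    [/\ {for (y, s), continuous (fun q : R * R => phi q.1 q.2)},
        is_derive y 1 (phi ^~ s) (phix y s),
        is_derive y 1 (phix ^~ s) (phixx y s) &
        is_derive s 1 (phi y) (phit y s)]) ->
  (forall y s, x0 - r <= y <= x0 + r -> t0 - r <= s <= t0 ->
    sg <= phit y s /\ phixx y s <= ga) ->
  (forall y s, x0 - r <= y <= x0 + r -> t0 - r <= s <= t0 ->
    z y s - phi y s <= z x0 t0 - phi x0 t0) ->
  sg + m <= ga.
Proof.
move=> H r0 rt0 gm dphi bphi zmax; rewrite leNgt; apply/negP => Hlt.
(* The losses add up to [4 * k], half of the gap: [2 * k] from the quadratic term, [k] from the tilt
   in time and [k] from the variation of [C] near [t1]. *)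
pose k := (sg + m - ga) / 8.
have k0 : 0 < k by rewrite divr_gt0//; slra.
pose L := x0 - 2 * r; pose U := x0 + 2 * r.
have LU : L <= U by rewrite /L /U; slra.
have [B B0 zxB] := @bounded_on_box _ (fun q : R * R => zx q.1 q.2) L U (t0 - r) t0 (wh_cont_dx H).
(* A lower bound of the perturbation on the lateral and lower sides of the box; [rho] is chosen so
   that two mollification errors, per unit of mass, stay below it. *)
pose e1 := k * Num.min (r ^+ 2) r.
have e10 : 0 < e1 by rewrite mulr_gt0// lt_min exprn_gt0.
pose rho := Num.min r (e1 / (4 * (B + 1))).
have rho0 : 0 < rho by rewrite lt_min r0/= divr_gt0// mulr_gt0// ltr_wpDl.
have rhor : rho <= r by rewrite ge_min lexx.
have Brho : 4 * (B * rho) <= e1.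
  have : rho * (4 * (B + 1)) <= e1.
    by rewrite -ler_pdivlMr ?ge_min ?lexx ?orbT// mulr_gt0// ltr_wpDl.
  snra.
pose a := trap rho (- rho) 0; pose a' := dtrap rho (- rho) 0.
have No : - rho <= 0 by slra.
have a0 y : 0 <= a y by exact: trap_ge0.
have ca : continuous a by exact: continuous_trap.
have ca' : continuous a' by exact: continuous_dtrap.
have aout y : ~~ (- rho < y < rho) -> a y = 0.
  by move=> hy; apply: trap_out; rewrite ?add0r.
have a'out y : ~~ (- rho < y < rho) -> a' y = 0.
  by move=> hy; apply: dtrap_out; rewrite ?add0r.
pose M := \int[mu]_(y in `[L, U]) a (y - x0).
have MM x : x0 - r <= x <= x0 + r -> \int[mu]_(y in `[L, U]) a (y - x) = M.
  by move=> hx; apply: mollifier_mass; rewrite // /L /U; slra.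
have shiftc (f : R -> R) x : continuous f -> continuous (fun y => f (y - x)).
  move=> cf y; apply: (@continuous_comp _ _ _ (fun y => y - x) f); last exact: cf.
  by apply: cvgB; [exact: cvg_id|exact: cvg_cst].
have M0 : 0 < M.
  have -> : M = \int[mu]_(y in `[L, U]) trap rho (x0 - rho) x0 y.
    apply: eq_Rintegral => y _; rewrite /a /trap.
    by congr (ramp _ - ramp _); ring.
  by apply: Rintegral_trap_gt0; rewrite // /L /U; slra.
have czs s : continuous (z ^~ s).
  exact: (@continuous_slice _ _ (fun q : R * R => z q.1 q.2) s (wh_cont H)).
have czxs s : continuous (zx ^~ s).
  exact: (@continuous_slice _ _ (fun q : R * R => zx q.1 q.2) s (wh_cont_dx H)).
have caf (b f : R -> R) x : continuous b -> continuous f ->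
    continuous (fun y => b (y - x) * f y).
  by move=> cb cf y; apply: cvgM; [exact: shiftc|exact: cf].
pose Z x t := \int[mu]_(y in `[L, U]) (a (y - x) * z y t).
(* On the window [z ^~ t] is Lipschitz with constant [B], and the kernel has radius [rho]. *)
have close x t : x0 - r <= x <= x0 + r -> t0 - r <= t <= t0 ->
    `|Z x t - M * z x t| <= M * (B * rho).
  move=> hx ht.
  have -> : Z x t - M * z x t = \int[mu]_(y in `[L, U]) (a (y - x) * (z y t - z x t)).
    rewrite -(MM x hx) mulrC -RintegralZc; last exact: shiftc.
    rewrite -RintegralBc; [|exact: caf|].
      by apply: eq_Rintegral => y _; ring.
    by move=> y; apply: cvgM; [exact: cvg_cst|exact: shiftc].
  have cI : continuous (fun y => a (y - x) * (z y t - z x t)).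
    by apply: caf => // y; apply: cvgB; [exact: czs|exact: cvg_cst].
  have cJ c : continuous (fun y => c * a (y - x)).
    by move=> y; apply: cvgM; [exact: cvg_cst|exact: shiftc].
  have pw y : L <= y <= U -> `|a (y - x) * (z y t - z x t)| <= B * rho * a (y - x).
    move=> hy; rewrite normrM (ger0_norm (a0 _)) mulrC.
    have [yx|/aout ->] := boolP (- rho < y - x < rho); last by rewrite !mulr0.
    rewrite ler_wpM2r//.
    have key (u v : R) : L <= u -> v <= U -> u <= v -> v - u <= rho ->
        `|z v t - z u t| <= B * rho.
      move=> Lu vU uv vur.
      have [|c] := @MVT_segment R (z ^~ t) (zx ^~ t) u v uv (fun x _ => wh_dx H x t) _.
        exact: continuous_subspaceT.
      rewrite in_itv/= => hc ->; rewrite normrM (ger0_norm (_ : 0 <= v - u)) ?subr_ge0//.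
      rewrite ler_pM ?subr_ge0//; apply: (zxB c t) => //; clear - hc Lu vU; lra.
    have [xy|yx'] := lerP x y; last rewrite distrC; apply: key.
    - by clear - hx r0; rewrite /L; lra.
    - by have /andP[] := hy.
    - exact: xy.
    - by clear - yx; lra.
    - by have /andP[] := hy.
    - by clear - hx r0; rewrite /U; lra.
    - exact: ltW.
    - by clear - yx; lra.
  rewrite mulrC -(MM x hx) -RintegralZc; last exact: shiftc.
  rewrite ler_norml; apply/andP; split.
    rewrite -mulN1r -RintegralZc//; apply: le_Rintegralc => //.
      by move=> y; apply: cvgM; [exact: cvg_cst|exact: cJ].
    by move=> y /pw; rewrite ler_norml mulN1r => /andP[].
  apply: le_Rintegralc => // y /pw; by rewrite ler_norml => /andP[].
pose tphi x t := phi x t + k * (x - x0) ^+ 2 + k * (t0 - t).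
pose Hf (q : R * R) := Z q.1 q.2 - M * tphi q.1 q.2.
pose Q : set (R * R) := `[x0 - r, x0 + r] `*` `[t0 - r, t0].
have cZ : continuous (fun q : R * R => Z q.1 q.2).
  apply: (@continuous_Rintegral _ (R * R)%type (fun p => a (p.1 - p.2.1) * z p.1 p.2.2)) => //.
  move=> p; apply: cvgM.
    apply: (@continuous_comp _ _ _ (fun p : R * (R * R) => p.1 - p.2.1) a); last exact: ca.
    apply: cvgB; first exact: cvg_fst.
    by apply: (@continuous_comp _ _ _ snd fst); [exact: cvg_snd|exact: cvg_fst].
  apply: (@continuous_comp2 _ _ _ _ (fun q : R * R => z q.1 q.2) fst (fun p => p.2.2)).
  - exact: cvg_fst.
  - by apply: (@continuous_comp _ _ _ snd snd); exact: cvg_snd.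
  - exact: (wh_cont H).
have cHf : {within Q, continuous Hf}.
  apply: continuous_in_subspaceT => q; rewrite inE /Q/= => -[]; rewrite /= ?in_itv/= => q1 q2.
  apply: cvgB; first exact: cZ.
  apply: cvgM; first exact: cvg_cst.
  apply: cvgD; first apply: cvgD.
  - by have [] := dphi q.1 q.2 q1 q2; case: q {q1 q2}.
  - apply: cvgM; first exact: cvg_cst.
    rewrite expr2 [X in X @ _ --> _](_ : _ = fun q : R * R => (q.1 - x0) * (q.1 - x0)); last first.
      by apply/funext => ?; rewrite expr2.
    by apply: cvgM; apply: cvgB; [exact: cvg_fst|exact: cvg_cst|exact: cvg_fst|exact: cvg_cst].
  - by apply: cvgM; [exact: cvg_cst|apply: cvgB; [exact: cvg_cst|exact: cvg_snd]].
have [||[x1 t1]] := @compact_EVT_max _ _ Hf Q _ _ cHf.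
- by exists (x0, t0); split; rewrite /= in_itv/=; slra.
- by apply: compact_setX; exact: segment_compact.
rewrite inE /Q/= !in_itv/= => -[hx1 ht1] Hmax.
have {}Hmax x t : x0 - r <= x <= x0 + r -> t0 - r <= t <= t0 ->
    Z x t - M * tphi x t <= Z x1 t1 - M * tphi x1 t1.
  by move=> hx ht; apply: (Hmax (x, t)); rewrite inE/= !in_itv/= hx ht.
have near0 : k * ((x1 - x0) ^+ 2 + (t0 - t1)) < e1.
  have := Hmax x0 t0 ltac:(slra) ltac:(slra).
  have := close x0 t0 ltac:(slra) ltac:(slra); have := close x1 t1 hx1 ht1.
  rewrite !ler_norml => /andP[c1 c2] /andP[c3 c4].
  rewrite /tphi !subrr expr0n/= !mulr0 !addr0 => c5.
  have c6 := zmax x1 t1 hx1 ht1.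
  have c7 : M * (k * ((x1 - x0) ^+ 2 + (t0 - t1))) <= M * (2 * (B * rho)) by snra.
  rewrite ler_pM2l// in c7; slra.
have {near0} near0 : (x1 - x0) ^+ 2 + (t0 - t1) < Num.min (r ^+ 2) r.
  by move: near0; rewrite /e1 ltr_pM2l.
have hx1' : x0 - r < x1 < x0 + r.
  have : (x1 - x0) ^+ 2 < r ^+ 2.
    by move: near0; rewrite lt_min => /andP[? _]; slra.
  by move=> ?; apply/andP; split; snra.
have ht1' : t0 - r < t1.
  by move: near0; rewrite lt_min => /andP[_ ?]; have := sqr_ge0 (x1 - x0); slra.
have Zxx : - (\int[mu]_(y in `[L, U]) (a' (y - x1) * zx y t1)) - M * (phixx x1 t1 + 2 * k) <= 0.
  pose h1 x := \int[mu]_(y in `[L, U]) (a (y - x) * zx y t1)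
    - M * (phix x t1 + 2 * k * (x - x0)).
  apply: (@second_derivative_at_max _ (fun x => Z x t1 - M * tphi x t1) h1
    (x0 - r) (x0 + r) x1) => //.
  - move=> x hx.
    have hxl : x0 - r <= x <= x0 + r by slra.
    have dZ := @is_derive_mollify R a a' (z ^~ t1) L U _ LU ca ca' (czs t1)
      (@trap_quadratic _ _ _ _) x.
    (* Moving the derivative from the kernel back to [z] permits a second differentiation under the
       integral. *)
    have parts : - (\int[mu]_(y in `[L, U]) (a' (y - x) * z y t1)) =
        \int[mu]_(y in `[L, U]) (a (y - x) * zx y t1).
      have da (y : R) : is_derive y 1 (fun y => a (y - x)) (a' (y - x)).
        have := @is_derive_comp_affine R a 1 (- x) y (a' (y - x)).
        rewrite !mul1r; under eq_fun do rewrite mul1r.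
        by apply; exact: is_derive_trap.
      have daz (y : R) : is_derive y 1 (fun y => a (y - x) * z y t1)
          (a (y - x) * zx y t1 + a' (y - x) * z y t1).
        rewrite addrC.
        exact: (@is_derive_mul _ (fun y => a (y - x)) (z ^~ t1) y _ _ (da y) (wh_dx H y t1)).
      have cc : continuous (fun y => a (y - x) * zx y t1 + a' (y - x) * z y t1).
        by move=> y; apply: cvgD; apply: caf.
      have := Rintegral_FTC2 LU cc daz.
      rewrite !aout ?mul0r ?subrr; [|by rewrite /L /U; slra..].
      by rewrite RintegralDc; [move=> ?; slra|exact: caf|exact: caf].
    rewrite parts in dZ.
    have [_ dpx _ _] := dphi x t1 hxl ht1.
    have dtp : is_derive x 1 (tphi ^~ t1) (phix x t1 + 2 * k * (x - x0)).
      apply: (is_derive_eq (is_derive_add (is_derive_add dpx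
        (is_derive_scale k (is_derive_sqr_sub x0 x))) (is_derive_const (k * (t0 - t1)) x))).
      by ring.
    exact: is_derive_sub dZ (is_derive_scale M dtp).
  - have := @is_derive_mollify R a a' (zx ^~ t1) L U _ LU ca ca' (czxs t1)
      (@trap_quadratic _ _ _ _) x1 => dZ.
    have [_ _ dpxx _] := dphi x1 t1 hx1 ht1.
    have dl : is_derive x1 1 (fun x => 2 * k * (x - x0)) (2 * k).
      have := @is_derive_affine R (2 * k) (- (2 * k * x0)) x1.
      by under eq_fun do rewrite -mulrBr.
    exact: is_derive_sub dZ (is_derive_scale M (is_derive_add dpxx dl)).
  - by move=> x hx; apply: Hmax; slra.
have Zxx' : - (\int[mu]_(y in `[L, U]) (a' (y - x1) * zx y t1)) <= M * (ga + 2 * k).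
  have [_ ?] := bphi x1 t1 hx1 ht1; snra.
pose A s := Z x1 s.
pose C s := \int[mu]_(y in `[L, U]) (a' (y - x1) * zx y s + m * a (y - x1)).
have cA : continuous A.
  move=> s; apply: (@continuous_comp2 _ _ _ _ (fun q : R * R => Z q.1 q.2) (cst x1) id).
  - exact: cvg_cst.
  - exact: cvg_id.
  - exact: cZ.
have cC : continuous C.
  apply: (@continuous_Rintegral _ R (fun p => a' (p.1 - x1) * zx p.1 p.2 + m * a (p.1 - x1))) => //.
  have cs (f : R -> R) : continuous f -> continuous (fun p : R * R => f (p.1 - x1)).
    move=> cf p; apply: (@continuous_comp _ _ _ (fun p : R * R => p.1 - x1) f); last exact: cf.
    by apply: cvgB; [exact: cvg_fst|exact: cvg_cst].
  move=> p; apply: cvgD; apply: cvgM; [exact: cs|exact: (wh_cont_dx H)|exact: cvg_cst|exact: cs].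
pose c := M * (m - ga - 3 * k).
have cC1 : M * (m - ga - 2 * k) <= C t1.
  rewrite /C RintegralDc; [|exact: caf|]; last first.
    by move=> y; apply: cvgM; [exact: cvg_cst|exact: shiftc].
  rewrite RintegralZc; last exact: shiftc.
  by rewrite (MM x1 hx1); slra.
have [d d0 Cd] : exists2 d, 0 < d & forall s, `|t1 - s| < d -> c <= C s.
  have /cvgrPdist_le/(_ _ (mulr_gt0 M0 k0)) := cC t1.
  move=> /nbhs_ballP[d /= d0 hd]; exists d => // s /hd.
  by rewrite ler_norml => /andP[_]; rewrite /c; slra.
(* A time before [t1] from which on [C] stays above [c]: the equation bounds [A t1 - A l] from
   above, maximality at [t1] bounds it from below. *)
pose l := Num.max (t0 - r) (t1 - d / 2).
have lt1 : l < t1 by rewrite gt_max ht1'/=; slra.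
have ltr : t0 - r <= l by rewrite le_max lexx.
have ld : t1 - l < d.
  have : t1 - d / 2 <= l by rewrite le_max lexx orbT.
  slra.
have upper : A t1 - A l <= - c * (t1 - l).
  have l0 : 0 <= l by clear - ltr rt0; lra.
  have da (y : R) : is_derive y 1 (fun y => a (y - x1)) (a' (y - x1)).
    have := @is_derive_comp_affine R a 1 (- x1) y (a' (y - x1)).
    rewrite !mul1r; under eq_fun do rewrite mul1r.
    by apply; exact: is_derive_trap.
  have LU_in y : - rho < y - x1 < rho -> L <= y <= U.
    by clear - hx1 rhor; rewrite /L /U; lra.
  have ht1t0 : t1 <= t0 by have /andP[] := ht1.
  apply: (@weak_heat_decrease _ z zx g L U l t1 m c (fun y => a (y - x1))
    (fun y => a' (y - x1)) H LU l0 lt1 da (shiftc _ _ ca')).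
  - by move=> y; exact: a0.
  - by move=> y hy; apply: aout; apply: contraNN hy; exact: LU_in.
  - by move=> y hy; apply: a'out; apply: contraNN hy; exact: LU_in.
  - move=> y s hy /andP[ls st]; apply: gm => //.
    by rewrite (le_trans ltr ls) (le_trans st ht1t0).
  - move=> s /andP[ls st]; apply: Cd.
    by clear - ls st ld; rewrite ger0_norm; lra.
have lower : M * (tphi x1 t1 - tphi x1 l) <= A t1 - A l.
  have hl : t0 - r <= l <= t0 by clear - ltr lt1 ht1; lra.
  by have := Hmax x1 l hx1 hl; rewrite /A; clear; lra.
have dt s : t0 - r <= s <= t0 -> is_derive s 1 (tphi x1) (phit x1 s - k).
  move=> hs; have [_ _ _ dp] := dphi x1 s hx1 hs.
  have dl : is_derive s 1 (fun s => k * (t0 - s)) (- k).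
    have -> : (fun s => k * (t0 - s)) = (fun s => - k * s + k * t0).
      by apply/funext => ?; ring.
    exact: is_derive_affine.
  apply: (is_derive_eq (is_derive_add (is_derive_add dp
    (is_derive_const (k * (x1 - x0) ^+ 2) s)) dl)).
  by ring.
have [||e] := @MVT R (tphi x1) (fun s => phit x1 s - k) l t1 lt1 _ _.
- by move=> s; rewrite in_itv/= => hs; apply: dt; clear - hs ltr ht1; lra.
- apply: continuous_in_subspaceT => s; rewrite inE/= in_itv/= => hs0.
  have hs : t0 - r <= s <= t0 by clear - hs0 ltr ht1; lra.
  exact: is_derive_continuous (dt s hs).
rewrite in_itv/= => he E.
have he' : t0 - r <= e <= t0 by clear - he ltr ht1; lra.
have [sge _] := bphi x1 e hx1 he'.
have c2 : (sg - k) * (t1 - l) <= tphi x1 t1 - tphi x1 l.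
  by rewrite E ler_wpM2r ?subr_ge0 ?(ltW lt1)// lerB.
have c1 : M * (tphi x1 t1 - tphi x1 l) <= M * (- (m - ga - 3 * k) * (t1 - l)).
  by apply: le_trans lower (le_trans upper _); rewrite /c; clear; lra.
rewrite ler_pM2l// in c1.
have := le_trans c2 c1.
by rewrite ler_pM2r ?subr_gt0// /k; clear - Hlt; lra.
Qed.

End Touching.

(** * The initial datum encoded in the weak form *)

Section InitialValue.
Context {R : realType}.
Notation mu := (@lebesgue_measure R).

(** Since the source need not be measurable, the sign is pulled out of each integral through bounds
    and the compact support of [a]. *)
Lemma weak_heat_opp (z zx g : R -> R -> R) : weak_heat z zx g ->
  weak_heat (fun x t => - z x t) (fun x t => - zx x t) (fun x t => - g x t).
Proof.
move=> H; split.
- by move=> q; apply: cvgN; exact: (wh_cont H).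
- by move=> q; apply: cvgN; exact: (wh_cont_dx H).
- by move=> x t; apply: is_deriveN; exact: (wh_dx H).
- by move=> T /(wh_source H)[M gM]; exists M => x t /gM; rewrite normrN.
move=> T a a' b b' T0 da ca' [K aK] db cb' bT.
have ca : continuous a by move=> x; exact: is_derive_continuous (da x).
have cb : continuous b by move=> x; exact: is_derive_continuous (db x).
have aout x : ~~ (- K <= x <= K) -> a x = 0.
  by move=> h; apply: aK; rewrite ltNge ler_norml.
(* The extra unit leaves room for the increments of size at most 1 in [is_derive_quadratic], by
   which [a'] is seen to vanish as well. *)
pose K1 := Num.max 0 K + 1.
have K1K : K < K1 by rewrite /K1 ltr_pwDr// le_max lexx orbT.
have K10 : 0 < K1 by rewrite ltr_wpDl// le_max lexx.
have a'out x : ~~ (- K1 <= x <= K1) -> a' x = 0.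
  rewrite -ler_norml -ltNge => hx.
  have aK0 y : K < `|y| -> a y = 0 by exact: aK.
  have h0 : is_derive x 1 a 0.
    apply: (@is_derive_quadratic _ _ _ _ 0) => h h1.
    rewrite !aK0 ?subrr ?mulr0 ?subrr ?normr0 ?mul0r//; first exact: lt_trans hx.
    have := lerB_normD x h; have : K + 1 <= K1 by rewrite lerD2r le_max lexx orbT.
    slra.
  by have h1 := da x; rewrite -(@derive_val _ _ _ _ _ _ _ h1) (@derive_val _ _ _ _ _ _ _ h0).
have KK : - K1 <= K1 by slra.
have bnd (f : R -> R -> R) M : (forall s y, 0 <= s <= T -> - K1 <= y <= K1 -> `|f s y| <= M) ->
    (forall s y, ~~ (- K1 <= y <= K1) -> f s y = 0) ->
    \int[mu]_(s in `[0, T]) \int[mu]_y (- f s y) =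
    - (\int[mu]_(s in `[0, T]) \int[mu]_y f s y).
  move=> fM fout.
  rewrite -(@RintegralN_unmeasurable _ _ _ _ _ _ (M * (K1 - - K1))) => //; last 2 first.
  - exact: segment_finite.
  - move=> s /=; rewrite in_itv/= => sT; rewrite (@Rintegral_support _ _ (- K1) K1).
      by apply: normr_Rintegral_segment => // y hy; exact: fM.
    exact: fout.
  apply: eq_Rintegral => s; rewrite inE/= in_itv/= => sT.
  rewrite (@Rintegral_support _ _ (- K1) K1); last first.
    by move=> y hy; rewrite fout ?oppr0.
  rewrite (@Rintegral_support _ (f s) (- K1) K1); last exact: fout.
  apply: (@RintegralN_unmeasurable _ _ _ _ _ _ M) => //; first exact: segment_finite.
  by move=> y /=; rewrite in_itv/=; exact: fM.
have aout1 x : ~~ (- K1 <= x <= K1) -> a x = 0.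
  by move=> h; apply: aout; apply: contraNN h; slra.
have [Mg gM] := wh_source H T0.
have Mg0 : 0 <= Mg by apply: le_trans (gM 0 0 _) => //; rewrite lexx/= ltW.
have [Mz Mz0 zM] := @bounded_on_box _ (fun q : R * R => z q.1 q.2) (- K1) K1 0 T (wh_cont H).
have [Mx Mx0 zxM] := @bounded_on_box _ (fun q : R * R => zx q.1 q.2) (- K1) K1 0 T (wh_cont_dx H).
have [Ma Ma0 aM] := @bounded_on_segment _ a (- K1) K1 ca.
have [Ma' Ma'0 a'M] := @bounded_on_segment _ a' (- K1) K1 ca'.
have [Mb Mb0 bM] := @bounded_on_segment _ b 0 T cb.
have [Mb' Mb'0 b'M] := @bounded_on_segment _ b' 0 T cb'.
have := wh_weak H T0 da ca' (ex_intro _ K aK) db cb' bT.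
move=> /(congr1 (@GRing.opp R)).
rewrite -(bnd _ (Ma * Mb' * Mz)); first last.
- by move=> s y /aout1 ->; rewrite !mul0r.
- by move=> s y hs hy; rewrite !normrM !ler_pM ?mulr_ge0 ?aM ?b'M ?(zM y s).
rewrite -(bnd _ (Ma' * Mb * Mx + Mg * (Ma * Mb))); first last.
- by move=> s y hy; rewrite aout1// a'out// !mul0r mulr0 addr0.
- move=> s y hs hy; apply: le_trans (ler_normD _ _) _; rewrite !normrM.
  apply: lerD; first by rewrite !ler_pM ?mulr_ge0 ?a'M ?bM ?(zxM y s).
  by rewrite !ler_pM ?mulr_ge0 ?aM ?bM ?gM.
move=> E.
transitivity (\int[mu]_(s in `[0, T]) \int[mu]_y (- (a y * b' s * z y s))).
  by apply: eq_Rintegral => s _; apply: eq_Rintegral => y _; ring.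
rewrite E.
by apply: eq_Rintegral => s _; apply: eq_Rintegral => y _; ring.
Qed.

(** The weak form carries no boundary term at time 0, so a time cutoff that equals 1 there detects
    the initial value, while the other terms are of the order of the length [h] of its descent. *)
Lemma weak_heat_initial_le0 (z zx g : R -> R -> R) x0 : weak_heat z zx g -> z x0 0 <= 0.
Proof.
move=> H; rewrite leNgt; apply/negP => w0.
pose w := z x0 0.
have [d d0 zd] : exists2 d, 0 < d & forall y s, `|x0 - y| < d -> `|0 - s| < d -> w / 2 <= z y s.
  have /cvgrPdist_le/(_ (w / 2)) := (@wh_cont _ _ _ _ H : forall q, {for q, continuous _}) (x0, 0).
  rewrite divr_gt0// => /(_ isT) /nbhs_ballP[d /= d0 hd]; exists d => // y s hy hs.
  have := hd (y, s) (conj hy hs); rewrite /= -/w ler_norml; slra.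
pose rho := d / 2.
have rho0 : 0 < rho by rewrite divr_gt0.
pose a := trap rho (x0 - rho) x0; pose a' := dtrap rho (x0 - rho) x0.
pose L := x0 - rho; pose U := x0 + rho.
have LU : L <= U by rewrite /L /U; slra.
have ca : continuous a by exact: continuous_trap.
have ca' : continuous a' by exact: continuous_dtrap.
have a0 y : 0 <= a y by apply: trap_ge0; slra.
have aout y : ~~ (L <= y <= U) -> a y = 0.
  by move=> hy; apply: trap_out => //; rewrite /L /U in hy; slra.
have a'out y : ~~ (L <= y <= U) -> a' y = 0.
  by move=> hy; apply: dtrap_out => //; rewrite /L /U in hy; slra.
have M0 : 0 < \int[mu]_(y in `[L, U]) a y.
  by apply: Rintegral_trap_gt0; rewrite /L /U; slra.
set M := \int[mu]_(y in `[L, U]) a y in M0.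
have [Mg gM] := wh_source H ltr01.
have czs s : continuous (z ^~ s).
  exact: (@continuous_slice _ _ (fun q : R * R => z q.1 q.2) s (wh_cont H)).
have czxs s : continuous (zx ^~ s).
  exact: (@continuous_slice _ _ (fun q : R * R => zx q.1 q.2) s (wh_cont_dx H)).
have caz (f h : R -> R) : continuous f -> continuous h -> continuous (fun y => f y * h y).
  by move=> cf ch y; apply: cvgM; [exact: cf|exact: ch].
have [Mx Mx0 zxM] := @bounded_on_box _ (fun q : R * R => zx q.1 q.2) L U 0 1 (wh_cont_dx H).
have [Ma Ma0 aM] := @bounded_on_segment _ a L U ca.
have [Ma' Ma'0 a'M] := @bounded_on_segment _ a' L U ca'.
have Mg0 : 0 <= Mg by apply: le_trans (gM 0 0 _) => //; rewrite lexx ler01.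
pose C := (Ma' * Mx + Mg * Ma) * (U - L).
have C0 : 0 <= C by rewrite mulr_ge0 ?subr_ge0 ?addr_ge0 ?mulr_ge0.
pose h := Num.min (Num.min rho 1) (w / 2 * M / (2 * (C + 1))).
have h0 : 0 < h by rewrite !lt_min rho0 ltr01/= !(divr_gt0, mulr_gt0)// ltr_wpDl.
have h1 : h <= 1 by rewrite !ge_min lexx orbT.
have hr : h <= rho by rewrite !ge_min lexx.
have hC : h * (2 * (C + 1)) <= w / 2 * M.
  by rewrite -ler_pdivlMr ?mulr_gt0 ?ltr_wpDl// ge_min lexx orbT.
(* [b] falls from 1 to 0 on [[0, h]], so [b'] has integral -1 however small [h] is. *)
pose b s := 1 - ramp (h^-1 * s - h^-1 * 0).
pose b' s := 0 - h^-1 * hat (h^-1 * s - h^-1 * 0).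
have db (s : R) : is_derive s 1 b (b' s).
  exact: is_derive_sub (is_derive_const 1 s) (is_derive_ramp_affine h 0 s).
have cb' : continuous b'.
  by move=> s; apply: cvgB; [exact: cvg_cst|exact: continuous_hat_affine].
have cb : continuous b by move=> s; exact: is_derive_continuous (db s).
have b1 : b h = 0 by rewrite /b mulr0 subr0 mulVf ?gt_eqF// ramp_right// subrr.
have b00 : b 0 = 1 by rewrite /b subrr ramp_left// subr0.
have b'0 s : b' s <= 0 by rewrite /b' sub0r oppr_le0 mulr_ge0 ?invr_ge0 ?hat_ge0// ltW.
have b01 s : 0 <= b s <= 1 by rewrite /b; have := ramp01 (h^-1 * s - h^-1 * 0); slra.
have := @weak_heat_window _ z zx g L U h (- Mg) (- C) a a' b b' H LU h0
   (fun x => is_derive_trap rho _ _ x) ca' a0 aout a'out db cb' b1.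
move=> /(_ _ _ _) W.
have {W} : - C * \int[mu]_(s in `[0, h]) b s <=
   \int[mu]_(s in `[0, h]) (b' s * \int[mu]_(y in `[L, U]) (a y * z y s)).
  apply: W.
  - by move=> s; have /andP[] := b01 s.
  - move=> y s _ hs _; have := gM y s; rewrite ler_norml.
    by move=> /(_ ltac:(slra)) /andP[].
  - move=> s hs _.
    have : `|\int[mu]_(y in `[L, U]) (a' y * zx y s + - Mg * a y)| <= C.
      apply: normr_Rintegral_segment => // y hy; apply: le_trans (ler_normD _ _) _.
      rewrite !normrM normrN (ger0_norm Mg0) lerD// ler_pM ?aM ?a'M//.
      by apply: (zxM y s) => //; slra.
    by rewrite ler_norml => /andP[].
have upper : \int[mu]_(s in `[0, h]) (b' s * \int[mu]_(y in `[L, U]) (a y * z y s)) <=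
    - (w / 2 * M).
  have <- : \int[mu]_(s in `[0, h]) (w / 2 * M * b' s) = - (w / 2 * M).
    by rewrite RintegralZc// (Rintegral_FTC2 (ltW h0) cb' db) b1 b00 sub0r mulrN1.
  apply: le_Rintegralc.
  - apply: caz => //.
    apply: (@continuous_Rintegral _ R (fun p => a p.1 * z p.1 p.2)) => // p.
    apply: cvgM; last exact: (wh_cont H).
    by apply: (@continuous_comp _ _ _ fst a); [exact: cvg_fst|exact: ca].
  - by move=> s; apply: cvgM; [exact: cvg_cst|exact: cb'].
  move=> s hs; rewrite [leRHS]mulrC; apply: ler_wnM2l => //.
  rewrite /M -RintegralZc//; apply: le_Rintegralc.
  - by move=> y; apply: cvgM; [exact: cvg_cst|exact: ca].
  - exact: caz.
  move=> y hy; rewrite mulrC ler_wpM2l// zd//; first by rewrite ltr_norml; rewrite /L /U /rho in hy; slra.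
  by rewrite sub0r normrN ger0_norm; rewrite /rho in hr; slra.
have lowerb : - (C * h) <= - C * \int[mu]_(s in `[0, h]) b s.
  rewrite mulNr lerN2 ler_wpM2l//.
  have : `|\int[mu]_(s in `[0, h]) b s| <= 1 * (h - 0).
    apply: normr_Rintegral_segment; first exact: ltW.
    by move=> s _; have := b01 s => ?; rewrite ger0_norm; slra.
  by rewrite mul1r subr0; apply: le_trans; exact: ler_norm.
have : 0 < w / 2 * M by rewrite mulr_gt0// divr_gt0.
nra.
Qed.

Lemma weak_heat_initial (z zx g : R -> R -> R) x0 : weak_heat z zx g -> z x0 0 = 0.
Proof.
move=> H; have h1 := weak_heat_initial_le0 x0 H.
have h2 := weak_heat_initial_le0 x0 (weak_heat_opp H); slra.
Qed.

Lemma weak_heat_initial_small (z zx g : R -> R -> R) K e : weak_heat z zx g -> 0 < e ->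
  exists2 d, 0 < d & forall x t, `|x| <= K -> 0 <= t <= d -> `|z x t| <= e.
Proof.
move=> H e0.
have := @tube_continuity _ R (fun q => z q.1 q.2) 0 (- K) K e (wh_cont H) e0.
move=> /nbhs_ballP[d /= d0 hd]; exists (d / 2) => [|x t]; first by rewrite divr_gt0.
rewrite ler_norml => xK ht.
have := hd t; rewrite /ball/= sub0r normrN ger0_norm; last slra.
by move=> /(_ ltac:(slra) x xK); rewrite (weak_heat_initial _ H) subr0.
Qed.

End InitialValue.

(** * The error function and the heat kernel *)

Section ErrorFunction.
Context {R : realType}.
Notation mu := (@lebesgue_measure R).
Implicit Types (x y z : R).

Lemma sqrt_pi_gt0 : 0 < Num.sqrt pi :> R.
Proof. by rewrite sqrtr_gt0 pi_gt0. Qed.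

(** Integration from minus infinity gives a single primitive on the whole line, which removes the
    case distinction in [erf]. *)
Lemma gauss_primitive : exists F : R -> R, forall x, is_derive x 1 F (expR (- x ^+ 2)).
Proof.
exists (fun x => \int[mu]_(t in [set` Interval -oo%O (BRight x)]) gauss_fun t) => x.
have int u : mu.-integrable [set` Interval -oo%O (BRight u)] (EFin \o @gauss_fun R).
  by apply: integrableS integrableT_gauss.
have h1 : x < x + 1 by lra.
have [|dF F'] := @continuous_FTC1 R (@gauss_fun R) -oo%O x (x + 1) h1 (int _) _
    (@continuous_gauss_fun R x); first by rewrite ltNyr.
apply: DeriveDef; first exact: dF.
by rewrite -derive1E F'.
Qed.

Lemma continuous_expRN2 : continuous (fun x => expR (- x ^+ 2)).
Proof. exact: continuous_gauss_fun. Qed.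

Lemma erfE (F : R -> R) : (forall x : R, is_derive x 1 F (expR (- x ^+ 2))) ->
  forall z, erf z = 2 / Num.sqrt pi * (F z - F 0).
Proof.
move=> dF z; rewrite /erf; congr (_ * _); case: ifPn => [z0|].
  by rewrite (Rintegral_FTC2 z0 continuous_expRN2 dF).
rewrite -ltNge => /ltW z0.
by rewrite (Rintegral_FTC2 z0 continuous_expRN2 dF) opprB.
Qed.

Lemma is_derive_erf z : is_derive z 1 erf (2 / Num.sqrt pi * expR (- z ^+ 2)).
Proof.
have [F dF] := gauss_primitive.
rewrite (_ : erf = fun z => 2 / Num.sqrt pi * (F z - F 0)); last first.
  by apply/funext => x; exact: erfE.
apply: is_derive_scale.
exact: (is_derive_eq (is_derive_sub (dF z) (is_derive_const (F 0) z)) (subr0 _)).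
Qed.

Lemma continuous_erf : continuous (@erf R).
Proof. by move=> z; exact: is_derive_continuous (is_derive_erf z). Qed.

Lemma erf0 : erf 0 = 0 :> R.
Proof. by have [F dF] := gauss_primitive; rewrite (erfE dF) subrr mulr0. Qed.

Lemma erf_lt x y : x < y -> erf x < erf y.
Proof.
move=> xy; have [|c _ E] := @MVT R erf _ x y xy (fun z _ => is_derive_erf z) _.
  exact: continuous_subspaceT continuous_erf.
by rewrite -subr_gt0 E mulr_gt0 ?subr_gt0// mulr_gt0 ?expR_gt0// divr_gt0// sqrt_pi_gt0.
Qed.

Lemma erf_le x y : x <= y -> erf x <= erf y.
Proof. by rewrite le_eqVlt => /predU1P[->//|/erf_lt/ltW]. Qed.

Lemma erf_le_linear x : 0 <= x -> erf x <= 2 / Num.sqrt pi * x.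
Proof.
move=> x0; have [|c _] := @MVT_segment R erf _ 0 x x0 (fun z _ => is_derive_erf z) _.
  exact: continuous_subspaceT continuous_erf.
rewrite erf0 !subr0 => ->; rewrite ler_wpM2r// ler_piMr ?divr_ge0 ?sqrtr_ge0//.
by rewrite -expR0 ler_expR oppr_le0 sqr_ge0.
Qed.

Lemma erfN z : erf (- z) = - erf z.
Proof.
have d x : is_derive x 1 (fun x => erf (-1 * x + 0) + erf x) 0.
  have d1 := @is_derive_comp_affine R erf (-1) 0 x _ (is_derive_erf _).
  apply: (is_derive_eq (is_derive_add d1 (is_derive_erf x))).
  by rewrite addr0 !mulN1r sqrrN addNr.
have := @is_derive_0_is_cst R _ z 0 d.
rewrite !mulN1r !addr0 oppr0 erf0 addr0 => h; apply/eqP.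
by rewrite -addr_eq0; apply/eqP.
Qed.

(** The square of the Gaussian integral over [[0, x]] tends to pi / 4; a square root gives the
    limit. *)
Lemma cvg_erf : erf x @[x --> +oo] --> (1 : R).
Proof.
have c : (gauss_integral_proof.integral0_gauss x) ^+ 2 @[x --> +oo] --> (pi / 4 : R).
  exact: gauss_integral_proof.cvg_integral0_gauss_sqr.
have : Num.sqrt (gauss_integral_proof.integral0_gauss x ^+ 2) @[x --> +oo]
    --> Num.sqrt (pi / 4 : R).
  by apply: continuous_cvg => //; exact: sqrt_continuous.
have -> : Num.sqrt (pi / 4 : R) = Num.sqrt pi / 2.
  rewrite sqrtrM ?pi_ge0// sqrtrV// (_ : 4 = 2 ^+ 2); last by rewrite -natrX.
  by rewrite sqrtr_sqr ger0_norm.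
move=> {}c.
have -> : (1 : R) = 2 / Num.sqrt pi * (Num.sqrt pi / 2).
  by field; rewrite gt_eqF// sqrt_pi_gt0.
have e : 2 / Num.sqrt pi * Num.sqrt (gauss_integral_proof.integral0_gauss x ^+ 2)
    @[x --> +oo] --> 2 / Num.sqrt pi * (Num.sqrt pi / 2 : R).
  by apply: cvgM => //; exact: cvg_cst.
apply: cvg_trans e; apply: near_eq_cvg.
near=> x; rewrite sqrtr_sqr ger0_norm ?gauss_integral_proof.integral0_gauss_ge0//.
by rewrite /erf ifT//; near: x; apply: nbhs_pinfty_ge; rewrite num_real.
Unshelve. all: by end_near. Qed.

Lemma erf_lt1 z : erf z < 1.
Proof.
have zz : z < z + 1 by lra.
apply: lt_le_trans (erf_lt zz) _.
have -> : 1 = lim (erf x @[x --> +oo]) :> R by apply/esym/cvg_lim => //; exact: cvg_erf.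
apply: limr_ge; first by apply/cvg_ex; exists 1; exact: cvg_erf.
by near=> x; apply: erf_le; near: x; apply: nbhs_pinfty_ge; rewrite num_real.
Unshelve. all: by end_near. Qed.

Lemma erf_gt0 z : 0 < z -> 0 < erf z.
Proof. by move=> z0; rewrite -erf0; exact: erf_lt. Qed.

Lemma erfc_gt0 z : 0 < erfc z.
Proof. by rewrite subr_gt0 erf_lt1. Qed.

Lemma erfc_le x y : x <= y -> erfc y <= erfc x.
Proof. by move=> xy; rewrite lerB// erf_le. Qed.

Lemma erfc_le1 z : 0 <= z -> erfc z <= 1.
Proof. by move=> z0; rewrite gerBl -erf0 erf_le. Qed.

Lemma erfcN z : erfc (- z) = 2 - erfc z.
Proof. by rewrite /erfc erfN; ring. Qed.

Lemma is_derive_erfc z : is_derive z 1 erfc (- (2 / Num.sqrt pi * expR (- z ^+ 2))).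
Proof.
exact: (is_derive_eq (is_derive_sub (is_derive_const 1 z) (is_derive_erf z)) (sub0r _)).
Qed.

Lemma continuous_erfc : continuous (@erfc R).
Proof. by move=> z; exact: is_derive_continuous (is_derive_erfc z). Qed.

Lemma cvg_erfc : erfc x @[x --> +oo] --> (0 : R).
Proof. by rewrite -(subrr 1); apply: cvgB; [exact: cvg_cst|exact: cvg_erf]. Qed.

Lemma is_derive_gauss z :
  is_derive z 1 (fun z => expR (- z ^+ 2)) (- (2 * z) * expR (- z ^+ 2)).
Proof.
have d : is_derive z 1 (fun z => - z ^+ 2) (- (2 * z)).
  have d1 := is_derive_sqr_sub 0 z; rewrite subr0 in d1.
  apply: is_deriveN.
  by under eq_fun do rewrite -[_ ^+ 2](congr1 (fun u => u ^+ 2) (subr0 _)).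
rewrite mulrC; exact: is_derive1_comp.
Qed.

(* [expR 1 * expR (- z ^+ 2) - erfc z] is nonincreasing on [1, +oo[ with limit 0. *)
Lemma erfc_le_gauss z : 0 <= z -> erfc z <= expR 1 * expR (- z ^+ 2).
Proof.
move=> z0; have [z1|z1] := lerP z 1.
  apply: le_trans (erfc_le1 z0) _; rewrite -expRD -[leLHS]expR0 ler_expR.
  by rewrite subr_ge0 expr_le1.
pose f x := expR 1 * expR (- x ^+ 2) - erfc x.
have df x : is_derive x 1 f (expR 1 * (- (2 * x) * expR (- x ^+ 2)) -
    - (2 / Num.sqrt pi * expR (- x ^+ 2))).
  exact: is_derive_sub (is_derive_scale _ (is_derive_gauss x)) (is_derive_erfc x).
have dec x y : 1 <= x -> x <= y -> f y <= f x.
  move=> x1 xy; have [|c] := @MVT_segment R f _ x y xy (fun z _ => df z) _.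
    by apply: continuous_subspaceT => u; exact: is_derive_continuous (df u).
  rewrite in_itv/= => /andP[xc _] E; rewrite -subr_le0 E.
  rewrite mulr_le0_ge0 ?subr_ge0// opprK mulrA -mulrDl mulr_le0_ge0 ?expR_ge0//.
  have c1 : 1 <= c by exact: le_trans xc.
  have e1 : 1 + 1 <= expR 1 :> R by exact: expR_ge1Dx.
  have p1 : 2 / Num.sqrt pi <= 2 :> R.
    rewrite ler_pdivrMr ?sqrt_pi_gt0// ler_peMr//.
    rewrite -(sqrtr1 R) ler_sqrt ?pi_gt0//; have := pi_ge2 R; lra.
  nra.
have cf : f x @[x --> +oo] --> (0 : R).
  rewrite -(subr0 0); apply: cvgB; last exact: cvg_erfc.
  by rewrite -(mulr0 (expR 1)); apply: cvgM; [exact: cvg_cst|exact: cvg_gauss_fun].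
rewrite -subr_ge0 -/(f z).
have -> : 0 = lim (f x @[x --> +oo]) :> R by apply/esym/cvg_lim.
apply: limr_le; first by apply/cvg_ex; exists 0.
by near=> x; apply: dec; [exact: ltW|near: x; apply: nbhs_pinfty_ge; rewrite num_real].
Unshelve. all: by end_near. Qed.

Lemma Rintegral_gauss_tail (m : R) :
  \int[mu]_(zeta in `[m, +oo[) expR (- zeta ^+ 2 / 4) = Num.sqrt pi * erfc (m / 2).
Proof.
have d (x : R) : is_derive x 1 (fun x => Num.sqrt pi * erf (2^-1 * x + 0))
    (expR (- x ^+ 2 / 4)).
  apply: (is_derive_eq (is_derive_scale _ (is_derive_comp_affine (is_derive_erf _)))).
  rewrite addr0 (_ : - (2^-1 * x) ^+ 2 = - x ^+ 2 / 4); last by field.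
  by field; rewrite gt_eqF// sqrt_pi_gt0.
have cf : continuous (fun x : R => expR (- x ^+ 2 / 4)).
  move=> x; apply: (@continuous_comp _ _ _ (fun x : R => - x ^+ 2 / 4) expR); last exact: continuous_expR.
  by apply: cvgM; [apply: cvgN; exact: exprn_continuous|exact: cvg_cst].
rewrite (@Rintegral_ge0_continuous_FTC2y _ _ (fun x => Num.sqrt pi * erf (2^-1 * x + 0)) m (Num.sqrt pi * 1)).
- by rewrite addr0 -mulrBr (mulrC m).
- by move=> x _; exact: expR_ge0.
- exact: continuous_subspaceT.
- apply: cvgM; first exact: cvg_cst.
  apply: (@cvg_comp _ _ _ (fun x : R => 2^-1 * x + 0) erf _ +oo); last exact: cvg_erf.
  apply/cvgryPge => A; apply: filterS (nbhs_pinfty_ge (num_real (2 * A))) => x Ax.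
  by rewrite addr0 ler_pdivlMl.
- by move=> x _; have ? := d x; exact: ex_derive.
- apply: cvg_at_right_filter; exact: is_derive_continuous (d m).
- by move=> x _; rewrite derive1E; have h := d x; rewrite derive_val.
Qed.

End ErrorFunction.

(** * The self-similar solutions E and G of the heat equation *)

Section HeatFunctions.
Context {R : realType}.
Implicit Types (x t : R).

Definition heatE x t := erfc (x / 2 * (Num.sqrt t)^-1).
Definition heatG x t := (Num.sqrt t)^-1 * expR (- (x / 2 * (Num.sqrt t)^-1) ^+ 2).
(** [heatE_t] and [heatG_t] serve below both as time derivatives and as second space derivatives:
    sharing one formula is how the heat equation enters. [heatG] is the heat kernel up to a constant
    factor. *)
Definition heatE_t x t := x / (2 * t * Num.sqrt pi) * heatG x t.
Definition heatG_t x t := (x ^+ 2 / (4 * t ^+ 2) - (2 * t)^-1) * heatG x t.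

Lemma is_derive_rsqrt t : 0 < t ->
  is_derive t 1 (fun t => (Num.sqrt t)^-1) (- (2 * t)^-1 * (Num.sqrt t)^-1).
Proof.
move=> t0; have s0 : Num.sqrt t != 0 by rewrite gt_eqF// sqrtr_gt0.
apply: (is_derive_eq (@is_deriveV _ _ t _ 1 s0 (is_derive1_sqrt t0))).
rewrite /GRing.scale/=; have E := sqr_sqrtr (ltW t0).
by move: (Num.sqrt t) E s0 => s <- s0; field.
Qed.

Lemma is_derive_heatE_x x t : 0 < t ->
  is_derive x 1 (heatE ^~ t) (- (Num.sqrt pi)^-1 * heatG x t).
Proof.
move=> t0; pose k := 2^-1 * (Num.sqrt t)^-1.
have -> : heatE ^~ t = fun x => erfc (k * x + 0).
  by apply/funext => y; rewrite /heatE /k; congr erfc; ring.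
apply: (is_derive_eq (is_derive_comp_affine (is_derive_erfc _))).
rewrite /heatG (_ : x / 2 * (Num.sqrt t)^-1 = k * x + 0); last by rewrite /k; ring.
by rewrite /k; field; rewrite !gt_eqF// ?sqrt_pi_gt0// sqrtr_gt0.
Qed.

Lemma is_derive_heatG_x x t : 0 < t ->
  is_derive x 1 (heatG ^~ t) (- (x / (2 * t)) * heatG x t).
Proof.
move=> t0; pose k := 2^-1 * (Num.sqrt t)^-1.
have -> : heatG ^~ t = fun x => (Num.sqrt t)^-1 * expR (- (k * x + 0) ^+ 2).
  by apply/funext => y; rewrite /heatG /k; congr (_ * expR (- (_ ^+ 2))); ring.
apply: (is_derive_eq (is_derive_scale _
  (@is_derive_comp_affine R (fun z => expR (- z ^+ 2)) k 0 x _ (is_derive_gauss _)))).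
rewrite /heatG (_ : x / 2 * (Num.sqrt t)^-1 = k * x + 0); last by rewrite /k; ring.
move: (expR _) => e; rewrite /k; have E := sqr_sqrtr (ltW t0).
have s0 : Num.sqrt t != 0 by rewrite gt_eqF// sqrtr_gt0.
by move: (Num.sqrt t) E s0 => s <- s0; field.
Qed.

Lemma is_derive_heatE_xx x t : 0 < t ->
  is_derive x 1 (fun x => - (Num.sqrt pi)^-1 * heatG x t) (heatE_t x t).
Proof.
move=> t0; apply: (is_derive_eq (is_derive_scale _ (is_derive_heatG_x x t0))).
by rewrite /heatE_t; field; rewrite !gt_eqF// sqrt_pi_gt0.
Qed.

Lemma is_derive_heatG_xx x t : 0 < t ->
  is_derive x 1 (fun x => - (x / (2 * t)) * heatG x t) (heatG_t x t).
Proof.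
move=> t0; have d : is_derive x 1 (fun x => - (x / (2 * t))) (- (2 * t)^-1).
  have -> : (fun x => - (x / (2 * t))) = fun x => - (2 * t)^-1 * x + 0.
    by apply/funext => y; ring.
  exact: is_derive_affine.
apply: (is_derive_eq (is_derive_mul d (is_derive_heatG_x x t0))).
by rewrite /heatG_t; field; rewrite gt_eqF.
Qed.

Lemma is_derive_heatE_t x t : 0 < t -> is_derive t 1 (heatE x) (heatE_t x t).
Proof.
move=> t0.
apply: (is_derive_eq (@is_derive1_comp _ erfc (fun t => x / 2 * (Num.sqrt t)^-1) t _ _
  (is_derive_erfc _) (is_derive_scale (x / 2) (is_derive_rsqrt t0)))).
by rewrite /heatE_t /heatG; field; rewrite !gt_eqF// ?sqrt_pi_gt0// sqrtr_gt0.
Qed.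

Lemma is_derive_heatG_t x t : 0 < t -> is_derive t 1 (heatG x) (heatG_t x t).
Proof.
move=> t0; have d := @is_derive1_comp _ (fun z => expR (- z ^+ 2))
  (fun t => x / 2 * (Num.sqrt t)^-1) t _ _
  (is_derive_gauss _) (is_derive_scale (x / 2) (is_derive_rsqrt t0)).
apply: (is_derive_eq (is_derive_mul (is_derive_rsqrt t0) d)).
have s0 : Num.sqrt t != 0 by rewrite gt_eqF// sqrtr_gt0.
rewrite /heatG_t /heatG /comp; move: (expR _) => e.
have E := sqr_sqrtr (ltW t0).
by move: (Num.sqrt t) E s0 => s <- s0; field.
Qed.

Lemma continuous_heat_arg x t : 0 < t ->
  {for (x, t), continuous (fun q : R * R => q.1 / 2 * (Num.sqrt q.2)^-1)}.
Proof.
move=> t0; apply: cvgM; first by apply: cvgM; [exact: cvg_fst|exact: cvg_cst].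
apply: cvgV; first by rewrite gt_eqF// sqrtr_gt0.
by apply: (@continuous_comp _ _ _ snd Num.sqrt); [exact: cvg_snd|exact: sqrt_continuous].
Qed.

Lemma continuous_heatE x t : 0 < t ->
  {for (x, t), continuous (fun q : R * R => heatE q.1 q.2)}.
Proof.
move=> t0; apply: (@continuous_comp _ _ _ (fun q : R * R => q.1 / 2 * (Num.sqrt q.2)^-1) erfc).
  exact: continuous_heat_arg.
exact: continuous_erfc.
Qed.

Lemma continuous_heatG x t : 0 < t ->
  {for (x, t), continuous (fun q : R * R => heatG q.1 q.2)}.
Proof.
move=> t0; apply: cvgM.
  apply: cvgV; first by rewrite gt_eqF// sqrtr_gt0.
  by apply: (@continuous_comp _ _ _ snd Num.sqrt); [exact: cvg_snd|exact: sqrt_continuous].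
apply: (@continuous_comp _ _ _ (fun q : R * R => q.1 / 2 * (Num.sqrt q.2)^-1)
  (fun z => expR (- z ^+ 2))); first exact: continuous_heat_arg.
exact: continuous_expRN2.
Qed.

Lemma continuous_heatE_t x t : 0 < t ->
  {for (x, t), continuous (fun q : R * R => heatE_t q.1 q.2)}.
Proof.
move=> t0; apply: cvgM; last exact: continuous_heatG.
apply: cvgM; first exact: cvg_fst.
apply: cvgV; first by rewrite gt_eqF// !mulr_gt0// sqrt_pi_gt0.
by apply: cvgM; [apply: cvgM; [exact: cvg_cst|exact: cvg_snd]|exact: cvg_cst].
Qed.

Lemma continuous_heatG_t x t : 0 < t ->
  {for (x, t), continuous (fun q : R * R => heatG_t q.1 q.2)}.
Proof.
move=> t0; apply: cvgM; last exact: continuous_heatG.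
have c1 : {for (x, t), continuous (fun q : R * R => q.1 ^+ 2)}.
  by apply: (@continuous_comp _ _ _ fst (fun y : R => y ^+ 2)); [exact: cvg_fst|exact: exprn_continuous].
have c2 : {for (x, t), continuous (fun q : R * R => q.2 ^+ 2)}.
  by apply: (@continuous_comp _ _ _ snd (fun y : R => y ^+ 2)); [exact: cvg_snd|exact: exprn_continuous].
apply: cvgB.
  apply: cvgM; first exact: c1.
  apply: cvgV; first by rewrite gt_eqF// mulr_gt0// exprn_gt0.
  by apply: cvgM; [exact: cvg_cst|exact: c2].
apply: cvgV; first by rewrite gt_eqF// mulr_gt0.
by apply: cvgM; [exact: cvg_cst|exact: cvg_snd].
Qed.

Lemma heatG_ge0 x t : 0 <= heatG x t.
Proof. by rewrite mulr_ge0 ?expR_ge0// invr_ge0 sqrtr_ge0. Qed.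

Lemma heatG_le x t : heatG x t <= (Num.sqrt t)^-1.
Proof.
rewrite ler_piMr ?invr_ge0 ?sqrtr_ge0//.
by rewrite -expR0 ler_expR oppr_le0 sqr_ge0.
Qed.

Lemma heatE_ge0 x t : 0 <= heatE x t.
Proof. exact: ltW (erfc_gt0 _). Qed.

Lemma heatE_le1 x t : 0 <= x -> heatE x t <= 1.
Proof. by move=> x0; rewrite erfc_le1// mulr_ge0 ?invr_ge0 ?sqrtr_ge0// divr_ge0. Qed.

Lemma heatE0 t : heatE 0 t = 1.
Proof. by rewrite /heatE !mul0r /erfc erf0 subr0. Qed.

Lemma heatE_le_heatG x t : 0 < t -> 0 <= x ->
  heatE x t <= expR 1 * Num.sqrt t * heatG x t.
Proof.
move=> t0 x0; rewrite /heatE /heatG mulrA mulfK ?gt_eqF ?sqrtr_gt0//.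
by apply: erfc_le_gauss; rewrite mulr_ge0 ?invr_ge0 ?sqrtr_ge0// divr_ge0.
Qed.

End HeatFunctions.

(** * Comparison with explicit barriers *)

Section Comparison.
Context {R : realType}.
Implicit Types (x t : R).

Definition barrier (c1 c2 c3 : R) (f : R -> R) x t :=
  c1 * heatE x t + c2 * heatG x t + c3 * t + f x.

Definition C2 (f f1 f2 : R -> R) := (forall x : R, is_derive x 1 f (f1 x)) /\
  (forall x : R, is_derive x 1 f1 (f2 x)) /\ continuous f2.

Lemma C2_continuous (f f1 f2 : R -> R) : C2 f f1 f2 -> continuous f.
Proof. by move=> [d _] x; exact: is_derive_continuous (d x). Qed.

Lemma continuous_barrier c1 c2 c3 f x t : 0 < t -> continuous f ->
  {for (x, t), continuous (fun q : R * R => barrier c1 c2 c3 f q.1 q.2)}.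
Proof.
move=> t0 cf; apply: cvgD; last first.
  by apply: (@continuous_comp _ _ _ fst f); [exact: cvg_fst|exact: cf].
apply: cvgD; last by apply: cvgM; [exact: cvg_cst|exact: cvg_snd].
apply: cvgD; apply: cvgM; first exact: cvg_cst.
- exact: continuous_heatE.
- exact: cvg_cst.
- exact: continuous_heatG.
Qed.

(** The heat terms contribute the same function [h] to the time derivative and to the second space
    derivative, so they cancel up to their oscillation on a small box. *)
Lemma touching_barrier (z zx g : R -> R -> R) c1 c2 c3 f f1 f2 x0 t0 r m :
  weak_heat z zx g -> C2 f f1 f2 -> 0 < t0 -> 0 < r ->
  (forall y s, `|y - x0| <= r -> 0 <= t0 - s <= r -> 0 <= s -> m <= g y s) ->
  (forall y s, `|y - x0| <= r -> 0 <= t0 - s <= r -> 0 <= s ->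
     z y s - barrier c1 c2 c3 f y s <= z x0 t0 - barrier c1 c2 c3 f x0 t0) ->
  c3 + m <= f2 x0.
Proof.
move=> H [df [df1 cf2]] t00 r0 gm zmax; rewrite leNgt; apply/negP => Hlt.
(* The oscillation of [h] enters twice and that of [f2] once, which uses up [3 * e] of the gap
   [4 * e]. *)
pose e := (c3 + m - f2 x0) / 4.
have e0 : 0 < e by rewrite divr_gt0//; lra.
pose h y s := c1 * heatE_t y s + c2 * heatG_t y s.
have ch : {for (x0, t0), continuous (fun q : R * R => h q.1 q.2)}.
  apply: cvgD; apply: cvgM; first exact: cvg_cst.
  - exact: continuous_heatE_t.
  - exact: cvg_cst.
  - exact: continuous_heatG_t.
have [d1 d10 hd1] : exists2 d, 0 < d & forall y s, `|x0 - y| < d -> `|t0 - s| < d ->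
    `|h y s - h x0 t0| <= e.
  have /cvgrPdist_le/(_ _ e0) := ch.
  move=> /nbhs_ballP[d /= d0 hd]; exists d => // y s hy hs.
  by rewrite distrC; exact: (hd (y, s) (conj hy hs)).
have [d2 d20 hd2] : exists2 d, 0 < d & forall y, `|x0 - y| < d -> `|f2 x0 - f2 y| <= e.
  by have /cvgrPdist_le/(_ _ e0)/nbhs_ballP[d /= d0 hd] := cf2 x0; exists d.
pose q := Num.min (Num.min (d1 / 2) (d2 / 2)) (Num.min (r / 2) (t0 / 2)).
have q0 : 0 < q by rewrite !lt_min !divr_gt0.
have qd1 : q < d1.
  apply: (@le_lt_trans _ _ (d1 / 2)); first by rewrite !ge_min lexx.
  by clear - d10; lra.
have qd2 : q < d2.
  apply: (@le_lt_trans _ _ (d2 / 2)); first by rewrite !ge_min lexx orbT.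
  by clear - d20; lra.
have qr : q <= r / 2 by rewrite !ge_min lexx !orbT.
have qt : q < t0.
  apply: (@le_lt_trans _ _ (t0 / 2)); first by rewrite !ge_min lexx !orbT.
  by clear - t00; lra.
have box (k : R) y : x0 - k <= y <= x0 + k -> `|y - x0| <= k.
  by clear; rewrite ler_norml; lra.
have := @touching_from_above _ z zx g x0 t0 q m (h x0 t0 - e + c3) (h x0 t0 + e + (f2 x0 + e))
  (barrier c1 c2 c3 f)
  (fun y s => c1 * (- (Num.sqrt pi)^-1 * heatG y s) + c2 * (- (y / (2 * s)) * heatG y s) + 0 + f1 y)
  (fun y s => c1 * heatE_t y s + c2 * heatG_t y s + 0 + f2 y)
  (fun y s => c1 * heatE_t y s + c2 * heatG_t y s + c3 + 0) H q0 qt.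
have W : ~ (h x0 t0 - e + c3 + m <= h x0 t0 + e + (f2 x0 + e)).
  have Em : c3 + m = f2 x0 + 4 * e by rewrite /e; field.
  by clearbody e; clear - e0 Em; move: (h x0 t0) => w; lra.
move=> /(_ _ _ _ _)/W; apply.
- move=> y s hy hs; apply: gm; clear - hy hs qr qt q0 r0 box.
  + by apply: box; lra.
  + lra.
  + lra.
- move=> y s hy hs; have s0 : 0 < s by clear - hs qt; lra.
  split.
  + by apply: continuous_barrier => // x; exact: is_derive_continuous (df x).
  + exact: is_derive_add (is_derive_add (is_derive_add
      (is_derive_scale c1 (is_derive_heatE_x y s0))
      (is_derive_scale c2 (is_derive_heatG_x y s0))) (is_derive_const (c3 * s) y)) (df y).
  + exact: is_derive_add (is_derive_add (is_derive_add
      (is_derive_scale c1 (is_derive_heatE_xx y s0))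
      (is_derive_scale c2 (is_derive_heatG_xx y s0))) (is_derive_const 0 y)) (df1 y).
  + have d3 : is_derive s 1 (fun s => c3 * s) c3.
      have := @is_derive_affine R c3 0 s.
      by under eq_fun do rewrite addr0.
    exact: is_derive_add (is_derive_add (is_derive_add
      (is_derive_scale c1 (is_derive_heatE_t y s0))
      (is_derive_scale c2 (is_derive_heatG_t y s0))) d3) (is_derive_const (f y) s).
- move=> y s hy hs.
  have h1 : `|h y s - h x0 t0| <= e.
    apply: hd1; rewrite distrC; apply: le_lt_trans qd1.
      exact: box.
    by clear - hs q0; rewrite ler_norml; lra.
  have h2 : `|f2 x0 - f2 y| <= e.
    by apply: hd2; rewrite distrC; apply: le_lt_trans qd2; exact: box.
  rewrite -/(h y s); clear - h1 h2; move: h1 h2; rewrite !ler_norml; lra.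
- move=> y s hy hs; apply: zmax; clear - hy hs qr qt q0 r0 box.
  + by apply: box; lra.
  + lra.
  + lra.
Qed.

(** At a positive maximum of [z - Phi], a smooth barrier that lies above [Phi] nearby and agrees
    with it at the point makes [z] minus the barrier maximal there too, so [Phi] itself may have
    kinks. Barrier and source bound are requested only where [Phi < z], which is where the sign of
    the source can be exploited. *)
Lemma comparison (z zx g Phi : R -> R -> R) (a b t1 T : R) :
  weak_heat z zx g -> 0 < t1 ->
  (forall x t, a <= x <= b -> t1 <= t <= T ->
     {for (x, t), continuous (fun q : R * R => Phi q.1 q.2)}) ->
  (forall x, a <= x <= b -> z x t1 <= Phi x t1) ->
  (forall t, t1 <= t <= T -> z a t <= Phi a t) ->
  (forall t, t1 <= t <= T -> z b t <= Phi b t) ->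
  (forall x0 t0, a < x0 < b -> t1 < t0 <= T -> Phi x0 t0 < z x0 t0 ->
    exists c1 c2 c3 f f1 f2 r m, [/\ C2 f f1 f2, 0 < r /\ f2 x0 < c3 + m,
      Phi x0 t0 = barrier c1 c2 c3 f x0 t0,
      (forall y s, `|y - x0| <= r -> 0 <= t0 - s <= r -> 0 < s ->
         Phi y s <= barrier c1 c2 c3 f y s) &
      (forall y s, `|y - x0| <= r -> 0 <= t0 - s <= r -> 0 <= s -> m <= g y s)]) ->
  forall x t, a <= x <= b -> t1 <= t <= T -> z x t <= Phi x t.
Proof.
move=> H t10 cPhi bot left right int x t hx ht.
have ab : a <= b by clear - hx; lra.
have tT : t1 <= T by clear - ht; lra.
pose Q : set (R * R) := `[a, b] `*` `[t1, T].
have cF : {within Q, continuous (fun q : R * R => z q.1 q.2 - Phi q.1 q.2)}.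
  apply: continuous_in_subspaceT => q; rewrite inE /Q/= => -[]; rewrite /= ?in_itv/= => q1 q2.
  apply: cvgB; first exact: (wh_cont H).
  by have := cPhi q.1 q.2 q1 q2; case: q {q1 q2}.
have [||[x0 t0]] := @compact_EVT_max _ _ _ Q _ _ cF.
- by exists (a, t1); split => /=; rewrite in_itv/= lexx.
- by apply: compact_setX; exact: segment_compact.
rewrite inE /Q/= => -[]; rewrite /= ?in_itv/= => hx0 ht0 Hmax.
have {}Hmax y s : a <= y <= b -> t1 <= s <= T -> z y s - Phi y s <= z x0 t0 - Phi x0 t0.
  by move=> hy hs; apply: (Hmax (y, s)); rewrite inE; split; rewrite /= in_itv.
rewrite leNgt; apply/negP => Hxt.
have Hx0 : Phi x0 t0 < z x0 t0.
  by have := Hmax x t hx ht; clear - Hxt; lra.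
have ax0 : a < x0.
  rewrite lt_neqAle; have /andP[-> _] := hx0; rewrite andbT; apply/eqP => E.
  by have := left t0 ht0; rewrite E leNgt Hx0.
have x0b : x0 < b.
  rewrite lt_neqAle; have /andP[_ ->] := hx0; rewrite andbT; apply/eqP => E.
  by have := right t0 ht0; rewrite -E leNgt Hx0.
have t1t0 : t1 < t0.
  rewrite lt_neqAle; have /andP[-> _] := ht0; rewrite andbT; apply/eqP => E.
  by have := bot x0 hx0; rewrite E leNgt Hx0.
have [||c1 [c2 [c3 [f [f1 [f2 [r [m [Cf [r0 fm] E above gm]]]]]]]]] := int x0 t0 _ _ Hx0.
- by rewrite ax0.
- by rewrite t1t0; have /andP[] := ht0.
pose r' := Num.min r (Num.min (Num.min (x0 - a) (b - x0)) (t0 - t1)).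
have r'0 : 0 < r' by rewrite !lt_min r0 !subr_gt0 ax0 x0b t1t0.
have r'r : r' <= r by rewrite ge_min lexx.
have r'a : r' <= x0 - a by rewrite !ge_min lexx !orbT.
have r'b : r' <= b - x0 by rewrite !ge_min lexx !orbT.
have r't : r' <= t0 - t1 by rewrite !ge_min lexx !orbT.
suff : c3 + m <= f2 x0 by rewrite leNgt fm.
apply: (@touching_barrier z zx g c1 c2 c3 f f1 f2 x0 t0 r' m) => //.
- exact: lt_trans t1t0.
- move=> y s hy hs s0; apply: gm => //; first exact: le_trans r'r.
  by have /andP[-> /le_trans ->] := hs.
move=> y s hy hs s0.
have hs' : t1 <= s <= T by clear - hs r't ht0; lra.
have hy' : a <= y <= b by move: hy; rewrite ler_norml; clear - r'a r'b; lra.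
rewrite -E; apply: le_trans (Hmax y s hy' hs'); rewrite lerB// above//.
- exact: le_trans r'r.
- by have /andP[-> /le_trans ->] := hs.
- by apply: lt_le_trans t10 _; have /andP[] := hs'.
Qed.

Lemma comparison_barrier (z zx g : R -> R -> R) c1 c2 c3 f f1 f2 (a b t1 T : R) :
  weak_heat z zx g -> C2 f f1 f2 -> 0 < t1 ->
  (forall x, a <= x <= b -> z x t1 <= barrier c1 c2 c3 f x t1) ->
  (forall t, t1 <= t <= T -> z a t <= barrier c1 c2 c3 f a t) ->
  (forall t, t1 <= t <= T -> z b t <= barrier c1 c2 c3 f b t) ->
  (forall x0 t0, a < x0 < b -> t1 < t0 <= T -> barrier c1 c2 c3 f x0 t0 < z x0 t0 ->
    exists r m, [/\ 0 < r, f2 x0 < c3 + m &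
      forall y s, `|y - x0| <= r -> 0 <= t0 - s <= r -> 0 <= s -> m <= g y s]) ->
  forall x t, a <= x <= b -> t1 <= t <= T -> z x t <= barrier c1 c2 c3 f x t.
Proof.
move=> H Cf t10 bot left right int; apply: (@comparison z zx g) => //.
  move=> x t hx ht; apply: continuous_barrier; last exact: C2_continuous Cf.
  by apply: lt_le_trans t10 _; have /andP[] := ht.
move=> x0 t0 hx0 ht0 /(int x0 t0 hx0 ht0)[r [m [r0 fm gm]]].
by exists c1, c2, c3, f, f1, f2, r, m; split.
Qed.

End Comparison.

(** * Kummer's function and the self-similar profiles *)

Section Kummer.
Context {R : realType}.
Implicit Types (z : R).

Lemma pochhammerS (a : R) n : pochhammer a n.+1 = pochhammer a n * (a + n%:R).
Proof. by rewrite /pochhammer big_ord_recr. Qed.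

Lemma pochhammer_gt0 (a : R) n : 0 < a -> 0 < pochhammer a n.
Proof. by move=> a0; apply: prodr_gt0 => i _; rewrite ltr_pwDl. Qed.

Lemma kummerM_same (a z : R) : 0 < a -> kummerM a a z = expR z.
Proof.
move=> a0; rewrite /kummerM /expR; congr (limn (series _)); apply/funext => n.
by rewrite divff ?mul1r// gt_eqF// pochhammer_gt0.
Qed.

Lemma pochhammer_half n :
  pochhammer (1 / 2) n / pochhammer (3 / 2) n = (2 * n + 1)%:R^-1 :> R.
Proof.
elim: n => [|n IH]; first by rewrite /pochhammer !big_ord0 divr1 muln0 add0n invr1.
have p0 : pochhammer (3 / 2) n != 0 :> R by rewrite gt_eqF// pochhammer_gt0// divr_gt0.
rewrite !pochhammerS invfM mulrACA IH.
have n0 : 0 <= n%:R :> R by [].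
have -> : (2 * n + 1)%:R = 2 * n%:R + 1 :> R by rewrite natrD natrM.
have -> : (2 * n.+1 + 1)%:R = 2 * (n%:R + 1) + 1 :> R by rewrite natrD natrM natr1.
move: (n%:R) n0 => x x0.
by field; rewrite !gt_eqF//; lra.
Qed.

Lemma is_derive_pow n z : is_derive z 1 (fun z => z ^+ n.+1) (n.+1%:R * z ^+ n).
Proof.
apply: DeriveDef; first exact: exprn_derivable.
by rewrite exp_derive /GRing.scale/= mulr1.
Qed.

(** Partial sums of the Maclaurin series of [Num.sqrt pi / 2 * erf]. *)
Definition erf_sum N z := \sum_(0 <= k < N) (-1) ^+ k / (k`!%:R * (2 * k + 1)%:R) * z ^+ (2 * k).+1.

Lemma is_derive_erf_sum N z :
  is_derive z 1 (erf_sum N) (series (exp_coeff (- z ^+ 2)) N).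
Proof.
elim: N => [|N IH].
  have -> : erf_sum 0 = fun=> 0 by apply/funext => x; rewrite /erf_sum big_geq.
  by rewrite /series/= big_geq//; exact: is_derive_const.
have -> : erf_sum N.+1 = fun x => erf_sum N x +
    (-1) ^+ N / (N`!%:R * (2 * N + 1)%:R) * x ^+ (2 * N).+1.
  by apply/funext => x; rewrite /erf_sum big_nat_recr.
rewrite seriesSr.
apply: (is_derive_eq (is_derive_add IH (is_derive_scale _ (is_derive_pow _ _)))).
congr (_ + _); rewrite /exp_coeff/= [(- z ^+ 2) ^+ N]exprNn -exprM addn1.
have f0 : N`!%:R != 0 :> R by rewrite pnatr_eq0 -lt0n fact_gt0.
have n0 : (2 * N).+1%:R != 0 :> R by rewrite pnatr_eq0.
by move: (_ ^+ N) (z ^+ _) (N`!%:R) f0 ((2 * N).+1%:R) n0 => a b c c0 d d0; field; rewrite c0 d0.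
Qed.

Lemma exp_tail_le (x y : R) N : `|x| <= y ->
  `|expR x - series (exp_coeff x) N| <= expR y - series (exp_coeff y) N.
Proof.
move=> xy; have cv u : series (exp_coeff u) M - series (exp_coeff u) N @[M --> \oo] -->
    (expR u - series (exp_coeff u) N : R).
  by apply: cvgB; [exact: is_cvg_series_exp_coeff|exact: cvg_cst].
have cvx : `|series (exp_coeff x) M - series (exp_coeff x) N| @[M --> \oo] -->
    `|expR x - series (exp_coeff x) N|.
  by apply: cvg_norm; exact: cv.
apply: ler_cvg_to cvx (cv y) _; near=> M.
have NM : (N <= M)%N by near: M; exact: nbhs_infty_ge.
rewrite !sub_series_geq//; apply: le_trans (ler_norm_sum _ _ _) _.
apply: ler_sum => k _; rewrite /exp_coeff/= normrM normfV normrX normr_nat.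
by rewrite ler_wpM2r ?invr_ge0// lerXn2r ?nnegrE// (le_trans _ xy).
Unshelve. all: by end_near. Qed.

(** The mean value theorem replaces termwise integration: the difference between [erf], suitably
    scaled, and its partial sum has a tail of the exponential series as derivative, and that tail is
    bounded on [[0, z]] by the one at [z ^+ 2]. *)
Lemma kummerM_erf z : 0 <= z ->
  2 * z * kummerM (1 / 2) (3 / 2) (- z ^+ 2) = Num.sqrt pi * erf z.
Proof.
move=> z0; pose tail N := expR (z ^+ 2) - series (exp_coeff (z ^+ 2)) N.
have cont N : continuous (fun y => Num.sqrt pi / 2 * erf y - erf_sum N y).
  move=> y; apply: cvgB.
    by apply: cvgM; [exact: cvg_cst|exact: continuous_erf].
  exact: is_derive_continuous (is_derive_erf_sum N y).
have D N (y : R) : is_derive y 1 (fun y => Num.sqrt pi / 2 * erf y - erf_sum N y)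
    (expR (- y ^+ 2) - series (exp_coeff (- y ^+ 2)) N).
  apply: (is_derive_eq (is_derive_sub (is_derive_scale _ (is_derive_erf y))
    (is_derive_erf_sum N y))).
  by congr (_ - _); field; rewrite gt_eqF// sqrt_pi_gt0.
have bnd N : `|Num.sqrt pi / 2 * erf z - erf_sum N z| <= tail N * z.
  have [|c] := @MVT_segment R _ _ 0 z z0 (fun y _ => D N y) _.
    exact: continuous_subspaceT.
  rewrite in_itv/= => /andP[c0 cz]; rewrite erf0 mulr0.
  have -> : erf_sum N 0 = 0.
    by rewrite /erf_sum big1// => k _; rewrite expr0n mulr0.
  rewrite !subr0 => ->; rewrite normrM (ger0_norm z0) ler_wpM2r//.
  by apply: exp_tail_le; rewrite normrN ger0_norm ?sqr_ge0// lerXn2r ?nnegrE.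
have tail0 : tail N * z @[N --> \oo] --> (0 : R).
  rewrite -(mul0r z) -(subrr (expR (z ^+ 2))); apply: cvgM; last exact: cvg_cst.
  by apply: cvgB; [exact: cvg_cst|exact: is_cvg_series_exp_coeff].
have cvs : erf_sum N z @[N --> \oo] --> Num.sqrt pi / 2 * erf z.
  apply/cvgrPdist_le => e e0.
  move/cvgrPdist_le : tail0 => /(_ _ e0); apply: filterS => N.
  rewrite sub0r normrN => hN; apply: le_trans (bnd N) (le_trans _ hN).
  exact: ler_norm.
have [->|zn0] := eqVneq z 0; first by rewrite mulr0 mul0r erf0 mulr0.
have serE : series (fun n => pochhammer (1 / 2) n / pochhammer (3 / 2) n *
    ((- z ^+ 2) ^+ n / n`!%:R)) = fun N => z^-1 * erf_sum N z.
  apply/funext => N; rewrite /series/= /erf_sum big_distrr/=; apply: eq_bigr => k _.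
  rewrite pochhammer_half [(- z ^+ 2) ^+ k]exprNn -exprM exprS addn1.
  have f0 : k`!%:R != 0 :> R by rewrite pnatr_eq0 -lt0n fact_gt0.
  have n0 : (2 * k).+1%:R != 0 :> R by rewrite pnatr_eq0.
  by move: (_ ^+ k) (z ^+ _) (k`!%:R) f0 ((2 * k).+1%:R) n0 => a b c c0 d d0; field; rewrite c0 d0.
rewrite /kummerM serE.
have -> : limn (fun N => z^-1 * erf_sum N z) = z^-1 * (Num.sqrt pi / 2 * erf z).
  by apply/cvg_lim => //; apply: cvgM => //; exact: cvg_cst.
by field.
Qed.

End Kummer.

(** * Closed forms of the profiles *)

Section Profiles.
Context {R : realType}.
Implicit Types (alpha beta eta x t : R).

Definition psi_amplitude alpha beta : R :=
  alpha * beta / 2 * expR (alpha ^+ 2 / 4) * Num.sqrt pi.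

Lemma psi_amplitude_gt0 alpha beta : 0 < alpha -> 0 < beta -> 0 < psi_amplitude alpha beta.
Proof. by move=> a0 b0; rewrite !mulr_gt0 ?expR_gt0// sqrt_pi_gt0. Qed.

Lemma PsiE alpha beta eta :
  Psi alpha beta eta = psi_amplitude alpha beta * erfc (Num.max `|eta| alpha / 2).
Proof. by rewrite /Psi Rintegral_gauss_tail mulrA. Qed.

Lemma Psi_alpha alpha beta : 0 < alpha ->
  Psi alpha beta alpha = psi_amplitude alpha beta * erfc (alpha / 2).
Proof. by move=> a0; rewrite PsiE (gtr0_norm a0) maxxx. Qed.

Lemma u0starE alpha beta : 0 < alpha ->
  u0star alpha beta = Psi alpha beta alpha * erf (alpha / 2).
Proof.
move=> a0; rewrite Psi_alpha// /u0star kummerM_same//.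
have -> : alpha * kummerM (1 / 2) (3 / 2) (- (alpha ^+ 2 / 4)) =
    Num.sqrt pi * erf (alpha / 2).
  rewrite -kummerM_erf; last by rewrite divr_ge0// ltW.
  have -> : 2 * (alpha / 2) = alpha by field.
  by rewrite (_ : - (alpha / 2) ^+ 2 = - (alpha ^+ 2 / 4))//; field.
rewrite /psi_amplitude expRN.
have e0 : expR (alpha ^+ 2 / 4) != 0 by rewrite gt_eqF// expR_gt0.
have s0 : Num.sqrt pi != 0 :> R by rewrite gt_eqF// sqrt_pi_gt0.
have r0 : erf (alpha / 2) != 0 by rewrite gt_eqF// erf_gt0// divr_gt0.
have r1 : 1 - erf (alpha / 2) != 0 by rewrite gt_eqF// erfc_gt0.
rewrite /erfc; move: (expR _) e0 (Num.sqrt pi) s0 (erf _) r0 r1 => e e0 s s0 r r0 r1.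
(* With [r] standing for [erf (alpha / 2)], the two quotients merge because r + (1 - r) = 1. *)
rewrite (_ : e^-1 / (s * r) + e^-1 / (s * (1 - r)) = (e * s * r * (1 - r))^-1).
  by rewrite invrK; ring.
by field; rewrite e0 s0 r0 r1.
Qed.

Lemma Phi0E alpha beta eta : 0 < alpha -> 0 <= eta ->
  Phi0 alpha beta eta = Psi alpha beta eta - Psi alpha beta alpha * erfc (eta / 2).
Proof.
move=> a0 eta0; rewrite /Phi0 u0starE// (PsiE _ _ eta) Psi_alpha// ger0_norm//.
have r0 : erf (alpha / 2) != 0 by rewrite gt_eqF// erf_gt0// divr_gt0.
have r1 : erfc (alpha / 2) != 0 by rewrite gt_eqF// erfc_gt0.
case: ltrP => ea.
  by rewrite [erfc (eta / 2)]/erfc; field.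
rewrite /erfc in r1 *; by field.
Qed.

(** The profile increases up to [alpha], where it equals [u0star], and decreases afterwards. *)
Lemma Phi0_le alpha beta eta : 0 < alpha -> 0 < beta -> 0 <= eta ->
  Phi0 alpha beta eta <= u0star alpha beta.
Proof.
move=> a0 b0 eta0.
have u0 : 0 <= u0star alpha beta.
  rewrite u0starE// Psi_alpha//; apply: ltW.
  apply: mulr_gt0; last by apply: erf_gt0; rewrite divr_gt0.
  by apply: mulr_gt0; [exact: psi_amplitude_gt0|exact: erfc_gt0].
rewrite /Phi0; case: ltrP => ea; rewrite mulrAC -mulrA ler_piMr//.
  by rewrite ler_pdivrMr ?erf_gt0 ?divr_gt0// mul1r erf_le// ler_pM2r// ltW.
by rewrite ler_pdivrMr ?erfc_gt0// mul1r erfc_le// ler_pM2r.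
Qed.

End Profiles.

(** * The HHMO-model *)

Section PsiFacts.
Context {R : realType}.
Variables (alpha beta : R).
Hypotheses (alpha0 : 0 < alpha) (beta0 : 0 < beta).
Implicit Types (x t : R).
Local Notation K := (psi_amplitude alpha beta).
Local Notation P := (Psi alpha beta alpha).
Local Notation psi := (psi alpha beta).

Lemma Psi_alpha_gt0 : 0 < P.
Proof. by rewrite Psi_alpha// mulr_gt0 ?psi_amplitude_gt0// erfc_gt0. Qed.

Lemma psiE x t : 0 < t ->
  psi x t = K * erfc (Num.max `|x / Num.sqrt t| alpha / 2).
Proof. by move=> t0; rewrite /Defs.psi t0 PsiE. Qed.

Lemma psi_ge0 x t : 0 <= psi x t.
Proof.
rewrite /Defs.psi; case: ifP => _; last by case: ifP => // _; exact: ltW Psi_alpha_gt0.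
by rewrite PsiE; apply: ltW; rewrite mulr_gt0 ?psi_amplitude_gt0// erfc_gt0.
Qed.

Lemma psi_le x t : psi x t <= P.
Proof.
have P0 := Psi_alpha_gt0; rewrite /Defs.psi; case: ifP => _; last by case: ifP => // _; exact: ltW.
rewrite PsiE (Psi_alpha _ alpha0) (ler_pM2l (psi_amplitude_gt0 alpha0 beta0)).
by rewrite erfc_le// ler_pM2r// le_max lexx orbT.
Qed.

Lemma psiN x t : psi (- x) t = psi x t.
Proof.
rewrite /Defs.psi oppr_eq0; congr (if _ then _ else _).
by rewrite !PsiE mulNr normrN.
Qed.

Lemma psi_inner x t : 0 < t -> `|x| <= alpha * Num.sqrt t -> psi x t = P.
Proof.
move=> t0 xt; rewrite (psiE _ t0) (Psi_alpha _ alpha0); congr (_ * erfc (_ / 2)).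
apply: max_r; rewrite normrM normfV (ger0_norm (sqrtr_ge0 t)).
by rewrite ler_pdivrMr ?sqrtr_gt0.
Qed.

Lemma heatEE x t : heatE x t = erfc (x / Num.sqrt t / 2).
Proof. by rewrite /heatE mulrAC. Qed.

Lemma psi_outer x t : 0 < t -> alpha * Num.sqrt t <= x -> psi x t = K * heatE x t.
Proof.
move=> t0 xt; rewrite (psiE _ t0) heatEE; congr (_ * erfc (_ / 2)).
have x0 : 0 <= x by apply: le_trans xt; rewrite mulr_ge0 ?sqrtr_ge0// ltW.
rewrite ger0_norm ?divr_ge0 ?sqrtr_ge0//.
by apply: max_l; rewrite ler_pdivlMr ?sqrtr_gt0.
Qed.

Lemma psi_le_heatE x t : 0 < t -> psi x t <= K * heatE x t.
Proof.
move=> t0; rewrite psiE// ler_pM2l ?psi_amplitude_gt0//.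
rewrite heatEE erfc_le// ler_pM2r// le_max.
by rewrite ler_norm.
Qed.

Lemma continuous_psi x t : 0 < t -> {for (x, t), continuous (fun q : R * R => psi q.1 q.2)}.
Proof.
move=> t0.
have c : {for (x, t), continuous (fun q : R * R =>
    K * erfc (Num.max `|q.1 / Num.sqrt q.2| alpha / 2))}.
  apply: cvgM; first exact: cvg_cst.
  apply: (@continuous_comp _ _ _ (fun q : R * R => Num.max `|q.1 / Num.sqrt q.2| alpha / 2) erfc);
    last exact: continuous_erfc.
  apply: cvgM; last exact: cvg_cst.
  apply: (@continuous_max R (R * R)%type (fun q => `|q.1 / Num.sqrt q.2|) (cst alpha));
    last exact: cvg_cst.
  apply: (@continuous_comp _ _ _ (fun q : R * R => q.1 / Num.sqrt q.2) Num.norm);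
    last exact: norm_continuous.
  apply: cvgM; first exact: cvg_fst.
  apply: cvgV; first by rewrite gt_eqF// sqrtr_gt0.
  by apply: (@continuous_comp _ _ _ snd Num.sqrt); [exact: cvg_snd|exact: sqrt_continuous].
rewrite /prop_for /continuous_at /= psiE//.
apply: cvg_trans c; apply: near_eq_cvg.
have h : nbhs (x, t) (fun q : R * R => 0 < q.2).
  by apply: (@cvg_snd _ _ (nbhs x) (nbhs t) _ (fun s => 0 < s)); exact: lt_nbhsr.
by apply: filterS h => -[y s] /= s0; rewrite psiE.
Qed.

End PsiFacts.

(** * From the model to the weak heat equation *)

Section Instance.
Context {R : realType}.
Variables (alpha beta ustar : R) (u p : R -> R -> R).
Hypotheses (alpha0 : 0 < alpha) (beta0 : 0 < beta).
Hypothesis (hup : weak_solution alpha beta ustar u p).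
Implicit Types (x t : R).
Notation mu := (@lebesgue_measure R).
Local Notation P := (Psi alpha beta alpha).
Local Notation psi := (psi alpha beta).

Lemma p_bound x t : 0 <= t -> 0 <= p x t <= 1.
Proof.
move=> t0; case: (ltgtP (running_sup u x t) ustar%:E) => h.
- by rewrite (ws_below hup t0 h) lexx ler01.
- by rewrite (ws_above hup t0 h) lexx ler01.
- exact: (ws_at hup t0 h).
Qed.

(** Negative times are clipped to 0, which extends the difference continuously to the whole plane,
    as [weak_heat] requires. *)
Definition wdiff x t := u x (Num.max 0 t) - psi x (Num.max 0 t).
Definition wdiff_x x t :=
  derive1 (fun y => u y (Num.max 0 t) - psi y (Num.max 0 t)) x.

Lemma wdiffE x t : 0 <= t -> wdiff x t = u x t - psi x t.
Proof. by move=> t0; rewrite /wdiff max_r. Qed.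

Lemma continuous_clip (F : R * R -> R) :
  (forall T, 0 < T -> {within strip T, continuous F}) ->
  continuous (fun q : R * R => F (q.1, Num.max 0 q.2)).
Proof.
move=> cF [x0 t0]; apply/cvgrPdist_le => e e0.
pose T := Num.max 0 t0 + 1.
have T0 : 0 < T by rewrite ltr_wpDl// le_max lexx.
have /subspace_continuousP/(_ (x0, Num.max 0 t0)) := cF T T0.
rewrite /strip/= le_max lexx/= /T lerDl ler01 => /(_ isT).
move/cvgrPdist_le => /(_ _ e0) /nbhs_ballP[d /= d0 hd].
have cm : {for (x0, t0), continuous (fun q : R * R => (q.1, Num.max 0 q.2))}.
  apply: continuous_pair; first exact: cvg_fst.
  apply: (@continuous_comp _ _ _ snd (fun t : R => Num.max 0 t)); first exact: cvg_snd.
  exact: continuous_max0.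
have B1 : nbhs (x0, Num.max 0 t0) (ball (x0, Num.max 0 t0) (Num.min d 1)).
  by apply: nbhsx_ballx; rewrite lt_min d0 ltr01.
have B2 : \forall q \near (x0, t0), ball (x0, Num.max 0 t0) (Num.min d 1) (q.1, Num.max 0 q.2).
  exact: cm _ B1.
apply: filterS B2 => -[x t] /= [b1 b2].
apply: (hd (x, Num.max 0 t)).
  have md : Num.min d 1 <= d by rewrite ge_min lexx.
  by split; [exact: (lt_le_trans b1 md)|exact: (lt_le_trans b2 md)].
rewrite /= le_max lexx/=.
move: b2; rewrite /ball/= lt_min ltr_distl => /andP[_]; rewrite ltr_distlC.
by move=> /andP[_ /ltW].
Qed.

Lemma test_function_product (T : R) (a a' b b' : R -> R) :
  (forall x : R, is_derive x 1 a (a' x)) -> continuous a' ->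
  (exists K, forall x, K < `|x| -> a x = 0) ->
  (forall s : R, is_derive s 1 b (b' s)) -> continuous b' -> b T = 0 ->
  test_function T (fun x t => a x * b t) (fun x t => a' x * b t) (fun x t => a x * b' t).
Proof.
move=> da ca' [K aK] db cb' bT.
have ca : continuous a by move=> x; exact: is_derive_continuous (da x).
have cb : continuous b by move=> x; exact: is_derive_continuous (db x).
have cprod (f g : R -> R) : continuous f -> continuous g ->
    {within strip T, continuous (fun z : R * R => f z.1 * g z.2)}.
  move=> cf cg; apply: continuous_subspaceT => z; apply: cvgM.
    by apply: (@continuous_comp _ _ _ fst f); [exact: cvg_fst|exact: cf].
  by apply: (@continuous_comp _ _ _ snd g); [exact: cvg_snd|exact: cg].
split.
- move=> x t _.
  have -> : (fun y => a y * b t) = fun y => b t * a y by apply/funext => y; rewrite mulrC.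
  by rewrite mulrC; exact: is_derive_scale.
- move=> x t _; apply/cvgrPdist_le => e e0.
  have [d d0 hd] := is_derive_linear_approx (is_derive_scale (a x) (db t)) e0.
  have : \forall s \near t, `|s - t| < d.
    by apply/nbhs_ballP; exists d => //= s; rewrite /ball/= distrC.
  move=> hs; rewrite !near_withinE; apply: filterS hs => s sd st0 _.
  have st : s - t != 0 by rewrite subr_eq0.
  have := hd _ sd; rewrite (addrC t) subrK => h.
  have -> : a x * b' t - (a x * b s - a x * b t) / (s - t) =
      - (a x * b s - a x * b t - (s - t) * (a x * b' t)) / (s - t) by field.
  by rewrite mulNr normrN normrM normfV ler_pdivrMr ?normr_gt0.
- exact: cprod.
- exact: cprod.
- exact: cprod.
- by exists K => x t _ /aK ->; rewrite mul0r.
- by move=> x; rewrite bT mulr0.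
Qed.

Lemma u_bounded T : 0 < T -> exists M, forall x t, 0 <= t <= T -> `|u x t| <= M.
Proof.
move=> T0; have [M hM] := ws_bounded hup T0; exists (M + P) => x t ht.
have -> : u x t = (u x t - psi x t) + psi x t by rewrite subrK.
apply: le_trans (ler_normD _ _) _; rewrite lerD ?hM//.
by rewrite ger0_norm ?psi_ge0// psi_le.
Qed.

Lemma weak_heat_wdiff : weak_heat wdiff wdiff_x (fun x t => p x t * u x t).
Proof.
split.
- exact: (continuous_clip (ws_cont hup)).
- exact: (continuous_clip (ws_cont_dx hup)).
- move=> x t; have t0 : 0 <= Num.max 0 t by rewrite le_max lexx.
  have := derivableP (@ws_derivable _ _ _ _ _ _ hup x _ t0).
  by rewrite /wdiff_x derive1E.
- move=> T /u_bounded[M hM]; exists M => x t ht; rewrite normrM.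
  have [p0 p1] := andP (p_bound x (proj1 (andP ht))).
  by rewrite (ger0_norm p0) -[leRHS]mul1r ler_pM// hM.
move=> T a a' b b' T0 da ca' aK db cb' bT.
have := ws_weak hup T0 (test_function_product da ca' aK db cb' bT).
have mE s : s \in (`[0, T]%classic : set R) -> Num.max 0 s = s.
  by rewrite inE/= in_itv/= => /andP[s0 _]; rewrite max_r.
move=> E; transitivity (\int[mu]_(s in `[0, T]) \int[mu]_y
    (a y * b' s * (u y s - psi y s))).
  by apply: eq_Rintegral => s /mE hs; apply: eq_Rintegral => y _; rewrite /wdiff hs.
rewrite E.
by apply: eq_Rintegral => s /mE hs; apply: eq_Rintegral => y _; rewrite /wdiff_x hs.
Qed.

(** Restricted to positive times because [psi], and with it [u], is discontinuous at the space-time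
    origin. *)
Lemma continuous_u x t : 0 < t -> {for (x, t), continuous (fun q : R * R => u q.1 q.2)}.
Proof.
move=> t0; have c : {for (x, t), continuous (fun q : R * R => wdiff q.1 q.2 + psi q.1 q.2)}.
  apply: cvgD; last exact: continuous_psi.
  exact: (wh_cont weak_heat_wdiff).
have uE y s : 0 < s -> u y s = wdiff y s + psi y s.
  by move=> s0; rewrite wdiffE ?subrK// ltW.
rewrite /prop_for /continuous_at /= uE//.
apply: cvg_trans c; apply: near_eq_cvg.
have h : nbhs (x, t) (fun q : R * R => 0 < q.2).
  by apply: (@cvg_snd _ _ (nbhs x) (nbhs t) _ (fun s => 0 < s)); exact: lt_nbhsr.
by apply: filterS h => -[y s] /= s0; rewrite uE.
Qed.

End Instance.

Lemma C2_quadratic (R : realType) (c k : R) :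
  C2 (fun x => c + k * x ^+ 2) (fun x => 0 + k * (2 * x)) (fun=> 0 + k * 2).
Proof.
split; last split.
- move=> x; have d := is_derive_sqr_sub 0 x; rewrite subr0 in d.
  have -> : (fun x => c + k * x ^+ 2) = fun x => c + k * (x - 0) ^+ 2.
    by apply/funext => y; rewrite subr0.
  exact: is_derive_add (is_derive_const c x) (is_derive_scale k d).
- move=> x; apply: (is_derive_add (is_derive_const 0 x)); apply: is_derive_scale.
  have := is_derive_affine 2 0 x; by under eq_fun do rewrite addr0.
- by move=> x; exact: cvg_cst.
Qed.

Lemma le_perturbation (R : realType) (a b c : R) :
  (forall e, 0 < e -> a <= b + e * c) -> a <= b.
Proof.
move=> H; apply/ler_addgt0Pr => e e0.
have c0 : 0 < `|c| + 1 by rewrite ltr_wpDl.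
apply: le_trans (H (e / (`|c| + 1)) (divr_gt0 e0 c0)) _; rewrite lerD2l.
rewrite -mulrA ler_piMr ?(ltW e0)// mulrC ler_pdivrMr// mul1r.
by apply: le_trans (ler_norm c) _; rewrite lerDl.
Qed.

(** * Nonnegativity of u *)

Section MainEstimates.
Context {R : realType}.
Variables (alpha beta ustar : R) (u p : R -> R -> R).
Hypotheses (alpha0 : 0 < alpha) (beta0 : 0 < beta).
Hypothesis (hup : weak_solution alpha beta ustar u p).
Implicit Types (x t : R).
Local Notation K := (psi_amplitude alpha beta).
Local Notation P := (Psi alpha beta alpha).
Local Notation psi := (psi alpha beta).
Local Notation w := (wdiff alpha beta u).
Local Notation wx := (wdiff_x alpha beta u).
Local Notation H := (weak_heat_wdiff alpha0 beta0 hup).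

Lemma uE x t : 0 <= t -> u x t = psi x t + w x t.
Proof. by move=> t0; rewrite wdiffE// addrC subrK. Qed.

Lemma w_bounded T : 0 < T -> exists2 M, 0 <= M & forall x t, 0 <= t <= T -> `|w x t| <= M.
Proof.
move=> T0; have [M hM] := ws_bounded hup T0; exists (Num.max 0 M); first by rewrite le_max lexx.
move=> x t ht; rewrite wdiffE; last by have /andP[] := ht.
by rewrite le_max hM// orbT.
Qed.

Lemma w_initial_small L d : 0 < d ->
  exists2 tau, 0 < tau & forall x t, `|x| <= L -> 0 <= t <= tau -> `|w x t| <= d.
Proof. exact: weak_heat_initial_small H. Qed.

(** At [L] the term [e * L ^+ 2] exceeds the given bound, which settles the lateral sides on an
    interval around the point of interest. *)
Lemma quadratic_width (M e x : R) : 0 < e -> 0 <= M ->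
  exists L, [/\ 0 < L, `|x| < L & M <= e * L ^+ 2].
Proof.
move=> e0 M0; exists (`|x| + M / e + 1).
have Me : 0 <= M / e by rewrite divr_ge0// ltW.
have x0 := normr_ge0 x.
split; [lra|lra|].
rewrite -ler_pdivrMl// mulrC; nra.
Qed.

Lemma near_le0 (F : R -> R -> R) x0 t0 : {for (x0, t0), continuous (fun q : R * R => F q.1 q.2)} ->
  F x0 t0 < 0 -> exists2 r, 0 < r & forall y s, `|y - x0| <= r -> 0 <= t0 - s <= r -> F y s < 0.
Proof.
move=> cF F0; have F0' : 0 < - F x0 t0 / 2 by rewrite divr_gt0// oppr_gt0.
have /cvgrPdist_le/(_ _ F0')/nbhs_ballP[d /= d0 hd] := cF.
exists (d / 2) => [|y s hy hs]; first by rewrite divr_gt0.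
have hy' : `|x0 - y| < d by rewrite distrC; apply: le_lt_trans hy _; lra.
have hs' : `|t0 - s| < d by rewrite ger0_norm; lra.
have := hd (y, s) (conj hy' hs').
rewrite ler_norml; lra.
Qed.

(** Comparison of [- w] with [psi]: where [psi < - w], [u] is negative, so the source [- (p * u)] of
    [- w] is nonnegative, the sign that excludes a touching point. *)
Lemma u_ge0 x t : 0 <= t -> 0 <= u x t.
Proof.
rewrite le_eqVlt => /predU1P[<-|t0].
  by rewrite uE// (weak_heat_initial _ H) addr0 psi_ge0.
rewrite uE ?(ltW t0)// -lerBlDr sub0r.
apply: (@le_perturbation _ _ _ (1 + (x ^+ 2 + 3 * t))) => e e0.
have [M M0 wM] := w_bounded t0.
have [L [L0 xL ML]] := quadratic_width x e0 M0.
have [tau tau0 wt] := w_initial_small L e0.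
(* The barriers involve functions singular at time 0, so the comparison starts at a positive time at
   which [w] is still at most [e] in size. *)
pose t1 := Num.min tau t.
have t10 : 0 < t1 by rewrite lt_min tau0.
have t1t : t1 <= t by rewrite ge_min lexx orbT.
have t1tau : t1 <= tau by rewrite ge_min lexx.
(* The factor 3 beats 2, the second derivative of [y ^+ 2], and so yields a strict supersolution. *)
pose Phi y s := psi y s + (e + e * y ^+ 2 + 3 * e * s).
have -> : psi x t + e * (1 + (x ^+ 2 + 3 * t)) = Phi x t by rewrite /Phi; ring.
have ee y s : 0 <= s -> 0 <= e * y ^+ 2 /\ 0 <= 3 * e * s.
  move=> s0; split; first by rewrite mulr_ge0 ?sqr_ge0// ltW.
  by rewrite !mulr_ge0// ltW.
have wM' y s : 0 <= s <= t -> - w y s <= M.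
  by move=> hs; apply: le_trans (wM y s hs); rewrite -normrN ler_norm.
apply: (@comparison _ _ _ _ Phi (- L) L t1 t (weak_heat_opp H) t10).
- move=> y s hy hs; have s0 : 0 < s by apply: lt_le_trans t10 _; have /andP[] := hs.
  apply: cvgD; first exact: continuous_psi.
  apply: cvgD; last by apply: cvgM; [exact: cvg_cst|exact: cvg_snd].
  apply: cvgD; first exact: cvg_cst.
  apply: cvgM; first exact: cvg_cst.
  by apply: (@continuous_comp _ _ _ fst (fun y : R => y ^+ 2)); [exact: cvg_fst|exact: exprn_continuous].
- move=> y; rewrite -ler_norml => hy.
  have ht1 : 0 <= t1 <= tau by rewrite ltW.
  have := wt y t1 hy ht1; rewrite ler_norml => /andP[h _].
  have [? ?] := ee y t1 (ltW t10); have := psi_ge0 alpha0 beta0 y t1.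
  rewrite /Phi; slra.
- move=> s hs; have hs' : 0 <= s <= t by slra.
  have [? ?] := ee L s (proj1 (andP hs')).
  have := psi_ge0 alpha0 beta0 (- L) s; have := wM' (- L) s hs'.
  rewrite /Phi sqrrN; slra.
- move=> s hs; have hs' : 0 <= s <= t by slra.
  have [? ?] := ee L s (proj1 (andP hs')).
  have := psi_ge0 alpha0 beta0 L s; have := wM' L s hs'.
  rewrite /Phi; slra.
- move=> x0 t0' hx0 ht0' hPhi.
  have t0'0 : 0 < t0' by slra.
  have un : u x0 t0' < 0.
    have [? ?] := ee x0 t0' (ltW t0'0); rewrite uE ?(ltW t0'0)//.
    by move: hPhi; rewrite /Phi; slra.
  have [r r0 hr] := near_le0 (continuous_u alpha0 beta0 hup t0'0) un.
  have src y s : `|y - x0| <= r -> 0 <= t0' - s <= r -> 0 <= s -> 0 <= - (p y s * u y s).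
    move=> hy hs s0; rewrite oppr_ge0 mulr_ge0_le0//.
      by have /andP[] := p_bound hup y s0.
    by apply: ltW; exact: hr.
  (* The barrier is built on whichever of [P], [K * heatE y s] and [K * heatE (- y) s] attains the
     minimum [psi] at the point; the last one equals [2 * K - K * heatE y s]. *)
  have touch c1 k : psi x0 t0' = c1 * heatE x0 t0' + k ->
      (forall y s, 0 < s -> psi y s <= c1 * heatE y s + k) ->
      exists c1 c2 c3 f f1 f2 r m, [/\ C2 f f1 f2, 0 < r /\ f2 x0 < c3 + m,
      Phi x0 t0' = barrier c1 c2 c3 f x0 t0',
      (forall y s, `|y - x0| <= r -> 0 <= t0' - s <= r -> 0 < s ->
         Phi y s <= barrier c1 c2 c3 f y s) &
      (forall y s, `|y - x0| <= r -> 0 <= t0' - s <= r -> 0 <= s -> m <= - (p y s * u y s))].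
    move=> E le; exists c1, 0, (3 * e).
    eexists _, _, _, r, 0; split; first exact: (C2_quadratic (k + e) e).
    - by split => //; slra.
    - by rewrite /Phi /barrier E; ring.
    - move=> y s _ _ s0; rewrite (_ : barrier _ _ _ _ _ _ =
          c1 * heatE y s + k + (e + e * y ^+ 2 + 3 * e * s)); last first.
        by rewrite /barrier; ring.
      by rewrite lerD2r; exact: le.
    - exact: src.
  have [xs|xs] := lerP `|x0| (alpha * Num.sqrt t0').
    apply: (touch 0 P).
      by rewrite psi_inner// mul0r add0r.
    by move=> y s _; rewrite mul0r add0r psi_le.
  have [x00|x00] := lerP 0 x0.
    apply: (touch K 0).
      by rewrite addr0 psi_outer//; rewrite ger0_norm// in xs; exact: ltW.
    by move=> y s s0; rewrite addr0 psi_le_heatE.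
  have heatEN y s : heatE (- y) s = 2 - heatE y s.
    by rewrite /heatE !mulNr erfcN.
  apply: (touch (- K) (2 * K)).
    rewrite -psiN psi_outer//; first by rewrite heatEN; ring.
    by rewrite ltr0_norm// in xs; exact: ltW.
  move=> y s s0; rewrite -psiN; apply: le_trans (psi_le_heatE _ _ _ _) _ => //.
  by rewrite heatEN; slra.
- by have := ltr_norml x L; rewrite xL => /esym/andP[/ltW -> /ltW ->].
- by rewrite t1t lexx.
Qed.

End MainEstimates.

(** * The upper bound and absorption at the axis *)

Section MainEstimates2.
Context {R : realType}.
Variables (alpha beta ustar : R) (u p : R -> R -> R).
Hypotheses (alpha0 : 0 < alpha) (beta0 : 0 < beta).
Hypothesis (hup : weak_solution alpha beta ustar u p).
Implicit Types (x t : R).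
Local Notation K := (psi_amplitude alpha beta).
Local Notation P := (Psi alpha beta alpha).
Local Notation psi := (psi alpha beta).
Local Notation w := (wdiff alpha beta u).
Local Notation wx := (wdiff_x alpha beta u).
Local Notation H := (weak_heat_wdiff alpha0 beta0 hup).

Lemma source_ge0 x t : 0 <= t -> 0 <= p x t * u x t.
Proof.
move=> t0; rewrite mulr_ge0//; last exact: (u_ge0 alpha0 beta0 hup).
by have /andP[] := p_bound hup x t0.
Qed.

Lemma w_geNP x t : 0 <= t -> - P <= w x t.
Proof.
move=> t0; have := u_ge0 alpha0 beta0 hup x t0; rewrite (uE alpha beta u)//.
have := psi_le alpha0 beta0 x t; lra.
Qed.

Lemma w_le0 x t : 0 <= t -> w x t <= 0.
Proof.
rewrite le_eqVlt => /predU1P[<-|t0]; first by rewrite (weak_heat_initial _ H).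
apply: (@le_perturbation _ _ _ (1 + (x ^+ 2 + 3 * t))) => e e0.
have [M M0 wM] := w_bounded hup t0.
have [L [L0 xL ML]] := quadratic_width x e0 M0.
have [tau tau0 wt] := w_initial_small alpha0 beta0 hup L e0.
pose t1 := Num.min tau t.
have t10 : 0 < t1 by rewrite lt_min tau0.
have t1t : t1 <= t by rewrite ge_min lexx orbT.
have t1tau : t1 <= tau by rewrite ge_min lexx.
have -> : 0 + e * (1 + (x ^+ 2 + 3 * t)) = barrier 0 0 (3 * e) (fun x => e + e * x ^+ 2) x t.
  by rewrite /barrier; ring.
have ee s : 0 <= s -> 0 <= 3 * e * s by move=> s0; rewrite !mulr_ge0// ltW.
have wM' y s : 0 <= s <= t -> w y s <= M.
  by move=> hs; apply: le_trans (wM y s hs); exact: ler_norm.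
apply: (@comparison_barrier _ _ _ _ 0 0 (3 * e) _ _ _ (- L) L t1 t H (C2_quadratic e e) t10).
- move=> y; rewrite -ler_norml => hy.
  have ht1 : 0 <= t1 <= tau by rewrite ltW.
  have := wt y t1 hy ht1; rewrite ler_norml => /andP[_ h].
  have := ee t1 (ltW t10); have : 0 <= e * y ^+ 2 by rewrite mulr_ge0 ?sqr_ge0// ltW.
  rewrite /barrier; slra.
- move=> s hs; have hs' : 0 <= s <= t by slra.
  have := ee s (proj1 (andP hs')); have := wM' (- L) s hs'.
  rewrite /barrier sqrrN; slra.
- move=> s hs; have hs' : 0 <= s <= t by slra.
  have := ee s (proj1 (andP hs')); have := wM' L s hs'.
  rewrite /barrier; slra.
- move=> x0 t0' _ _ _; exists 1, 0; split => //; first by slra.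
  by move=> y s _ _; exact: source_ge0.
- by have := ltr_norml x L; rewrite xL => /esym/andP[/ltW -> /ltW ->].
- by rewrite t1t lexx.
Qed.

Lemma u_le_psi x t : 0 <= t -> u x t <= psi x t.
Proof. by move=> t0; rewrite (uE alpha beta u)// gerDl w_le0. Qed.

Hypothesis ustarP : ustar < P.

(* Near the origin [u] starts above the threshold, so a whole strip
   around the axis is absorbing after a short time. *)
Lemma absorbing_strip : exists c t1, [/\ 0 < c, 0 < t1 &
  forall x t, `|x| <= c -> t1 <= t -> p x t = 1 /\ psi x t = P].
Proof.
have d0 : 0 < (P - ustar) / 2 by rewrite divr_gt0// subr_gt0.
have [tau tau0 wt] := w_initial_small alpha0 beta0 hup 1 d0.
(* From time [tau] on, this strip lies in the plateau of [psi]. At [tau] itself [u] falls short of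
   [P] by at most half the gap, and the running supremum remembers that crossing. *)
exists (Num.min 1 (alpha * Num.sqrt tau)), tau; split => //.
  by rewrite lt_min ltr01 mulr_gt0// sqrtr_gt0.
move=> x t; rewrite le_min => /andP[x1 xs] tt.
have t0 : 0 < t by exact: lt_le_trans tt.
have psP s : tau <= s -> psi x s = P.
  move=> ts; apply: psi_inner => //; first exact: lt_le_trans ts.
  by apply: le_trans xs _; rewrite ler_wpM2l ?(ltW alpha0)// ler_wsqrtr.
split; last exact: psP.
apply: (ws_above hup (ltW t0)).
apply: (@lt_le_trans _ _ (u x tau)%:E).
  rewrite lte_fin (uE alpha beta u) ?(ltW tau0)// psP//.
  have := wt x tau x1; rewrite ltW// lexx => /(_ isT); rewrite ler_norml => /andP[h _].
  by move: h ustarP; slra.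
by apply: ereal_sup_ubound; exists tau => //=; rewrite in_itv/= ltW.
Qed.

(* A stationary supersolution: [S'' <= S] everywhere, and [S'' <= 0] where [c <= |x|]. *)
Definition log_profile (A c x : R) := A * (1 + c ^+ 2 / 2 * ln (1 + (x / c) ^+ 2)).
Definition log_profile1 (A c x : R) := A * c ^+ 2 * (x * (x ^+ 2 + c ^+ 2)^-1).
Definition log_profile2 (A c x : R) :=
  A * c ^+ 2 * ((c ^+ 2 - x ^+ 2) * (x ^+ 2 + c ^+ 2)^-1 ^+ 2).

Lemma C2_log_profile A c : 0 < c ->
  C2 (fun x => - P + log_profile A c x) (log_profile1 A c) (log_profile2 A c).
Proof.
move=> c0.
have den x : x ^+ 2 + c ^+ 2 != 0 by rewrite gt_eqF// ltr_wpDl ?sqr_ge0// exprn_gt0.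
have dsq x : is_derive x 1 (fun x => x ^+ 2 + c ^+ 2) (2 * x).
  have d := is_derive_sqr_sub 0 x; rewrite subr0 in d.
  have -> : (fun x => x ^+ 2 + c ^+ 2) = fun x => (x - 0) ^+ 2 + c ^+ 2.
    by apply/funext => y; rewrite subr0.
  exact: (is_derive_eq (is_derive_add d (is_derive_const _ x)) (addr0 _)).
split; last split.
- move=> x.
  have din : is_derive x 1 (fun x => 1 + (x / c) ^+ 2) (2 * x / c ^+ 2).
    have -> : (fun x => 1 + (x / c) ^+ 2) = fun x => (c ^+ 2)^-1 * (x ^+ 2 + c ^+ 2).
      by apply/funext => y; field; rewrite gt_eqF.
    by apply: (is_derive_eq (is_derive_scale _ (dsq x))); ring.
  have pos : 0 < 1 + (x / c) ^+ 2 by rewrite ltr_pwDl// sqr_ge0.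
  have dln := @is_derive1_comp _ (@ln R) _ x _ _ (is_derive1_ln pos) din.
  have := is_derive_add (is_derive_const (- P) x) (is_derive_scale A
    (is_derive_add (is_derive_const 1 x) (is_derive_scale (c ^+ 2 / 2) dln))).
  move=> d; apply: (is_derive_eq d).
  rewrite /log_profile1; have := den x => dx; field.
  by rewrite dx gt_eqF//= addrC.
- move=> x.
  have dinv := @is_deriveV _ (fun x => x ^+ 2 + c ^+ 2) x _ 1 (den x) (dsq x).
  have := is_derive_scale (A * c ^+ 2) (is_derive_mul (is_derive_id x 1) dinv).
  move=> d; apply: (is_derive_eq d).
  by rewrite /log_profile2 /GRing.scale/=; have := den x => dx; field.
- move=> x.
  have cs : continuous (fun x : R => x ^+ 2) by exact: exprn_continuous.
  apply: cvgM; first exact: cvg_cst.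
  apply: cvgM; first by apply: cvgB; [exact: cvg_cst|exact: cs].
  apply: (@continuous_comp _ _ _ (fun x => (x ^+ 2 + c ^+ 2)^-1) (fun y => y ^+ 2)); last exact: cs.
  by apply: cvgV => //; apply: cvgD; [exact: cs|exact: cvg_cst].
Qed.

Lemma log_profile_ge A c x : 0 <= A -> A <= log_profile A c x.
Proof.
move=> A0; rewrite /log_profile ler_peMr// lerDl mulr_ge0 ?divr_ge0 ?sqr_ge0//.
by rewrite ln_ge0// lerDl sqr_ge0.
Qed.

Lemma log_profile2_le A c x : 0 <= A -> 0 < c -> log_profile2 A c x <= A.
Proof.
move=> A0 c0; have d0 : 0 < x ^+ 2 + c ^+ 2 by rewrite ltr_wpDl ?sqr_ge0// exprn_gt0.
rewrite /log_profile2 -mulrA ler_piMr// exprVn mulrA ler_pdivrMr ?exprn_gt0// mul1r.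
have := sqr_ge0 x; have := sqr_ge0 c; nra.
Qed.

Lemma log_profile2_out A c x : 0 <= A -> 0 < c -> c <= `|x| -> log_profile2 A c x <= 0.
Proof.
move=> A0 c0 cx; apply: mulr_ge0_le0; first by rewrite mulr_ge0 ?sqr_ge0.
apply: mulr_le0_ge0; last exact: sqr_ge0.
rewrite subr_le0 -(real_normK (num_real x)).
by rewrite lerXn2r ?nnegrE// ltW.
Qed.

(** The logarithm is at least 2 N / c^2 at this abscissa, so the bracket is at least 1 + N: however
    small the amplitude, the profile reaches [P] on a wide enough interval. *)
Lemma log_profile_large c (N : R) : 0 < c -> 0 <= N ->
  P <= log_profile (P / (1 + N)) c (c * expR (N / c ^+ 2)).
Proof.
move=> c0 N0; have P0 := Psi_alpha_gt0 alpha0 beta0.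
have N1 : 0 < 1 + N by rewrite ltr_pwDl.
rewrite /log_profile (mulrC c) mulfK ?gt_eqF// -mulrA ler_peMr ?(ltW P0)//.
rewrite mulrC ler_pdivlMr// mul1r lerD2l -ler_pdivrMl; last by rewrite divr_gt0// exprn_gt0.
have -> : (c ^+ 2 / 2)^-1 * N = ln (expR (N / c ^+ 2) ^+ 2).
  by rewrite -expRM_natl expRK; field; rewrite gt_eqF.
by rewrite ler_ln ?posrE ?lerDr// ?exprn_gt0 ?expR_gt0// ltr_pwDl ?exprn_ge0 ?expR_ge0.
Qed.

(** Outside the strip the profile is concave and a nonnegative source suffices. Inside, a violation
    forces [w + P > A]; there the source is [u], which is [w + P], and so exceeds the second
    derivative of the profile, at most [A]. *)
Lemma w_axis d : 0 < d -> exists2 T1, 0 < T1 & forall t, T1 <= t -> w 0 t <= - P + d.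
Proof.
move=> d0; have P0 := Psi_alpha_gt0 alpha0 beta0.
have [c [t1 [c0 t10 strip]]] := absorbing_strip.
pose N := 2 * P / d.
have N0 : 0 < N by rewrite divr_gt0// mulr_gt0.
pose A := P / (1 + N).
have A0 : 0 < A by rewrite divr_gt0// ltr_wpDl// ltW.
have Ad : A <= d / 2.
  rewrite ler_pdivrMr; last by rewrite ltr_pwDl// ltW.
  have -> : d / 2 * (1 + N) = P + d / 2 by rewrite /N; field; rewrite gt_eqF.
  by rewrite lerDl divr_ge0// ltW.
pose L := c * expR (N / c ^+ 2).
have L0 : 0 < L by rewrite mulr_gt0// expR_gt0.
have SL : P <= log_profile A c L by exact: log_profile_large (ltW N0).
clearbody L.
(* On the interval [heatG] is smallest at the ends, so [C * heatG] is at least [P] at time [t1] and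
   the barrier starts above 0. After [T1] this term is at most [d / 2] on the axis. *)
pose C := P / heatG L t1.
have G0 y s : 0 < s -> 0 < heatG y s.
  by move=> s0; rewrite mulr_gt0 ?expR_gt0// invr_gt0 sqrtr_gt0.
have C0 : 0 < C by rewrite divr_gt0// G0.
pose T1 := Num.max t1 ((2 * C / d) ^+ 2).
exists T1 => [|t]; first by rewrite lt_max t10.
rewrite ge_max => /andP[t1t Ct].
have t0 : 0 < t by exact: lt_le_trans t1t.
have key : w 0 t <= - P + A + C * heatG 0 t.
  apply: (@le_perturbation _ _ _ t) => e e0.
  have -> : - P + A + C * heatG 0 t + e * t =
      barrier 0 C e (fun x => - P + log_profile A c x) 0 t.
    by rewrite /barrier /log_profile !mul0r expr0n/= !addr0 ln1; ring.
  have Sge y := log_profile_ge c y (ltW A0).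
  apply: (@comparison_barrier _ _ _ _ 0 C e _ _ _ (- L) L t1 t H (C2_log_profile A c0) t10).
  - move=> y; rewrite -ler_norml => yL; apply: le_trans (w_le0 _ (ltW t10)) _.
    have PG : P <= C * heatG y t1.
      rewrite /C mulrAC ler_pdivlMr ?G0// ler_pM2l// /heatG ler_pM2l ?invr_gt0 ?sqrtr_gt0//.
      rewrite ler_expR lerN2 !exprMn ler_wpM2r ?sqr_ge0// ler_wpM2r ?sqr_ge0//.
      by rewrite -(real_normK (num_real y)) lerXn2r ?nnegrE// ltW.
    have := Sge y; have : 0 <= e * t1 by rewrite mulr_ge0// ltW.
    rewrite /barrier; slra.
  - move=> s hs; have s0 : 0 < s by slra.
    apply: le_trans (w_le0 _ (ltW s0)) _.
    have : 0 <= e * s by rewrite mulr_ge0// ltW.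
    have : 0 <= C * heatG (- L) s by rewrite mulr_ge0 ?heatG_ge0// ltW.
    have E : log_profile A c (- L) = log_profile A c L.
      by rewrite /log_profile mulNr sqrrN.
    rewrite /barrier E; slra.
  - move=> s hs; have s0 : 0 < s by slra.
    apply: le_trans (w_le0 _ (ltW s0)) _.
    have : 0 <= e * s by rewrite mulr_ge0// ltW.
    have : 0 <= C * heatG L s by rewrite mulr_ge0 ?heatG_ge0// ltW.
    rewrite /barrier; slra.
  - move=> x0 t0' hx0 ht0' hw.
    have t0'0 : 0 < t0' by slra.
    have [xc|cx] := ltrP `|x0| c; last first.
      exists 1, 0; split => //; first by rewrite addr0; apply: le_lt_trans (log_profile2_out (ltW A0) c0 cx) _.
      by move=> y s _ _; exact: source_ge0.
    have neg : A - (w x0 t0' + P) < 0.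
      have : 0 <= e * t0' by rewrite mulr_ge0// ltW.
      have : 0 <= C * heatG x0 t0' by rewrite mulr_ge0 ?heatG_ge0// ltW.
      have := Sge x0; move: hw; rewrite /barrier; slra.
    have cF : {for (x0, t0'), continuous (fun q : R * R => A - (w q.1 q.2 + P))}.
      apply: cvgB; first exact: cvg_cst.
      by apply: cvgD; [exact: (wh_cont H)|exact: cvg_cst].
    have [r r0 hr] := near_le0 (F := fun y s => A - (w y s + P)) cF neg.
    (* Keeps the box inside the strip and after [t1], where [p] is 1 and [psi] is [P]. *)
    pose r' := Num.min r (Num.min (c - `|x0|) (t0' - t1)).
    have r'0 : 0 < r' by rewrite !lt_min r0 !subr_gt0 xc; have /andP[-> _] := ht0'.
    exists r', A; split => //.
      by have := log_profile2_le x0 (ltW A0) c0; slra.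
    move=> y s hy hs s0.
    have r'r : r' <= r by rewrite ge_min lexx.
    have r'c : r' <= c - `|x0| by rewrite !ge_min lexx !orbT.
    have r't : r' <= t0' - t1 by rewrite !ge_min lexx !orbT.
    have yc : `|y| <= c.
      have -> : y = x0 + (y - x0) by ring.
      by have := ler_normD x0 (y - x0); slra.
    have ts : t1 <= s by slra.
    have [p1 psP] := strip y s yc ts.
    rewrite p1 mul1r (uE alpha beta u)// psP.
    have := hr y s (le_trans hy r'r) ltac:(slra); slra.
  - by rewrite oppr_le0 (ltW L0).
  - by rewrite t1t lexx.
apply: le_trans key _.
have : C * heatG 0 t <= d / 2.
  apply: (@le_trans _ _ (C * (Num.sqrt t)^-1)).
    by rewrite ler_pM2l// heatG_le.
  rewrite ler_pdivrMr ?sqrtr_gt0// mulrC -ler_pdivrMr ?divr_gt0//.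
  have -> : C / (d / 2) = 2 * C / d by field; rewrite gt_eqF.
  have Cd0 : 0 <= 2 * C / d by apply: divr_ge0; [apply: mulr_ge0 => //; exact: ltW|exact: ltW].
  by have := ler_wsqrtr Ct; rewrite sqrtr_sqr ger0_norm.
slra.
Qed.

End MainEstimates2.

(** * Convergence to the profile on the half-line *)

Section Asymptotics.
Context {R : realType}.
Variables (alpha beta ustar : R) (u p : R -> R -> R).
Hypotheses (alpha0 : 0 < alpha) (beta0 : 0 < beta).
Hypothesis (hup : weak_solution alpha beta ustar u p).
Implicit Types (x t : R).
Local Notation K := (psi_amplitude alpha beta).
Local Notation P := (Psi alpha beta alpha).
Local Notation psi := (psi alpha beta).
Local Notation w := (wdiff alpha beta u).
Local Notation wx := (wdiff_x alpha beta u).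
Local Notation H := (weak_heat_wdiff alpha0 beta0 hup).
Hypothesis ustarP : ustar < P.

Lemma upper_profile d : 0 < d -> exists T1 C, [/\ 0 < T1, 0 <= C &
  forall x t, 0 <= x -> T1 <= t -> w x t <= - (P * heatE x t) + d + C / Num.sqrt t].
Proof.
move=> d0; have P0 := Psi_alpha_gt0 alpha0 beta0.
have [T1 T10 axis] := w_axis alpha0 beta0 hup ustarP d0.
(* By [heatE_le_heatG] at time [T1], [C * heatG] then covers [P * heatE], so the barrier starts
   above 0, whatever [w] is at that time. *)
pose C := P * (expR 1 * Num.sqrt T1).
have C0 : 0 <= C.
  apply: mulr_ge0; first exact: ltW.
  by apply: mulr_ge0; [exact: expR_ge0|exact: sqrtr_ge0].
exists T1, C; split => // x t x0 T1t.
have t0 : 0 < t by exact: lt_le_trans T1t.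
suff key : w x t <= - (P - d) * heatE x t + C * heatG x t.
  apply: le_trans key _.
  have h1 : C * heatG x t <= C / Num.sqrt t by rewrite ler_wpM2l// heatG_le.
  have h2 : d * heatE x t <= d by rewrite ler_piMr ?(ltW d0)// heatE_le1.
  move: h1 h2; move: (C * heatG x t) (C / _) (heatE x t) => a b e h1 h2; slra.
apply: (@le_perturbation _ _ _ (x ^+ 2 + 3 * t)) => e e0.
have [L [L0 xL ML]] := quadratic_width x e0 (ltW P0).
have -> : - (P - d) * heatE x t + C * heatG x t + e * (x ^+ 2 + 3 * t) =
    barrier (- (P - d)) C (3 * e) (fun x => 0 + e * x ^+ 2) x t.
  by rewrite /barrier; ring.
have ee s : 0 < s -> 0 <= 3 * e * s by move=> s0; rewrite !mulr_ge0// ltW.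
have CG y s : 0 <= C * heatG y s by rewrite mulr_ge0 ?heatG_ge0.
apply: (@comparison_barrier _ _ _ _ (- (P - d)) C (3 * e) _ _ _ 0 L T1 t H (C2_quadratic 0 e) T10).
- move=> y /andP[y0 _]; apply: le_trans (w_le0 alpha0 beta0 hup y (ltW T10)) _.
  have h1 : P * heatE y T1 <= C * heatG y T1.
    by rewrite /C -mulrA ler_pM2l// heatE_le_heatG.
  have h2 : 0 <= d * heatE y T1 by rewrite mulr_ge0 ?heatE_ge0// ltW.
  have h3 : 0 <= e * y ^+ 2 by rewrite mulr_ge0 ?sqr_ge0// ltW.
  have := ee T1 T10; rewrite /barrier; slra.
- move=> s /andP[T1s _]; have s0 : 0 < s by exact: lt_le_trans T1s.
  have := axis s T1s; have := ee s s0; have := CG 0 s.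
  rewrite /barrier heatE0 expr0n/=; slra.
- move=> s /andP[T1s _]; have s0 : 0 < s by exact: lt_le_trans T1s.
  apply: le_trans (w_le0 alpha0 beta0 hup L (ltW s0)) _.
  have h1 : P * heatE L s <= P by rewrite ler_piMr ?(ltW P0)// heatE_le1// ltW.
  have h2 : 0 <= d * heatE L s by rewrite mulr_ge0 ?heatE_ge0// ltW.
  have := ee s s0; have := CG L s; rewrite /barrier; slra.
- move=> x1 t1 _ _ _; exists 1, 0; split => //; first by slra.
  by move=> y s _ _; exact: (source_ge0 alpha0 beta0 hup).
- by rewrite x0 ltW//; move: xL; rewrite ger0_norm.
- by rewrite T1t lexx.
Qed.

Lemma psi_sub_heatE x t : 0 <= x -> 0 < t ->
  psi x t - P * heatE x t = Phi0 alpha beta (x / Num.sqrt t).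
Proof.

move=> x0 t0; have e0 : 0 <= x / Num.sqrt t by rewrite divr_ge0 ?sqrtr_ge0.
rewrite (Phi0E _ alpha0 e0) heatEE.
by rewrite /Defs.psi t0.
Qed.

Lemma sqrt_dominates (C d t : R) : 0 <= C -> 0 < d -> (C / d) ^+ 2 <= t -> 0 < t ->
  C / Num.sqrt t <= d.
Proof.
move=> C0 d0 Ct t0; rewrite ler_pdivrMr ?sqrtr_gt0// mulrC -ler_pdivrMr//.
by have := ler_wsqrtr Ct; rewrite sqrtr_sqr ger0_norm// divr_ge0// ltW.
Qed.

Hypotheses (ustar0 : 0 < ustar) (ustar_u0 : u0star alpha beta < ustar).

(** The running supremum involves all times. The profile bound handles late times for every x >= 0,
    and at early times [psi] itself is small far from the axis. *)
Lemma far_p_eq0 : exists X : R, 0 < X /\ forall x t, X <= x -> 0 <= t -> p x t = 0.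
Proof.
(* Of the gap [4 * d], the profile estimate spends [2 * d]; the rest keeps the running supremum
   strictly below [ustar]. *)
pose d : R := (ustar - u0star alpha beta) / 4.
have d0 : 0 < d by rewrite divr_gt0// subr_gt0.
have [T1 [C [T10 C0 up]]] := upper_profile d0.
pose T2 := Num.max T1 ((C / d) ^+ 2).
have T20 : 0 < T2 by rewrite lt_max T10.
have K0 : 0 < K by exact: psi_amplitude_gt0.
have late x t : 0 <= x -> T2 <= t -> u x t <= ustar - 2 * d.
  rewrite ge_max => x0 /andP[T1t Ct]; have t0 : 0 < t by exact: lt_le_trans T1t.
  rewrite (uE alpha beta u) ?(ltW t0)//.
  have := up x t x0 T1t; have := sqrt_dominates C0 d0 Ct t0.
  have := psi_sub_heatE x0 t0.
  have := @Phi0_le _ alpha beta (x / Num.sqrt t) alpha0 beta0.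
  rewrite divr_ge0 ?sqrtr_ge0// => /(_ isT).
  have : u0star alpha beta = ustar - 4 * d by rewrite /d; field.
  move: (Phi0 _ _ _) (u0star _ _) (C / _) (P * _) (psi x t) (w x t).
  by keep_arith; intros; lra.
have us0 : 0 < ustar / (2 * K) by rewrite divr_gt0// mulr_gt0.
have [z0 [_ hz]] : \forall z \near +oo, erfc z <= ustar / (2 * K).
  have /cvgrPdist_le/(_ _ us0) := @cvg_erfc R.
  apply: filterS => z; rewrite sub0r normrN; exact: le_trans (ler_norm _).
pose z1 := Num.max 1 (z0 + 1).
have z10 : 0 < z1 by rewrite lt_max ltr01.
have ez : erfc z1 <= ustar / (2 * K) by apply: hz; rewrite lt_max ltrDl ltr01 orbT.
(* For [t <= T2] and [X <= x] the argument of [erfc] in [heatE x t] is at least [z1]. *)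
pose X := z1 * 2 * Num.sqrt T2.
have X0 : 0 < X by rewrite !mulr_gt0// sqrtr_gt0.
have early x t : X <= x -> 0 <= t -> t <= T2 -> u x t <= ustar / 2.
  move=> Xx; have x0 : 0 < x by exact: lt_le_trans Xx.
  rewrite le_eqVlt => /predU1P[<- _|t0 tT].
    rewrite (uE alpha beta u)// (weak_heat_initial _ H) addr0 /Defs.psi ltxx gt_eqF//.
    by rewrite divr_ge0// ltW.
  apply: le_trans (u_le_psi alpha0 beta0 hup x (ltW t0)) _.
  apply: le_trans (psi_le_heatE alpha0 beta0 x t0) _.
  have : K * heatE x t <= K * (ustar / (2 * K)).
    rewrite ler_pM2l//; apply: le_trans ez; rewrite heatEE; apply: erfc_le.
    rewrite ler_pdivlMr// ler_pdivlMr ?sqrtr_gt0//; apply: le_trans Xx.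
    by rewrite ler_pM2l ?mulr_gt0// ler_wsqrtr.
  by rewrite (_ : K * (ustar / (2 * K)) = ustar / 2)//; field; rewrite gt_eqF.
exists X; split => // x t Xx t0; apply: (ws_below hup t0).
apply: (@le_lt_trans _ _ (Num.max (ustar / 2) (ustar - 2 * d))%:E); last first.
  rewrite lte_fin gt_max ltrBlDr ltrDl mulr_gt0// andbT ltr_pdivrMr//.
  by rewrite ltr_pMr// ltr1n.
rewrite /running_sup; apply: ge_ereal_sup => _ [s /= + <-].
rewrite in_itv/= => /andP[s0 _].
rewrite lee_fin le_max; have [sT|Ts] := lerP s T2.
  by rewrite early.
by rewrite late ?orbT// ltW// (lt_le_trans X0).
Qed.

(** On [[0, X]] the bound [- P <= w] is already enough, since there [heatE] differs from 1 by O(1 /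
    sqrt t). Beyond [X] the source vanishes and the comparison is with a solution of the heat
    equation. *)
Lemma lower_profile : exists2 C, 0 <= C &
  forall x t, 0 <= x -> 1 <= t -> - (P * heatE x t) - C / Num.sqrt t <= w x t.
Proof.
have P0 := Psi_alpha_gt0 alpha0 beta0.
have K0 : 0 < K by exact: psi_amplitude_gt0.
have [X [X0 far]] := far_p_eq0.
pose c2 := P * X / Num.sqrt pi * expR ((X / 2) ^+ 2).
(* The first constant covers the start at time 1, where [- w <= psi]. The second covers the side
   [x = X]: its exponential offsets the Gaussian factor of [heatG X s], smallest at s = 1. *)
pose C := Num.max (K * expR 1) c2.
have c1C : K * expR 1 <= C by rewrite le_max lexx.
have c2C : c2 <= C by rewrite le_max lexx orbT.
have C0 : 0 < C by apply: lt_le_trans c1C; rewrite mulr_gt0 ?expR_gt0.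
have PX0 : 0 <= P * X / Num.sqrt pi by rewrite divr_ge0 ?sqrtr_ge0// mulr_ge0// ltW.
have PXc2 : P * X / Num.sqrt pi <= c2.
  by rewrite /c2 ler_peMr// -expR0 ler_expR sqr_ge0.
have near_axis x t : 0 <= x -> x <= X -> 0 < t ->
    P <= P * heatE x t + P * X / Num.sqrt pi / Num.sqrt t.
  move=> x0 xX t0; have st : 0 < Num.sqrt t by rewrite sqrtr_gt0.
  have arg0 : 0 <= x / 2 * (Num.sqrt t)^-1 by rewrite mulr_ge0 ?invr_ge0 ?(ltW st)// divr_ge0.
  have h1 := erf_le_linear arg0.
  have h2 : P * erf (x / 2 * (Num.sqrt t)^-1) <= P * (X / Num.sqrt pi / Num.sqrt t).
    rewrite ler_pM2l//; apply: le_trans h1 _.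
    have -> : 2 / Num.sqrt pi * (x / 2 * (Num.sqrt t)^-1) = x / Num.sqrt pi / Num.sqrt t.
      by field; rewrite !gt_eqF// sqrt_pi_gt0.
    by rewrite !ler_pM2r ?invr_gt0// sqrt_pi_gt0.
  have -> : P * heatE x t = P - P * erf (x / 2 * (Num.sqrt t)^-1).
    by rewrite /heatE /erfc mulrBr mulr1.
  have -> : P * X / Num.sqrt pi / Num.sqrt t = P * (X / Num.sqrt pi / Num.sqrt t) by ring.
  by move: h2; set a := P * erf _; set b := P * (_ / _); clearbody a b; slra.
exists C; first exact: ltW.
move=> x t x0 t1; have t0 : 0 < t by exact: lt_le_trans t1.
have st : 0 < Num.sqrt t by rewrite sqrtr_gt0.
have [xX|/ltW Xx] := lerP x X.
  have := w_geNP alpha0 beta0 hup x (ltW t0); have := near_axis x t x0 xX t0.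
  have : P * X / Num.sqrt pi / Num.sqrt t <= C / Num.sqrt t.
    by rewrite ler_pM2r ?invr_gt0// (le_trans PXc2).
  slra.
suff key : - w x t <= P * heatE x t + C * heatG x t.
  have : C * heatG x t <= C / Num.sqrt t by rewrite ler_pM2l// heatG_le.
  slra.
apply: (@le_perturbation _ _ _ (x ^+ 2 + 3 * t)) => e e0.
have [L [L0 xL ML]] := quadratic_width x e0 (ltW P0).
have -> : P * heatE x t + C * heatG x t + e * (x ^+ 2 + 3 * t) =
    barrier P C (3 * e) (fun x => 0 + e * x ^+ 2) x t.
  by rewrite /barrier; ring.
have ee s : 0 < s -> 0 <= 3 * e * s by move=> s0; rewrite !mulr_ge0// ltW.
have CG y s : 0 <= C * heatG y s by rewrite mulr_ge0 ?heatG_ge0// ltW.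
have PE y s : 0 <= P * heatE y s by rewrite mulr_ge0 ?heatE_ge0// ltW.
have ey y : 0 <= e * y ^+ 2 by rewrite mulr_ge0 ?sqr_ge0// ltW.
have wP y s : 0 < s -> - w y s <= P.
  by move=> s0; rewrite lerNl (w_geNP alpha0 beta0 hup)// ltW.
apply: (@comparison_barrier _ _ _ _ P C (3 * e) _ _ _ X L 1 t (weak_heat_opp H)
  (C2_quadratic 0 e) ltr01).
- move=> y /andP[Xy _]; have y0 : 0 <= y by exact: le_trans (ltW X0) Xy.
  have h1 := heatE_le_heatG (ltr01 : 0 < 1 :> R) y0.
  have h2 : - w y 1 <= psi y 1.
    have := u_ge0 alpha0 beta0 hup y (ler01 : 0 <= 1 :> R); rewrite (uE alpha beta u)//; lra.
  have h3 := psi_le_heatE alpha0 beta0 y (ltr01 : 0 < 1 :> R).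
  have h4 : K * heatE y 1 <= K * expR 1 * heatG y 1.
    by rewrite sqrtr1 mulr1 in h1; rewrite -mulrA ler_pM2l.
  have h5 : K * expR 1 * heatG y 1 <= C * heatG y 1 by rewrite ler_wpM2r// heatG_ge0.
  have := ee 1 ltr01; have := PE y 1; have := ey y; rewrite /barrier; slra.
- move=> s /andP[s1 _]; have s0 : 0 < s by exact: lt_le_trans s1.
  have ss : 0 < Num.sqrt s by rewrite sqrtr_gt0.
  have h1 := near_axis X s (ltW X0) (lexx X) s0.
  have h2 : P * X / Num.sqrt pi / Num.sqrt s <= C * heatG X s.
    apply: (@le_trans _ _ (c2 * heatG X s)); last by rewrite ler_wpM2r// heatG_ge0.
    have -> : c2 * heatG X s = P * X / Num.sqrt pi / Num.sqrt s *
        (expR ((X / 2) ^+ 2) * expR (- (X / 2 * (Num.sqrt s)^-1) ^+ 2)).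
      by rewrite /c2 /heatG; ring.
    rewrite ler_peMr//; first by rewrite divr_ge0// ltW.
    rewrite -expRD -[leLHS]expR0 ler_expR subr_ge0 exprMn ler_piMr ?sqr_ge0//.
    by rewrite exprVn sqr_sqrtr ?(ltW s0)// invf_le1.
  have := ee s s0; have := ey X; have := wP X s s0; rewrite /barrier; slra.
- move=> s /andP[s1 _]; have s0 : 0 < s by exact: lt_le_trans s1.
  have := ee s s0; have := wP L s s0; have := CG L s; have := PE L s.
  rewrite /barrier; slra.
- move=> x1 t2 /andP[Xx1 _] _ _; exists (x1 - X), 0; split => //.
  + by rewrite subr_gt0.
  + by slra.
  + move=> y s hy _ s0; rewrite far ?mul0r ?oppr0//.
    by move: hy; rewrite ler_norml; slra.
- by rewrite Xx ltW//; move: xL; rewrite ger0_norm.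
- by rewrite t1 lexx.
Qed.

(** With x = eta sqrt t, [u - Phi0] equals [w + P * heatE], which the upper and lower profile bounds
    enclose uniformly in x. *)
Lemma cvg_to_profile :
  (ereal_sup [set `|u (eta * Num.sqrt t) t - Phi0 alpha beta eta|%:E
             | eta in `[0%R, +oo[]
   @[t --> +oo] --> (0 : \bar R)%E).
Proof.
have bound e : 0 < e -> \forall t \near +oo,
    (0 <= ereal_sup [set `|u (eta * Num.sqrt t) t - Phi0 alpha beta eta|%:E
             | eta in `[0%R, +oo[] <= e%:E)%E.
  move=> e0; have e20 : 0 < e / 2 by rewrite divr_gt0.
  have [T1 [C1 [T10 C10 up]]] := upper_profile e20.
  have [C2 C20 low] := lower_profile.
  pose C := Num.max C1 C2.
  have C0 : 0 <= C by rewrite le_max C10.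
  pose T := Num.max (Num.max T1 1) ((C / (e / 2)) ^+ 2).
  apply: filterS (nbhs_pinfty_ge (num_real T)) => t.
  rewrite /T !ge_max -andbA => /and3P[T1t t1 Ct].
  have t0 : 0 < t by exact: lt_le_trans t1.
  have st : 0 < Num.sqrt t by rewrite sqrtr_gt0.
  have hC := sqrt_dominates C0 e20 Ct t0.
  have C1C : C1 / Num.sqrt t <= C / Num.sqrt t by rewrite ler_pM2r ?invr_gt0// le_max lexx.
  have C2C : C2 / Num.sqrt t <= C / Num.sqrt t by rewrite ler_pM2r ?invr_gt0// le_max lexx orbT.
  apply/andP; split.
    (* The value at [eta = 0] rules out the supremum of the empty set, minus infinity. *)
    apply: (@le_trans _ _ `|u (0 * Num.sqrt t) t - Phi0 alpha beta 0|%:E).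
      by rewrite lee_fin.
    by apply: ereal_sup_ubound; exists 0 => //=; rewrite in_itv/= lexx.
  apply: ge_ereal_sup => _ [eta /= + <-]; rewrite in_itv/= andbT => eta0.
  pose x := eta * Num.sqrt t; have x0 : 0 <= x by rewrite mulr_ge0// ltW.
  have xe : x / Num.sqrt t = eta by rewrite /x mulfK// gt_eqF.
  rewrite lee_fin -/x -xe -(psi_sub_heatE x0 t0) (uE alpha beta u) ?(ltW t0)//.
  have := up x t x0 T1t; have := low x t x0 t1.
  rewrite ler_norml; slra.
apply/fine_cvgP; split.
  apply: filterS (bound 1 ltr01) => t /andP[h0 h1].
  by rewrite fin_numElt (lt_le_trans _ h0)// (le_lt_trans h1)// ltry.
apply/cvgrPdist_le => e e0; apply: filterS (bound e e0) => t /andP[h0 h1] /=.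
rewrite sub0r normrN ger0_norm ?fine_ge0//.
by rewrite -lee_fin fineK// fin_numElt (lt_le_trans _ h0)// (le_lt_trans h1)// ltry.
Qed.

End Asymptotics.

Theorem theorem12 (R : realType) (alpha beta ustar : R) (u p : R -> R -> R)
    (halpha : 0 < alpha) (hbeta : 0 < beta) (hustar : 0 < ustar)
    (hlow : u0star alpha beta < ustar) (hhigh : ustar < Psi alpha beta alpha)
    (hup : weak_solution alpha beta ustar u p) :
  (exists X : R, 0 < X /\
     forall x t : R, X <= x -> 0 <= t -> p x t = 0) /\
  (ereal_sup [set `|u (eta * Num.sqrt t) t - Phi0 alpha beta eta|%:E
             | eta in `[0%R, +oo[]
   @[t --> +oo] --> (0 : \bar R)%E).
Proof.
split; first exact: (far_p_eq0 halpha hbeta hup).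
exact: (cvg_to_profile halpha hbeta hup).
Qed.
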